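(* Let $N\ge1$ be an integer. For a probability measure $\gamma$ on $[0,1]$ write $m_j(\gamma)=\int_0^1x^j\gamma(dx)$. 1. If $\gamma_{\mathtt w}^{(N)}=\sum_{k=1}^N \mathtt w_k\delta_{x_k}$, where $(x_1,\dots,x_N,\mathtt w_1,\dots,\mathtt w_N)$ has distribution $J(4,1,1,N)\otimes \mathrm{Dir}_N(2)$, then the distribution of $\big(m_1(\gamma_{\mathtt w}^{(N)}),\dots,m_{2N-1}(\gamma_{\mathtt w}^{(N)})\big)$ is uniform on $M_{2N-1}^{[0,1]}$. 2. If $\gamma_{\mathtt w}^{(N)}=\mathtt w_0\delta_0+\sum_{k=1}^N \mathtt w_k\delta_{x_k}$, where $(x_1,\dots,x_N,\mathtt w_0,\dots,\mathtt w_N)$ has distribution $J(4,1,3,N)\otimes \mathrm{Dir}(1,2,\dots,2,2)$ (parameter $1$ for $\mathtt w_0$ and parameter $2$ for each of $\mathtt w_1,\dots,\mathtt w_N$), then the distribution of $\big(m_1(\gamma_{\mathtt w}^{(N)}),\dots,m_{2N}(\gamma_{\mathtt w}^{(N)})\big)$ is uniform on $M_{2N}^{[0,1]}$. 3. If $\gamma_{\mathtt w}^{(N)}=\mathtt w_0\delta_0+\sum_{k=1}^{N-1} \mathtt w_k\delta_{x_k}+\mathtt w_N\delta_1$, where $(x_1,\dots,x_{N-1},\mathtt w_0,\dots,\mathtt w_N)$ has distribution $J(4,3,3,N-1)\otimes \mathrm{Dir}(1,2,\dots,2,1)$ (parameter $1$ for $\mathtt w_0$ and $\mathtt w_N$,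 parameter $2$ for each of $\mathtt w_1,\dots,\mathtt w_{N-1}$), then the distribution of $\big(m_1(\gamma_{\mathtt w}^{(N)}),\dots,m_{2N-1}(\gamma_{\mathtt w}^{(N)})\big)$ is uniform on $M_{2N-1}^{[0,1]}$. 4. If $\gamma_{\mathtt w}^{(N)}=\sum_{k=1}^{N} \mathtt w_k\delta_{x_k}+\mathtt w_{N+1}\delta_1$, where $(x_1,\dots,x_N,\mathtt w_1,\dots,\mathtt w_{N+1})$ has distribution $J(4,3,1,N)\otimes \mathrm{Dir}(2,2,\dots,2,1)$ (parameter $2$ for each of $\mathtt w_1,\dots,\mathtt w_N$, parameter $1$ for $\mathtt w_{N+1}$), then the distribution of $\big(m_1(\gamma_{\mathtt w}^{(N)}),\dots,m_{2N}(\gamma_{\mathtt w}^{(N)})\big)$ is uniform on $M_{2N}^{[0,1]}$.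
   Context: For $n\ge1$, $M_n^{[0,1]}=\{(\int_0^1x^k\mu(dx))_{1\le k\le n}:\mu \text{ a probability measure on }[0,1]\}\subset\mathbb{R}^n$; the uniform distribution on $M_n^{[0,1]}$ is normalized Lebesgue measure on this set. For $a,b,\beta>0$, $J(\beta,a,b,N)$ is the probability distribution on $[0,1]^N$ with density proportional to $$|\Delta(x_1,\dots,x_N)|^\beta\prod_{k=1}^N x_k^{b-1}(1-x_k)^{a-1},\qquad \Delta(x_1,\dots,x_N)=\prod_{1\le j<k\le N}(x_j-x_k)$$ (for zero variables it is trivial). For $a_1,\dots,a_{k+1}>0$, $\mathrm{Dir}(a_1,\dots,a_{k+1})$ is the Dirichlet distribution on the simplex $\mathcal S_{k+1}=\{(y_1,\dots,y_{k+1}):y_i>0,\ \sum_iy_i=1\}$, with density $\frac{\Gamma(a_1+\cdots+a_{k+1})}{\Gamma(a_1)\cdots\Gamma(a_{k+1})}\,y_1^{a_1-1}\cdots y_{k+1}^{a_{k+1}-1}$ with respect to Lebesgue measure on $\mathcal S_{k+1}$ (in the coordinates $y_1,\dots,y_k$). When all $a_i=a$ it is denoted $\mathrm{Dir}_{k+1}(a)$. The symbol $\otimes$ denotes product measure: the points $(x_k)$ and the weights $(\mathtt w_k)$ are independent. *)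

(* Defs.v *)
From HB Require Import structures.
From mathcomp Require Import all_boot all_order all_algebra.
From mathcomp Require Import all_classical all_reals all_analysis.
From mathcomp Require Import measurable_realfun.

Set Implicit Arguments.
Unset Strict Implicit.
Unset Printing Implicit Defensive.

Import Order.TTheory GRing.Theory Num.Theory.
Import numFieldNormedType.Exports.

Local Open Scope classical_set_scope.
Local Open Scope ring_scope.

Section lebesgue_tuple_step.
Context {R : realType}.
Variable n : nat.

Definition tuple_cons (p : measurableTypeR R * n.-tuple R) : n.+1.-tuple R :=
  [tuple of p.1 :: p.2].

Lemma measurable_tuple_cons : measurable_fun setT tuple_cons.
Proof.
apply: (@measurable_cons _ _ _ _ (fun p => p.1) n (fun p => p.2)).
- exact: measurable_fst.
- exact: measurable_snd.
Qed.

Lemma measurable_preimage_tuple_cons (A : set (n.+1.-tuple R)) :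
  measurable A -> measurable (tuple_cons @^-1` A).
Proof. by move=> mA; rewrite -[X in measurable X]setTI; exact: measurable_tuple_cons. Qed.

Variable mu : {sigma_finite_measure set (n.-tuple R) -> \bar R}.

Definition lebesgue_step : set (n.+1.-tuple R) -> \bar R :=
  pushforward (@lebesgue_measure R \x mu)%E tuple_cons.

Let step0 : lebesgue_step set0 = 0%E.
Proof. by rewrite /lebesgue_step /pushforward preimage_set0 measure0. Qed.

Let step_ge0 A : (0 <= lebesgue_step A)%E.
Proof. by rewrite /lebesgue_step /pushforward; exact: measure_ge0. Qed.

Let step_sigma_additive : semi_sigma_additive lebesgue_step.
Proof.
rewrite /lebesgue_step; apply: measure_semi_sigma_additive.
exact: measurable_tuple_cons.
Qed.

HB.instance Definition _ := isMeasure.Build _ _ _ lebesgue_step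
  step0 step_ge0 step_sigma_additive.

Lemma measurable_tuple_uncons :
  measurable_fun setT
    (fun t : n.+1.-tuple R =>
      (thead t : measurableTypeR R, [tuple of behead t] : n.-tuple R)).
Proof.
apply/measurable_fun_pairP; split => /=.
- exact: (@measurable_tnth _ (measurableTypeR R) n.+1 ord0).
- exact: measurable_behead.
Qed.

Let step_sigma_finite : sigma_finite setT lebesgue_step.
Proof.
have /sigma_finiteP[F [TF ndF Foo]] := sigma_finiteT (@lebesgue_measure R).
have /sigma_finiteP[G [TG ndG Goo]] := sigma_finiteT mu.
pose g := fun t : n.+1.-tuple R =>
  (thead t : measurableTypeR R, [tuple of behead t] : n.-tuple R).
have gK k : tuple_cons @^-1` (g @^-1` (F k `*` G k)) = F k `*` G k.
  apply/seteqP; split => -[a t]; rewrite /preimage/= /g /tuple_cons/= theadE;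
    by rewrite (_ : ([tuple of behead (a :: t)] : n.-tuple R) = t)//; exact: val_inj.
exists (fun k => g @^-1` (F k `*` G k)).
  rewrite -preimage_bigcup (_ : \bigcup_k _ = setT) ?preimage_setT//.
  rewrite -subTset => -[a t] _.
  have [i _ Fia] : (\bigcup_k F k) a by rewrite -TF.
  have [j _ Gjt] : (\bigcup_k G k) t by rewrite -TG.
  exists (maxn i j) => //; split => /=.
  - by move: a Fia; exact/subsetPset/ndF/leq_maxl.
  - by move: t Gjt; exact/subsetPset/ndG/leq_maxr.
move=> k; have [mFk Fk] := Foo k; have [mGk Gk] := Goo k; split.
  rewrite -[X in measurable X]setTI; apply: measurable_tuple_uncons => //.
  exact: measurableX.
rewrite /lebesgue_step /pushforward gK product_measure1E//.
by rewrite lte_mul_pinfty// ge0_fin_numE.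
Qed.

HB.instance Definition _ := Measure_isSigmaFinite.Build _ _ _ lebesgue_step
  step_sigma_finite.

End lebesgue_tuple_step.

(* Lebesgue measure on R^n, vectors being n-tuples; on R^0 it is the unit mass. *)
Fixpoint lebesgue_tuple (R : realType) (n : nat) :
    {sigma_finite_measure set (n.-tuple R) -> \bar R} :=
  match n with
  | 0 => \d_([tuple] : 0.-tuple R)
  | m.+1 => lebesgue_step (lebesgue_tuple R m)
  end.

Lemma lebesgue_tuple_box (R : realType) (n : nat) (A : nat -> set R) :
  (forall i, measurable (A i)) ->
  lebesgue_tuple R n [set t | forall i : 'I_n, A i (tnth t i)] =
  (\prod_(i < n) lebesgue_measure (A i))%E.
Proof.
elim: n A => [|n IH] A mA.
  by rewrite big_ord0 /= diracE mem_set// => -[].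
pose B : set (n.-tuple R) := [set t | forall i : 'I_n, A i.+1 (tnth t i)].
have mB : measurable B.
  rewrite (_ : B = \bigcap_(i in [set: 'I_n]) ((@tnth n R ^~ i) @^-1` A i.+1)).
    apply: fin_bigcap_measurable; first exact: finite_finset.
    by move=> i _; rewrite -[X in measurable X]setTI; exact: measurable_tnth.
  by apply/seteqP; split => t /= Bt i; [move=> _|]; exact: Bt.
rewrite big_ord_recl -(IH (fun i => A i.+1))// -product_measure1E//=; last exact: mA.
rewrite /lebesgue_step /pushforward; congr (product_measure1 _ _ _).
apply/seteqP; split => -[a t] /=.
- move=> At; split => /=; first exact: (At ord0).
  by move=> i; have := At (lift ord0 i); rewrite /tuple_cons tnthS.
- move=> [Aa Bt] i; case: (unliftP ord0 i) => [j|] ->.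
    by rewrite /tuple_cons tnthS; exact: Bt.
  exact: Aa.
Qed.

Section densities.
Context {R : realType}.

Definition vandermonde n (x : n.-tuple R) : R :=
  \prod_(j < n) \prod_(k < n | (j < k)%N) (tnth x j - tnth x k).

Definition unit_cube n : set (n.-tuple R) :=
  [set x | forall k, 0 <= tnth x k <= 1].
Arguments unit_cube : clear implicits.

(* The exponents are swapped as is customary: b goes with x, a with 1 - x. *)
Definition jacobi_weight (beta a b : R) n (x : n.-tuple R) : R :=
  `|vandermonde x| `^ beta *
  \prod_(k < n) (tnth x k `^ (b - 1) * (1 - tnth x k) `^ (a - 1)).

Definition jacobi (beta a b : R) (n : nat) (A : set (n.-tuple R)) : \bar R :=
  ((\int[lebesgue_tuple R n]_(x in unit_cube n) jacobi_weight beta a b x)^-1%:E *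
   \int[lebesgue_tuple R n]_(x in unit_cube n `&` A)
     (jacobi_weight beta a b x)%:E)%E.

Definition Gamma (a : R) : R :=
  \int[lebesgue_measure]_(t in `]0, +oo[) (t `^ (a - 1) * expR (- t)).

Definition open_simplex m : set (m.-tuple R) :=
  [set y | (forall i, 0 < tnth y i) /\ \sum_(i < m) tnth y i = 1].
Arguments open_simplex : clear implicits.

(* Inverse of the coordinate chart keeping the first m - 1 entries: the value
   nth takes past the end of y provides the missing last entry. *)
Definition complete_simplex m (y : m.-1.-tuple R) : m.-tuple R :=
  [tuple nth (1 - \sum_(z <- y) z) y i | i < m].

Definition dirichlet_pdf m (a y : m.-tuple R) : R :=
  Gamma (\sum_(i < m) tnth a i) / (\prod_(i < m) Gamma (tnth a i)) *
  \prod_(i < m) tnth y i `^ (tnth a i - 1).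

Definition dirichlet m (a : m.-tuple R) (A : set (m.-tuple R)) : \bar R :=
  \int[lebesgue_tuple R m.-1]_(y in @complete_simplex m @^-1` (open_simplex m `&` A))
     (dirichlet_pdf a (complete_simplex y))%:E.

Lemma measurable_unit_cube n : measurable (unit_cube n).
Proof.
rewrite (_ : unit_cube n =
    \bigcap_(k in [set: 'I_n]) ((@tnth n R ^~ k) @^-1` `[0, 1]%classic)).
  apply: fin_bigcap_measurable; first exact: finite_finset.
  move=> k _; rewrite -[X in measurable X]setTI.
  by apply: measurable_tnth => //; exact: measurable_itv.
apply/seteqP; split => x.
- by move=> x01 k _; rewrite /= in_itv/=; exact: x01.
- by move=> x01 k; have := x01 k I; rewrite /= in_itv.
Qed.

Lemma measurable_jacobi_weight (beta a b : R) n :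
  measurable_fun setT (@jacobi_weight beta a b n).
Proof.
have mt k : measurable_fun setT (@tnth n R ^~ k) by exact: measurable_tnth.
apply: measurable_funM.
  apply: (@measurableT_comp _ _ _ _ _ _ (fun z => z `^ beta)).
    exact: measurable_powR.
  apply: measurableT_comp => //; apply: measurable_prod => j _.
  rewrite (_ : (fun _ => _) = fun x : n.-tuple R =>
      \prod_(k <- [seq k : 'I_n <- index_enum _ | (j < k)%N]) (tnth x j - tnth x k)).
    by apply: measurable_prod => k _; exact: measurable_funB.
  by apply/funext => x; rewrite big_filter.
apply: measurable_prod => k _; apply: measurable_funM.
  apply: (@measurableT_comp _ _ _ _ _ _ (fun z => z `^ (b - 1))).
    exact: measurable_powR.
  exact: mt.
apply: (@measurableT_comp _ _ _ _ _ _ (fun z => z `^ (a - 1))).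
  exact: measurable_powR.
exact: measurable_funB.
Qed.

Lemma jacobi_weight_ge0 (beta a b : R) n (x : n.-tuple R) :
  0 <= jacobi_weight beta a b x.
Proof.
apply: mulr_ge0; first exact: powR_ge0.
by apply: prodr_ge0 => k _; rewrite mulr_ge0// powR_ge0.
Qed.

Section jacobi_measure.
Variables (beta a b : R) (n : nat).

Let jacobi0 : @jacobi beta a b n set0 = 0%E.
Proof. by rewrite /jacobi setI0 integral_set0 mule0. Qed.

Let jacobi_ge0 A : (0 <= @jacobi beta a b n A)%E.
Proof.
apply: mule_ge0; last first.
  by apply: integral_ge0 => x _; rewrite lee_fin jacobi_weight_ge0.
rewrite lee_fin invr_ge0; apply: fine_ge0.
by apply: integral_ge0 => x _; rewrite lee_fin jacobi_weight_ge0.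
Qed.

Let jacobi_sigma_additive : semi_sigma_additive (@jacobi beta a b n).
Proof.
move=> F mF tF mUF; apply: cvg_toP.
  apply: ereal_nondecreasing_is_cvgn => k l kl.
  by apply: lee_sum_nneg_natr => // i _ _; exact: jacobi_ge0.
rewrite /jacobi nneseriesZl//; last first.
  by move=> i _; apply: integral_ge0 => x _; rewrite lee_fin jacobi_weight_ge0.
rewrite setI_bigcupr ge0_integral_bigcup//=.
- by move=> i; apply: measurableI => //; exact: measurable_unit_cube.
- apply: measurable_funTS; apply/measurable_EFinP.
  exact: measurable_jacobi_weight.
- by move=> x _; rewrite lee_fin jacobi_weight_ge0.
- exact: trivIset_setIl.
Qed.

HB.instance Definition _ := isMeasure.Build _ _ _ (@jacobi beta a b n)
  jacobi0 jacobi_ge0 jacobi_sigma_additive.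

End jacobi_measure.

Lemma measurable_open_simplex m : measurable (open_simplex m).
Proof.
have mt k : measurable_fun setT (@tnth m R ^~ k) by exact: measurable_tnth.
apply: measurableI.
  rewrite (_ : (fun _ => _) =
      \bigcap_(k in [set: 'I_m]) ((@tnth m R ^~ k) @^-1` `]0, +oo[%classic)).
    apply: fin_bigcap_measurable; first exact: finite_finset.
    move=> k _; rewrite -[X in measurable X]setTI.
    by apply: mt => //; exact: measurable_itv.
  apply/seteqP; split => x.
  - by move=> x0 k _; rewrite /= in_itv/= andbT; exact: x0.
  - by move=> x0 k; have := x0 k I; rewrite /= in_itv/= andbT.
rewrite (_ : (fun _ => _) =
    (fun y : m.-tuple R => \sum_(i < m) tnth y i) @^-1` [set 1])//.
rewrite -[X in measurable X]setTI.
by apply: (@measurable_sum _ _ _ setT _ _ (fun i y => tnth y i)).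
Qed.

Lemma measurable_complete_simplex m : measurable_fun setT (@complete_simplex m).
Proof.
have mt k : measurable_fun setT (@tnth m.-1 R ^~ k) by exact: measurable_tnth.
apply/measurable_fun_tnthP => i; case: (ltnP i m.-1) => im.
  rewrite (_ : _ \o _ = (@tnth m.-1 R ^~ (Ordinal im)))//.
  by apply/funext => y; rewrite /= tnth_mktuple (tnth_nth (1 - \sum_(z <- y) z)).
rewrite (_ : _ \o _ = fun y => 1 - \sum_(j < m.-1) tnth y j).
  apply: measurable_funB => //.
  exact: (@measurable_sum _ _ _ setT _ _ (fun j y => tnth y j)).
apply/funext => y; rewrite /= tnth_mktuple nth_default ?size_tuple//.
by rewrite big_tuple.
Qed.

Lemma measurable_dirichlet_pdf m (a : m.-tuple R) :
  measurable_fun setT (dirichlet_pdf a).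
Proof.
apply: measurable_funM => //; apply: measurable_prod => i _.
apply: (@measurableT_comp _ _ _ _ _ _ (fun z => z `^ (tnth a i - 1))).
  exact: measurable_powR.
exact: measurable_tnth.
Qed.

Lemma Gamma_ge0 (a : R) : 0 <= Gamma a.
Proof.
apply: fine_ge0; apply: integral_ge0 => t _.
by rewrite lee_fin mulr_ge0// ?powR_ge0// expR_ge0.
Qed.

Lemma dirichlet_pdf_ge0 m (a y : m.-tuple R) : 0 <= dirichlet_pdf a y.
Proof.
rewrite mulr_ge0 ?divr_ge0 ?Gamma_ge0//; apply: prodr_ge0 => i _.
  exact: Gamma_ge0.
exact: powR_ge0.
Qed.

Section dirichlet_measure.
Variables (m : nat) (a : m.-tuple R).

Let dirichlet0 : dirichlet a set0 = 0%E.
Proof. by rewrite /dirichlet setI0 preimage_set0 integral_set0. Qed.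

Let dirichlet_ge0 A : (0 <= dirichlet a A)%E.
Proof. by apply: integral_ge0 => y _; rewrite lee_fin dirichlet_pdf_ge0. Qed.

Let dirichlet_sigma_additive : semi_sigma_additive (dirichlet a).
Proof.
move=> F mF tF mUF; apply: cvg_toP.
  apply: ereal_nondecreasing_is_cvgn => k l kl.
  by apply: lee_sum_nneg_natr => // i _ _; exact: dirichlet_ge0.
rewrite /dirichlet setI_bigcupr preimage_bigcup ge0_integral_bigcup//=.
- move=> i; rewrite -[X in measurable X]setTI.
  apply: measurable_complete_simplex => //; apply: measurableI => //.
  exact: measurable_open_simplex.
- apply: measurable_funTS; apply/measurable_EFinP.
  apply: (measurableT_comp (measurable_dirichlet_pdf a)).
  exact: measurable_complete_simplex.
- by move=> y _; rewrite lee_fin dirichlet_pdf_ge0.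
- by move=> i j _ _ [y [[_ Fi] [_ Fj]]]; apply: tF => //; exists (complete_simplex y).
Qed.

HB.instance Definition _ := isMeasure.Build _ _ _ (dirichlet a)
  dirichlet0 dirichlet_ge0 dirichlet_sigma_additive.

End dirichlet_measure.

Definition uniform_on n (M A : set (n.-tuple R)) : \bar R :=
  ((fine (lebesgue_tuple R n M))^-1%:E * lebesgue_tuple R n (M `&` A))%E.

Definition moment (mu : {measure set (measurableTypeR R) -> \bar R}) (j : nat) : R :=
  \int[mu]_(x in `[0, 1]) x ^+ j.

Definition moments (n : nat) (mu : {measure set (measurableTypeR R) -> \bar R}) :
    n.-tuple R :=
  [tuple moment mu k.+1 | k < n].

Definition moment_space (n : nat) : set (n.-tuple R) :=
  [set @moments n mu | mu in
    [set mu : probability (measurableTypeR R) R | mu `[0%R, 1%R]%classic = 1%E]].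

(* The absolute value only makes this a measure for all w: Dirichlet weights
   are almost surely positive. *)
Definition discrete_measure (x w : seq R) : {measure set (measurableTypeR R) -> \bar R} :=
  msum (fun k => mscale (`|w`_k|)%:nng (\d_(x`_k : measurableTypeR R))) (size x).

Lemma discrete_measureE (x w : seq R) A : (forall k, 0 <= w`_k) ->
  discrete_measure x w A = (\sum_(k < size x) (w`_k)%:E * \d_(x`_k) A)%E.
Proof.
move=> w0; rewrite /= /msum; apply: eq_bigr => k _.
by rewrite /mscale/=; congr (_%:E * _)%E; exact: ger0_norm.
Qed.

Lemma moment_discrete_measure (x w : seq R) j :
  (forall k, 0 <= w`_k) -> (forall k, 0 <= x`_k <= 1) ->
  moment (discrete_measure x w) j = \sum_(k < size x) w`_k * x`_k ^+ j.
Proof.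
move=> w0 x01; rewrite /moment /Rintegral /discrete_measure.
have mX : @measurable_fun _ _ (measurableTypeR R) (\bar R) `[0, 1]%classic
    (fun t => (t ^+ j)%:E).
  by apply/measurable_EFinP; exact: measurable_funX.
have X0 (t : measurableTypeR R) : `[0, 1]%classic t -> (0 <= (t ^+ j)%:E :> \bar R)%E.
  by rewrite /= in_itv/= => /andP[t0 _]; rewrite lee_fin exprn_ge0.
rewrite ge0_integral_measure_sum//=.
under eq_bigr => k _.
  rewrite ge0_integral_mscale// integral_dirac// diracE mem_set ?mul1e; last first.
    by rewrite /= in_itv/=; exact: x01.
  rewrite (_ : (_%:num%:E = (w`_k)%:E)%E); last by congr EFin; exact: ger0_norm.
  over.
by rewrite /= sumEFin.
Qed.

End densities.
Arguments jacobi {R} (beta a b)%_R n%_N A.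
Arguments moments {R} n%_N mu.
Arguments moment_space {R} n%_N.

Definition has_law d d' (T : measurableType d) (T' : measurableType d')
    (R : realType) (P : probability T R) (X : T -> T') (nu : set T' -> \bar R) :=
  measurable_fun setT X /\
  forall A, measurable A -> pushforward P X A = nu A.

(* Main.v *)
Require Import Defs.
From HB Require Import structures.
From mathcomp Require Import all_boot all_order all_algebra.
From mathcomp Require Import all_classical all_reals all_analysis.
From mathcomp Require Import measurable_realfun.
From mathcomp Require Import ring lra zify.

(* Let the nodes be z = (0^e0, x_1, ..., x_n, 1^e1) with e0, e1 in {0, 1}, put
   D = 2 n + e0 + e1, and let K_D be the cone of the c in R^D such that
   q |-> sum q_i c_i is nonnegative on the polynomials of degree < D that are
   nonnegative on [0, 1]. The heart of the matter is that for all (e0, e1, n)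
   the image of the measure
     prod_(i <> j) (x_i - x_j)^2 prod x_i^(2 e0) (1 - x_i)^(2 e1) prod w_i dx dw
   (the last product over the interior nodes only) under
   (x, w) |-> (sum_k w_k z_k^j)_(j < D) is n! times Lebesgue measure on K_D.

   This is proved by induction on D, comparing Laplace transforms at the points l
   for which p = sum l_j X^j is positive on [0, 1]. On the side of the nodes one
   integrates prod p(z)^(-1 or -2) against a power of the discriminant; partial
   fractions of p over the nodes write l_(D-1) times the integrand as a sum of
   derivatives in the x_k, so that only boundary terms remain, which are integrals
   of the same kind with an interior node moved to 0 or 1. On the side of the
   cone, the fibre of K_D over a point of K_(D-1) is an interval whose ends are
   the next moments of the two representations of that point (with and without
   the node 1), which leads to the same recursion.

   Normalizing the total mass sum w_k turns the measure on the w_k into a Dirichlet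
   distribution and K_D into its slice c_0 = 1. This slice contains the moment
   space, which in turn contains the Borel set of all moments of measures carried
   by nodes z; the identity just described shows that the slice exceeds the latter
   by a null set only. *)

Import Order.TTheory GRing.Theory Num.Theory.
Import numFieldNormedType.Exports.

Local Open Scope classical_set_scope.
Local Open Scope ring_scope.

(** Laplace transforms compare the two measures as a whole, so that almost everywhere existence of a
    representation by nodes comes out as a consequence and is not an ingredient. On the cone, unlike
    on its slice, the weights are independent, and the transform in them is a product of Gamma
    integrals. The recursion closes because one coefficient plays two roles. The coefficient of
    X^(D-1) in p is the sum of the residues on the side of the nodes, and it is also the variable
    dual to the last coordinate of the cone: integrating an exponential over a fibre gives one
    exponential for each end, divided by this coefficient. All (e0, e1, n) of equal dimension are
    treated together, since the two ends of a fibre belong to representations of different types.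
    The factor n! reflects that the interior nodes are not ordered. The normalizing constants of the
    Jacobi and Dirichlet laws are never evaluated; comparing total masses at the very end identifies
    them. *)

(** * Partial fractions with simple and double poles *)

Section hermite_partial_fractions.
Context {R : fieldType}.
Implicit Types (s : seq R) (m : R -> nat) (p : {poly R}).

Definition node_poly s m : {poly R} := \prod_(a <- s) ('X - a%:P) ^+ m a.

Lemma monic_node_poly s m : node_poly s m \is monic.
Proof. by apply: monic_prod => a _; rewrite monic_exp // monicXsubC. Qed.

Lemma size_node_poly s m : size (node_poly s m) = (\sum_(a <- s) m a).+1.
Proof.
rewrite /node_poly; elim: s => [|a s IH]; first by rewrite !big_nil size_poly1.
rewrite !big_cons size_monicM ?monic_exp ?monicXsubC //; last first.
  by rewrite monic_neq0 // (monic_node_poly s m).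
by rewrite size_exp_XsubC IH addSn /= addnS.
Qed.

Lemma node_poly_eq0 s m a : a \notin s -> (node_poly s m).[a] != 0.
Proof.
move=> as_; rewrite horner_prod prodf_seq_neq0; apply/allP => b bs /=.
rewrite horner_exp hornerXsubC expf_neq0 // subr_eq0.
by apply: contraNneq as_ => ->.
Qed.

Lemma dvdp_node_poly s m (f : {poly R}) : uniq s ->
  (forall a, a \in s -> ('X - a%:P) ^+ m a %| f) -> node_poly s m %| f.
Proof.
rewrite /node_poly; elim: s => [|a s IH] /=; first by rewrite big_nil dvd1p.
move=> /andP[as_ us] Hf; rewrite big_cons Gauss_dvdp; last first.
  apply: coprimep_expl; rewrite coprimep_sym coprimep_XsubC.
  by rewrite /root -/(node_poly s m) node_poly_eq0.
rewrite Hf ?mem_head //= IH // => b bs; apply: Hf.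
by rewrite in_cons bs orbT.
Qed.

Lemma dvdp_XsubC_sqr (f : {poly R}) a :
  f.[a] = 0 -> f^`().[a] = 0 -> ('X - a%:P) ^+ 2 %| f.
Proof.
move=> /eqP/factor_theorem[g ->]; rewrite derivM derivXsubC mulr1.
rewrite hornerD hornerM hornerXsubC subrr mulr0 add0r => /eqP/factor_theorem[h ->].
by rewrite -mulrA -expr2 dvdp_mull.
Qed.

(** The residue at [a] of p divided by [node_poly s m]: with [q] the product of the other factors,
    it is the value of p / q at a simple root and the derivative of p / q at a double root. *)
Definition residue s m p a : R :=
  let q := node_poly (rem a s) m in
  if m a == 2 then (p^`().[a] * q.[a] - p.[a] * q^`().[a]) / q.[a] ^+ 2
  else p.[a] / q.[a].

(** By Hermite interpolation p is the sum of the [h a * Q a], where [h a] is the Taylor part of p /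
    [Q a] at a of degree below [m a]; the statement compares coefficients of degree D - 1.
    Analytically, this coefficient is minus the residue at infinity. *)
Lemma sum_residues s m p : uniq s -> {in s, forall a, m a = 1 \/ m a = 2}%N ->
  (size p <= \sum_(a <- s) m a)%N ->
  p`_(\sum_(a <- s) m a).-1 = \sum_(a <- s) residue s m p a.
Proof.
move=> us m12 sp.
set D := (\sum_(a <- s) m a)%N in sp *.
pose Q a := node_poly (rem a s) m.
pose h a : {poly R} := if m a == 2%N then
    residue s m p a *: ('X - a%:P) + (p.[a] / (Q a).[a])%:P
  else (p.[a] / (Q a).[a])%:P.
have Qa a : a \in s -> (Q a).[a] != 0.
  by move=> as_; apply: node_poly_eq0; rewrite mem_rem_uniqF.
have sD a : a \in s -> (\sum_(b <- rem a s) m b + m a = D)%N.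
  by move=> as_; rewrite /D (perm_big _ (perm_to_rem as_)) big_cons addnC.
have sQ a : a \in s -> (size (Q a) + m a = D.+1)%N.
  by move=> as_; rewrite size_node_poly addSn sD.
have sh a : (size (h a) <= m a)%N \/ ~ (m a = 1 \/ m a = 2)%N.
  rewrite /h; case: eqP => [->|ma2].
    left; rewrite (leq_trans (size_polyD _ _)) // geq_max.
    rewrite (leq_trans (size_scale_leq _ _)) ?size_XsubC //=.
    by rewrite (leq_trans (size_polyC_leq1 _)).
  have [->|ma1] := eqVneq (m a) 1%N; first by left; exact: size_polyC_leq1.
  by right => -[]// /eqP; rewrite (negbTE ma1).
have {}sh a : a \in s -> (size (h a) <= m a)%N.
  by move=> as_; case: (sh a) => // /(_ (m12 a as_)).
pose H := \sum_(a <- s) h a * Q a.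
have sH : (size H <= D)%N.
  rewrite /H big_seq; apply: (leq_trans (size_sum _ _ _)).
  apply/bigmax_leqP_seq => a as_ _.
  rewrite (leq_trans (size_polyMleq _ _)) //.
  by have := sQ a as_; have := sh a as_; lia.
(* The difference vanishes to order [m a] at every node a, because each other term contains the full
   factor at a; having degree below D, it is zero. *)
have pH : p = H.
  apply/eqP; rewrite -subr_eq0; apply/eqP.
  have : node_poly s m %| p - H.
    apply: dvdp_node_poly => // a as_.
    have -> : p - H = (p - h a * Q a) - \sum_(b <- rem a s) h b * Q b.
      by rewrite /H (perm_big _ (perm_to_rem as_)) big_cons opprD addrA.
    apply: dvdp_sub.
      rewrite /h; case: eqP => [ma|ma2].
        rewrite ma; apply: dvdp_XsubC_sqr.
          by rewrite !hornerE subrr mulr0 add0r divfK ?subrr // Qa.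
        rewrite derivB derivM derivD derivZ derivXsubC derivC addr0 !hornerE /=.
        rewrite subrr mulr0 add0r /residue ma eqxx -/(Q a).
        by field; exact: Qa.
      have -> : m a = 1%N by case: (m12 a as_).
      by rewrite expr1 dvdp_XsubCl /root !hornerE divfK ?subrr // Qa.
    rewrite big_seq; apply: (big_ind (fun f => ('X - a%:P) ^+ m a %| f)).
    - exact: dvdp0.
    - by move=> f g; exact: dvdp_add.
    move=> b bs; apply: dvdp_mull; rewrite /Q /node_poly.
    have ab : a \in rem b s.
      rewrite mem_rem_uniq // inE as_ andbT; apply: contraTneq bs => ->.
      by rewrite mem_rem_uniqF.
    by rewrite (big_rem a ab) /=; exact: dvdp_mulr.
  move=> dv; apply: contraTeq dv => nz; apply/negP => /(dvdp_leq nz).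
  rewrite size_node_poly -/D; apply/negP; rewrite -ltnNge ltnS.
  by rewrite (leq_trans (size_polyD _ _)) // geq_max sp size_polyN.
rewrite [in LHS]pH /H coef_sum big_seq [RHS]big_seq; apply: eq_bigr => a as_.
have mQ : Q a \is monic by exact: monic_node_poly.
(* [Q a] is monic of degree D - [m a], so only the top coefficient of [h a] reaches degree D - 1. *)
have hQ : (h a * Q a)`_D.-1 = (h a)`_(m a).-1.
  have ma : (0 < m a)%N by case: (m12 a as_) => ->.
  have D1 : D.-1 = ((m a).-1 + (size (Q a)).-1)%N.
    have := sQ a as_; have : (0 < size (Q a))%N by rewrite size_node_poly.
    lia.
  rewrite D1 coefM.
  rewrite (bigD1 (inord (m a).-1)) //= inordK ?ltnS ?leq_addr //.
  rewrite addKn -/(lead_coef (Q a)) (monicP mQ) mulr1 big1 ?addr0 // => i ine.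
  have [im|im] := ltnP i (m a); last first.
    by rewrite (nth_default _ (leq_trans (sh a as_) im)) mul0r.
  rewrite [X in _ * X]nth_default ?mulr0 //.
  have : nat_of_ord i != (m a).-1.
    by apply: contraNneq ine => ie; apply/eqP/val_inj; rewrite /= inordK ?ltnS ?leq_addr.
  by move/eqP; lia.
rewrite hQ /h /residue; case: eqP => [->|ma2].
  by rewrite coefD coefZ coefB !coefC coefX /= subr0 mulr1 addr0.
have -> : m a = 1%N by case: (m12 a as_).
by rewrite coefC.
Qed.

End hermite_partial_fractions.

(** * Inserting and deleting a coordinate *)

Section insertion.
Context {T : Type} {n : nat}.

(** The index k witnesses that n is positive, so the types n and [n.-1] allow the removal of a node
    to be stated for every n. *)
Definition tuple_insert (k : 'I_n) (t : T) (y : n.-1.-tuple T) : n.-tuple T :=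
  [tuple if unlift k i is Some j then tnth y j else t | i < n].

Definition tuple_delete (k : 'I_n) (x : n.-tuple T) : n.-1.-tuple T :=
  [tuple tnth x (lift k j) | j < n.-1].

Lemma tnth_insert k t y : tnth (tuple_insert k t y) k = t.
Proof. by rewrite tnth_mktuple unlift_none. Qed.

Lemma tnth_insert_lift k t y j :
  tnth (tuple_insert k t y) (lift k j) = tnth y j.
Proof. by rewrite tnth_mktuple liftK. Qed.

Lemma tnth_delete k x j : tnth (tuple_delete k x) j = tnth x (lift k j).
Proof. by rewrite tnth_mktuple. Qed.

Lemma insertK k t : cancel (tuple_insert k t) (tuple_delete k).
Proof.
by move=> y; apply: eq_from_tnth => j; rewrite tnth_delete tnth_insert_lift.
Qed.

Lemma deleteK k x : tuple_insert k (tnth x k) (tuple_delete k x) = x.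
Proof.
apply: eq_from_tnth => i; case: (unliftP k i) => [j|] ->.
  by rewrite tnth_insert_lift tnth_delete.
by rewrite tnth_insert.
Qed.

End insertion.

Lemma big_ord_lift {S : Type} {idx : S} {op : Monoid.com_law idx} n
    (k : 'I_n) (F : 'I_n -> S) :
  \big[op/idx]_(i < n) F i = op (F k) (\big[op/idx]_(j < n.-1) F (lift k j)).
Proof. by case: n k F => [[]//|n] k F; exact: bigD1_ord. Qed.

Lemma big_ord_lift_neq {S : Type} {idx : S} {op : Monoid.com_law idx} n
    (k : 'I_n) (F : 'I_n -> S) :
  \big[op/idx]_(i < n | i != k) F i = \big[op/idx]_(j < n.-1) F (lift k j).
Proof.
rewrite big_mkcond (big_ord_lift n k) eqxx /= Monoid.mul1m.
by apply: eq_bigr => j _; rewrite eq_sym neq_lift.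
Qed.

Lemma big_ord_lift_neq2 {S : Type} {idx : S} {op : Monoid.com_law idx} n
    (k : 'I_n) (l : 'I_n.-1) (F : 'I_n -> S) :
  \big[op/idx]_(i < n | i != lift k l) F i =
  op (F k) (\big[op/idx]_(j < n.-1 | j != l) F (lift k j)).
Proof.
rewrite big_mkcond (big_ord_lift n k) /= neq_lift; congr (op _ _).
by rewrite [RHS]big_mkcond; apply: eq_bigr => j _; rewrite (inj_eq lift_inj).
Qed.

(** * The Laplace integrand and its expression through fluxes *)

Section weights.
Context {R : realFieldType}.

(** Ordered pairs are used, so each pair of nodes enters with total exponent 4: this is the fourth
    power of the Vandermonde product. *)
Definition sqdisc n (x : n.-tuple R) : R :=
  \prod_(i < n) \prod_(j < n | j != i) (tnth x i - tnth x j) ^+ 2.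

(** As in a confluent Vandermonde determinant, two nodes contribute their distance to the product of
    their multiplicities: 4 for two interior nodes, 2 for an interior node and an end. *)
Definition node_weight (e0 e1 : bool) n (x : n.-tuple R) : R :=
  sqdisc n x *
  \prod_(k < n) (tnth x k ^+ (2 * e0) * (1 - tnth x k) ^+ (2 * e1)).

(* The factors 1 / p come from integrating exp (- w p z) against w at a double
   node z, and against 1 at the simple nodes 0 and 1. *)
Definition laplace_weight (e0 e1 : bool) (p : {poly R}) n (x : n.-tuple R) : R :=
  node_weight e0 e1 n x * (\prod_(k < n) p.[tnth x k] ^- 2) *
  (p.[0] ^- e0 * p.[1] ^- e1).

(** The node polynomial with interior nodes double and ends simple. The factor X - 1 keeps it monic
    at the price of a sign on [0, 1] when [e1] holds, which is the origin of the [(-1) ^+ e1] in the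
    recursion. *)
Definition gap_poly (e0 e1 : bool) n (y : n.-tuple R) : {poly R} :=
  'X ^+ e0 * ('X - 1) ^+ e1 * \prod_(j < n) ('X - (tnth y j)%:P) ^+ 2.

(* Minus the derivative at t of laplace_weight y * gap_poly / p. *)
Definition flux (e0 e1 : bool) (p : {poly R}) n (t : R) (y : n.-tuple R) : R :=
  - laplace_weight e0 e1 p n y *
  (((gap_poly e0 e1 n y)^`().[t] * p.[t] - (gap_poly e0 e1 n y).[t] * p^`().[t])
   / p.[t] ^+ 2).

Lemma sqdisc_ge0 n x : 0 <= sqdisc n x.
Proof. by do 2 (apply: prodr_ge0 => ? _); exact: sqr_ge0. Qed.

Lemma node_weight_ge0 e0 e1 n x : 0 <= node_weight e0 e1 n x.
Proof.
rewrite mulr_ge0 ?sqdisc_ge0 //; apply: prodr_ge0 => k _.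
by rewrite !exprM mulr_ge0 // exprn_ge0 // sqr_ge0.
Qed.

Lemma sqdisc_insert n (k : 'I_n) t y :
  sqdisc n (tuple_insert k t y) =
  sqdisc n.-1 y * (\prod_(j < n.-1) (t - tnth y j) ^+ 2) ^+ 2.
Proof.
rewrite /sqdisc (big_ord_lift n k) big_ord_lift_neq tnth_insert.
under eq_bigr do rewrite tnth_insert_lift.
under [X in _ * X = _]eq_bigr => i _.
  rewrite big_ord_lift_neq2 tnth_insert tnth_insert_lift.
  under eq_bigr do rewrite tnth_insert_lift.
  rewrite -sqrrN opprB.
  over.
by rewrite big_split /= mulrA mulrC expr2.
Qed.

Lemma sqdisc_eq0 n (x : n.-tuple R) i j :
  i != j -> tnth x i = tnth x j -> sqdisc n x = 0.
Proof.
move=> ij xij; apply/eqP/prodf_eq0; exists i => //.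
by apply/prodf_eq0; exists j; rewrite 1?eq_sym // xij subrr expr0n.
Qed.

Lemma horner_gap_poly e0 e1 n (y : n.-tuple R) t :
  (gap_poly e0 e1 n y).[t] =
  t ^+ e0 * (t - 1) ^+ e1 * \prod_(j < n) (t - tnth y j) ^+ 2.
Proof.
rewrite /gap_poly !hornerM !horner_exp horner_prod !hornerE /=.
by congr (_ * _); apply: eq_bigr => j _; rewrite !hornerE.
Qed.

Lemma node_weight_insert e0 e1 n (k : 'I_n) t y :
  node_weight e0 e1 n (tuple_insert k t y) =
  node_weight e0 e1 n.-1 y * (gap_poly e0 e1 n.-1 y).[t] ^+ 2.
Proof.
rewrite /node_weight sqdisc_insert (big_ord_lift n k) tnth_insert.
under [X in _ * (_ * X) = _]eq_bigr do rewrite tnth_insert_lift.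
rewrite horner_gap_poly ![(2 * nat_of_bool _)%N]mulnC !exprM.
rewrite -[in (1 - t) ^+ e1]opprB [(- (t - 1)) ^+ e1]exprNn.
rewrite [X in _ * (_ * X ^+ 2 * _)](_ : _ = (-1) ^+ e1 * (t - 1) ^+ e1) //.
rewrite [((-1) ^+ e1 * _) ^+ 2]exprMn -[((-1) ^+ e1) ^+ 2]exprM mulnC exprM sqrrN.
by rewrite expr1n expr1n; ring.
Qed.

Lemma laplace_weight_insert e0 e1 p n (k : 'I_n) t y :
  laplace_weight e0 e1 p n (tuple_insert k t y) =
  laplace_weight e0 e1 p n.-1 y *
  ((gap_poly e0 e1 n.-1 y).[t] ^+ 2 / p.[t] ^+ 2).
Proof.
rewrite /laplace_weight node_weight_insert (big_ord_lift n k) tnth_insert.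
under [X in _ * (_ * X) * _ = _]eq_bigr do rewrite tnth_insert_lift.
by ring.
Qed.

Lemma node_weight_true0 e1 n (x : n.-tuple R) :
  node_weight true e1 n x =
  node_weight false e1 n x * \prod_(k < n) tnth x k ^+ 2.
Proof.
rewrite /node_weight -mulrA; congr (_ * _); rewrite -big_split /=.
by apply: eq_bigr => k _; rewrite muln1 muln0 expr0; ring.
Qed.

Lemma node_weight_true1 e0 n (x : n.-tuple R) :
  node_weight e0 true n x =
  node_weight e0 false n x * \prod_(k < n) (1 - tnth x k) ^+ 2.
Proof.
rewrite /node_weight -mulrA; congr (_ * _); rewrite -big_split /=.
by apply: eq_bigr => k _; rewrite muln1 muln0 expr0; ring.
Qed.

(** The quotient on the left is the residue at the simple node 0. It cancels 1 / p(0) and the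
    repulsion x_k^2 from 0, so that the weight without this node remains. *)
Lemma laplace_weight_drop0 e1 p n (x : n.-tuple R) : p.[0] != 0 ->
  (forall k, tnth x k != 0) ->
  laplace_weight true e1 p n x * (p.[0] / (gap_poly false e1 n x).[0]) =
  (-1) ^+ e1 * laplace_weight false e1 p n x.
Proof.
move=> p0 x0; rewrite horner_gap_poly /laplace_weight node_weight_true0 sub0r.
rewrite [X in _ / (_ * X)](eq_bigr (fun k => tnth x k ^+ 2)); last by move=> k _; rewrite sub0r sqrrN.
have X0 : \prod_(k < n) tnth x k ^+ 2 != 0.
  by apply/prodf_neq0 => k _; rewrite sqrf_eq0.
set X := \prod_(k < n) tnth x k ^+ 2 in X0 *.
set c := p.[1] ^- e1; rewrite expr0 expr1 invr1.
by case: e1 @c => c; rewrite /= ?expr0 ?expr1; field; rewrite ?X0 ?p0.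
Qed.

Lemma laplace_weight_drop1 e0 p n (x : n.-tuple R) : p.[1] != 0 ->
  (forall k, tnth x k != 1) ->
  laplace_weight e0 true p n x * (p.[1] / (gap_poly e0 false n x).[1]) =
  laplace_weight e0 false p n x.
Proof.
move=> p1 x1; rewrite horner_gap_poly /laplace_weight node_weight_true1 expr1n.
have X0 : \prod_(k < n) (1 - tnth x k) ^+ 2 != 0.
  by apply/prodf_neq0 => k _; rewrite sqrf_eq0 subr_eq0 eq_sym.
set X := \prod_(k < n) (1 - tnth x k) ^+ 2 in X0 *.
set c := p.[0] ^- e0; rewrite expr0 expr1 invr1.
by field; rewrite ?X0 ?p1.
Qed.

Lemma flux_eq0 e0 e1 p n (y : n.-tuple R) j :
  flux e0 e1 p n (tnth y j) y = 0.
Proof.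
rewrite /flux.
have [g ->] : exists g, gap_poly e0 e1 n y = g * ('X - (tnth y j)%:P) ^+ 2.
  eexists; rewrite /gap_poly (bigD1 j) //= mulrA mulrAC; reflexivity.
rewrite expr2 mulrA derivM derivXsubC mulr1.
by rewrite hornerD !hornerM !hornerXsubC subrr !(mulr0, mul0r, addr0, subr0).
Qed.

(** The multiplicity can be read off the value of a node because interior nodes will lie strictly
    between 0 and 1. *)
Let mult (a : R) : nat := if (a == 0) || (a == 1) then 1%N else 2%N.

(* Residues of p / (X^e0 (X - 1)^e1 prod (X - x_k)^2): the residue at the double
   pole x_k, multiplied by the weight, is a total derivative in x_k because the
   discriminant of x is that of the other nodes times a fourth power. *)
Lemma laplace_weight_flux (e0 e1 : bool) (p : {poly R}) n (x : n.-tuple R) :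
  (forall t, 0 <= t <= 1 -> p.[t] != 0) -> (forall k, 0 < tnth x k < 1) ->
  (size p <= 2 * n + e0 + e1)%N ->
  p`_(2 * n + e0 + e1).-1 * laplace_weight e0 e1 p n x =
  \sum_(k < n) flux e0 e1 p n.-1 (tnth x k) (tuple_delete k x) +
  ((-1) ^+ e1 * laplace_weight false e1 p n x) *+ e0 +
  laplace_weight e0 false p n x *+ e1.
Proof.
move=> p0 x01 sp.
have x0 k : tnth x k != 0 by case/andP: (x01 k) => /lt0r_neq0.
have x1 k : tnth x k != 1 by case/andP: (x01 k) => _ /lt_eqF ->.
have px k : p.[tnth x k] != 0.
  by apply: p0; case/andP: (x01 k) => /ltW -> /ltW ->.
have [/injectiveP xinj|/injectivePn[i [j ij xij]]] := boolP (injectiveb (tnth x)).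
  pose s := nseq e0 0 ++ (x ++ nseq e1 1) : seq R.
  have ux : uniq x by apply/(tuple_uniqP x).
  have x0' : 0 \notin x by apply/negP => /tnthP[k /eqP]; rewrite eq_sym (negbTE (x0 k)).
  have x1' : 1 \notin x by apply/negP => /tnthP[k /eqP]; rewrite eq_sym (negbTE (x1 k)).
  have us : uniq s.
    rewrite /s; move: e0 e1 {sp s} => [] []; rewrite /= ?cats0 ?cats1 ?mem_rcons ?rcons_uniq ?inE.
    - by rewrite eq_sym oner_eq0 x0' x1' ux.
    - by rewrite x0' ux.
    - by rewrite x1' ux.
    - by [].
  have mx k : mult (tnth x k) = 2%N by rewrite /mult (negbTE (x0 k)) (negbTE (x1 k)).
  have sm : (\sum_(a <- s) mult a = 2 * n + e0 + e1)%N.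
    rewrite /s !big_cat /= big_tuple !big_nseq.
    rewrite [X in (_ + (X + _))%N](eq_bigr (fun=> 2%N)) // sum_nat_const card_ord.
    by case: e0 {sp s us}; case: e1; rewrite /= /mult ?eqxx ?orbT /=; lia.
  have := @sum_residues _ s mult p us; rewrite sm => -> //; last first.
    by move=> a _; rewrite /mult; case: ifP; [left|right].
  have nps : node_poly s mult = gap_poly e0 e1 n x.
    rewrite /node_poly /s /gap_poly !big_cat /= big_tuple !big_nseq /=.
    rewrite [X in _ * (X * _)](eq_bigr (fun k => ('X - (tnth x k)%:P) ^+ 2)); last first.
      by move=> k _; rewrite mx.
    by case: e0 {sp s us sm}; case: e1; rewrite /= /mult ?eqxx ?orbT /= ?subr0 ?polyC0 ?polyC1; ring.
  have npr a : a \in s ->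
      node_poly (rem a s) mult * ('X - a%:P) ^+ mult a = gap_poly e0 e1 n x.
    move=> as_; rewrite -nps /node_poly (perm_big _ (perm_to_rem as_)) big_cons.
    by rewrite mulrC.
  have gx k : node_poly (rem (tnth x k) s) mult = gap_poly e0 e1 n.-1 (tuple_delete k x).
    apply: (@mulIf _ (('X - (tnth x k)%:P) ^+ 2)).
      by rewrite expf_neq0 // polyXsubC_eq0.
    rewrite -{1}(mx k) npr ?/s ?mem_cat ?mem_tnth ?orbT //.
    rewrite /gap_poly (big_ord_lift n k) /=.
    rewrite -[RHS]mulrA; congr (_ * _); rewrite [RHS]mulrC; congr (_ * _).
    by apply: eq_bigr => j _; rewrite tnth_delete.
  rewrite mulr_suml /s !big_cat /= big_tuple.
  have rx k : residue s mult p (tnth x k) * laplace_weight e0 e1 p n x =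
      flux e0 e1 p n.-1 (tnth x k) (tuple_delete k x).
    rewrite -{2}(deleteK k x) laplace_weight_insert /residue mx eqxx gx /flux.
    have q0 : (gap_poly e0 e1 n.-1 (tuple_delete k x)).[tnth x k] != 0.
      rewrite -gx node_poly_eq0 // mem_rem_uniqF //.
    by field; rewrite q0 px.
  rewrite (eq_bigr _ (fun k _ => rx k)).
  rewrite addrCA addrA -!addrA; congr (_ + (_ + _)).
    rewrite big_nseq; case: e0 {sp nps gx rx} @s us sm npr => s us sm npr //=.
    rewrite addr0 mulr1n -laplace_weight_drop0 ?p0 ?lexx ?ler01 // mulrC.
    rewrite /residue (_ : mult 0 = 1%N) /=; last by rewrite /mult eqxx.
    congr (_ * (_ / _)); congr (_.[_]).
    apply: (@mulIf _ 'X); first by rewrite polyX_eq0.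
    transitivity (gap_poly true e1 n x).
      by rewrite -(npr 0) ?mem_head // (_ : mult 0 = 1%N) ?subr0 // /mult eqxx.
    by rewrite /gap_poly /= expr0 expr1; ring.
  rewrite big_nseq; case: e1 {sp nps gx rx} @s us sm npr => s us sm npr //=.
  rewrite addr0 mulr1n -laplace_weight_drop1 ?p0 ?lexx ?ler01 // mulrC.
  rewrite /residue (_ : mult 1 = 1%N) /=; last by rewrite /mult eqxx orbT.
  congr (_ * (_ / _)); congr (_.[_]).
  apply: (@mulIf _ ('X - 1)); first by rewrite -polyC1 polyXsubC_eq0.
  transitivity (gap_poly e0 true n x).
    rewrite -(npr 1); last by rewrite !mem_cat mem_head !orbT.
    by rewrite (_ : mult 1 = 1%N) ?polyC1 // /mult eqxx orbT.
  by rewrite /gap_poly /= expr0 expr1; ring.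
(* Two nodes coincide, so the discriminant kills all weights. Each flux vanishes too: through the
   discriminant if both nodes survive the deletion, through the double root of [gap_poly]
   otherwise. *)
have W0 e e' : laplace_weight e e' p n x = 0.
  by rewrite /laplace_weight /node_weight (sqdisc_eq0 _ _ i j) // !mul0r.
rewrite !W0 !mulr0 !mul0rn !addr0 big1 // => k _.
wlog ki : i j ij xij / k != i.
  move=> H; have [ki|] := eqVneq k i; last exact: (H i j).
  by apply: (H j i); [rewrite eq_sym| |rewrite ki].
case: (unliftP k i) ij xij ki => [i'|] ->; last by rewrite eqxx.
have [->|kj] := eqVneq k j.
  by move=> _ <- _; rewrite -tnth_delete flux_eq0.
case: (unliftP k j) kj => [j'|] ->; last by rewrite eqxx.
move=> _ ij xij _; rewrite /flux /laplace_weight /node_weight.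
rewrite (sqdisc_eq0 _ _ i' j') ?mul0r ?oppr0 ?mul0r // ?tnth_delete //.
by rewrite -(inj_eq (@lift_inj _ k)).
Qed.

End weights.

(** * Measures with a density *)

Section density.
Context {d} {T : measurableType d} {R : realType}.
Variables (mu : {measure set T -> \bar R}) (g : T -> R).
Hypotheses (mg : measurable_fun setT g) (g0 : forall x, 0 <= g x).

(** The two proofs are arguments so that the structure of a measure can be attached to the term
    itself. *)
Definition mdensity (_ : measurable_fun setT g) (_ : forall x, 0 <= g x)
    (A : set T) : \bar R := (\int[mu]_(x in A) (g x)%:E)%E.

Let mgE (D : set T) : measurable_fun D (fun x => (g x)%:E).
Proof. by apply: measurable_funTS; apply/measurable_EFinP. Qed.

Let mdensity0 : mdensity mg g0 set0 = 0%E.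
Proof. exact: integral_set0. Qed.

Let mdensity_ge0 A : (0 <= mdensity mg g0 A)%E.
Proof. by apply: integral_ge0 => x _; rewrite lee_fin. Qed.

Let mdensity_sigma_additive : semi_sigma_additive (mdensity mg g0).
Proof.
move=> F mF tF mUF; apply: cvg_toP.
  apply: ereal_nondecreasing_is_cvgn => k l kl.
  by apply: lee_sum_nneg_natr => // i _ _; exact: mdensity_ge0.
by rewrite /mdensity ge0_integral_bigcup// => x _; rewrite lee_fin.
Qed.

HB.instance Definition _ := isMeasure.Build _ _ _ (mdensity mg g0)
  mdensity0 mdensity_ge0 mdensity_sigma_additive.

Import HBNNSimple.

Lemma ge0_integral_density (h : T -> \bar R) :
  measurable_fun setT h -> (forall x, 0 <= h x)%E ->
  (\int[mdensity mg g0]_x h x = \int[mu]_x ((g x)%:E * h x))%E.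
Proof.
move=> mh h0.
pose f := nnsfun_approx measurableT mh.
transitivity (limn (fun n => \int[mdensity mg g0]_x (f n x)%:E))%E.
  rewrite -monotone_convergence//.
  - apply: eq_integral => y _; apply/esym/cvg_lim => //.
    by apply: cvg_nnsfun_approx => // *; exact: h0.
  - by move=> n; exact/measurable_EFinP/measurable_funP.
  - by move=> n y _; rewrite lee_fin.
  - by move=> y _ m n mn; rewrite lee_fin; exact/lefP/nd_nnsfun_approx.
have fE n : (\int[mdensity mg g0]_x (f n x)%:E = \int[mu]_x ((g x)%:E * (f n x)%:E))%E.
  have fsum x : ((f n x)%:E =
      \sum_(r \in range (f n)) (r * \1_(f n @^-1` [set r]) x)%:E)%E.
    by rewrite fsumEFin// -fimfunE.
  transitivity (\int[mdensity mg g0]_x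
      \sum_(r \in range (f n)) (r * \1_(f n @^-1` [set r]) x)%:E)%E.
    by apply: eq_integral => x _.
  rewrite ge0_integral_fsum//; last 2 first.
  - by move=> y; exact/measurable_EFinP/measurable_funM.
  - by move=> y x _; rewrite nnfun_muleindic_ge0.
  transitivity (\int[mu]_x
      \sum_(r \in range (f n)) ((g x)%:E * (r * \1_(f n @^-1` [set r]) x)%:E))%E.
    2: by apply: eq_integral => x _; rewrite fsum ge0_mule_fsumr// => r;
      rewrite EFinM nnfun_muleindic_ge0.
  rewrite ge0_integral_fsum//; last 2 first.
  - move=> r; apply: emeasurable_funM => //.
    exact/measurable_EFinP/measurable_funM.
  - by move=> r x _; rewrite mule_ge0 ?lee_fin// -lee_fin EFinM nnfun_muleindic_ge0.
  apply: eq_fsbigr => r _; rewrite integralZl_indic_nnsfun// integral_indic// setIT.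
  have [r0|r0] := leP 0 r; last first.
    rewrite preimage_nnfun0// measure0 mule0; apply/esym; apply: integral0_eq => x _.
    by rewrite indic0 mulr0 mule0.
  transitivity (r%:E * \int[mu]_x ((g x)%:E * (\1_(f n @^-1` [set r]) x)%:E))%E.
    congr (_ * _)%E; rewrite /= /mdensity integral_mkcond.
    apply: eq_integral => x _; rewrite patchE indicE.
    by case: ifPn => _; rewrite ?mule1 ?mule0.
  rewrite -ge0_integralZl//.
  - by apply: eq_integral => x _; rewrite EFinM muleCA.
  - by apply: emeasurable_funM => //; exact/measurable_EFinP.
  - by move=> x _; rewrite mule_ge0// lee_fin.
under eq_fun do rewrite fE.
rewrite -monotone_convergence//.
- apply: eq_integral => x _; apply/cvg_lim => //; apply: cvgeZl => //.
  by apply: cvg_nnsfun_approx => // *; exact: h0.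
- by move=> n; apply: emeasurable_funM => //; exact/measurable_EFinP/measurable_funP.
- by move=> n x _; rewrite mule_ge0// lee_fin.
- move=> x _ m n mn; apply: lee_wpmul2l; rewrite ?lee_fin//.
  exact/lefP/nd_nnsfun_approx.
Qed.

End density.
Arguments mdensity {d T R} mu {g}.

Lemma le_ge0_integral d (T : measurableType d) (R : realType)
    (mu : {measure set T -> \bar R}) (f g : T -> \bar R) :
  (forall x, 0 <= f x)%E -> (forall x, f x <= g x)%E ->
  (\int[mu]_x f x <= \int[mu]_x g x)%E.
Proof.
move=> f0 fg; have g0 x : (0 <= g x)%E by exact: le_trans (fg x).
rewrite !ge0_integralTE//; apply: le_ereal_sup => _ [h hf <-].
by exists h => // x; exact: le_trans (hf x) _.
Qed.

(** Holds for arbitrary sets: the value is an iterated integral, and the integral of a nonnegative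
    function is a supremum over the simple functions below it. This is what allows the moment space
    to be squeezed between two measurable sets. *)
Lemma le_lebesgue_tuple (R : realType) n (A B : set (n.-tuple R)) :
  A `<=` B -> (lebesgue_tuple R n A <= lebesgue_tuple R n B)%E.
Proof.
elim: n A B => [|n IH] A B AB.
  rewrite /= !diracE lee_fin ler_nat; case: (boolP (_ \in A)) => // /[!inE] xA.
  by rewrite mem_set//; exact: AB.
rewrite /= /lebesgue_step /pushforward /product_measure1.
apply: le_ge0_integral => x /=; first exact: measure_ge0.
by apply: IH => t /=; rewrite !xsectionE; exact: AB.
Qed.

(** * Integrals over tuples, one coordinate at a time *)

Section lebesgue_tuple_integrals.
Context {R : realType}.
Local Notation leb := (@lebesgue_measure R).

Lemma measurable_mktuple d (T : measurableType d) n (f : 'I_n -> T -> R) :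
  (forall i, measurable_fun setT (f i)) ->
  measurable_fun setT (fun u => [tuple f i u | i < n]).
Proof.
move=> mf; apply/measurable_fun_tnthP => i.
by rewrite (_ : _ \o _ = f i)//; apply/funext => u; rewrite /= tnth_mktuple.
Qed.

Lemma measurable_insert n (k : 'I_n) :
  measurable_fun setT
    (fun u : n.-1.-tuple R * measurableTypeR R => tuple_insert k u.2 u.1).
Proof.
apply: measurable_mktuple => i; case: (unlift k i) => [j|]; last exact: measurable_snd.
apply: (@measurableT_comp _ _ _ _ _ _ (fun y => tnth y j)) => //.
exact: measurable_tnth.
Qed.

Lemma measurable_delete n (k : 'I_n) :
  measurable_fun setT (fun x : n.-tuple R => tuple_delete k x).
Proof. by apply: measurable_mktuple => j; exact: measurable_tnth. Qed.

Local Open Scope ereal_scope.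

Lemma ge0_integral_lebesgue_cons n (f : n.+1.-tuple R -> \bar R) :
  measurable_fun setT f -> (forall x, 0 <= f x) ->
  \int[lebesgue_tuple R n.+1]_x f x =
  \int[leb]_t \int[lebesgue_tuple R n]_y f [tuple of t :: y].
Proof.
move=> mf f0 /=.
rewrite -[lebesgue_step _]/(pushforward (leb \x lebesgue_tuple R n) (@tuple_cons R n)).
rewrite ge0_integral_pushforward//; last exact: measurable_tuple_cons.
rewrite preimage_setT fubini_tonelli1//=.
by apply: measurableT_comp => //; exact: measurable_tuple_cons.
Qed.

Lemma tuple_insert0 n t (y : n.-tuple R) :
  tuple_insert (@ord0 n) t y = [tuple of t :: y].
Proof.
apply: eq_from_tnth => i; case: (unliftP ord0 i) => [j|] ->.
  by rewrite (@tnth_insert_lift _ n.+1 _ _ y) tnthS.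
by rewrite tnth_insert.
Qed.

Lemma tuple_insertS n (k : 'I_n.+1) t s (y : n.-tuple R) :
  tuple_insert (lift ord0 k) t [tuple of s :: y] =
  [tuple of s :: tuple_insert k t y].
Proof.
apply: eq_from_tnth => i; case: (unliftP (lift ord0 k) i) => [j|] ->; last first.
  by rewrite tnth_insert tnthS tnth_insert.
rewrite tnth_insert_lift; case: (unliftP ord0 j) => [j'|] ->.
  rewrite tnthS.
  rewrite (_ : lift (lift ord0 k) _ = lift ord0 (lift k j')); last first.
    by apply/val_inj; rewrite /= bumpS.
  by rewrite tnthS (@tnth_insert_lift _ n.+1 _ _ y).
by rewrite (_ : lift (lift ord0 k) _ = ord0)//; exact/val_inj.
Qed.

Lemma measurable_section_insert n (k : 'I_n.+1) (f : n.+1.-tuple R -> \bar R) :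
  measurable_fun setT f ->
  measurable_fun setT
    (fun u : n.-tuple R * measurableTypeR R => f (tuple_insert k u.2 u.1)).
Proof. by move=> mf; apply: measurableT_comp => //; exact: (@measurable_insert n.+1). Qed.

(** Tonelli with an arbitrary coordinate innermost: a node x_k when fluxes are integrated, the last
    moment when the cone is cut into fibres. *)
Lemma ge0_integral_lebesgue_insert n (k : 'I_n.+1) (f : n.+1.-tuple R -> \bar R) :
  measurable_fun setT f -> (forall x, 0 <= f x) ->
  \int[lebesgue_tuple R n.+1]_x f x =
  \int[lebesgue_tuple R n]_y \int[leb]_t f (tuple_insert k t y).
Proof.
elim: n k f => [|n IH] k f mf f0.
  rewrite ge0_integral_lebesgue_cons// (ord1 k).
  rewrite (fubini_tonelli (fun u : measurableTypeR R * 0.-tuple R => f [tuple of u.1 :: u.2]))//=.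
    by apply: eq_integral => y _; apply: eq_integral => t _; rewrite tuple_insert0.
  apply: measurableT_comp => //; exact: measurable_tuple_cons.
have mcons : measurable_fun setT
    (fun u : measurableTypeR R * n.+1.-tuple R => f [tuple of u.1 :: u.2]).
  by apply: measurableT_comp => //; exact: measurable_tuple_cons.
rewrite ge0_integral_lebesgue_cons//; case: (unliftP ord0 k) => [j|] ->; last first.
  rewrite (fubini_tonelli (fun u : measurableTypeR R * n.+1.-tuple R => f [tuple of u.1 :: u.2]))//=.
  by apply: eq_integral => y _; apply: eq_integral => t _; rewrite tuple_insert0.
rewrite ge0_integral_lebesgue_cons//; last 2 first.
- apply: (measurable_fun_fubini_tonelli_F
    (fun u : n.+1.-tuple R * measurableTypeR R => f (tuple_insert (lift ord0 j) u.2 u.1))) => //.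
  exact: measurable_section_insert.
- by move=> y; exact: integral_ge0.
apply: eq_integral => s _; rewrite (IH j)//.
  by apply: eq_integral => y _; apply: eq_integral => t _; rewrite tuple_insertS.
apply: (measurableT_comp mf); apply: (@measurable_cons _ _ _ _ (fun=> s) n.+1 id) => //.
Qed.

Lemma emeasurable_prod d (T : measurableType d) (I : Type) (s : seq I)
    (h : I -> T -> \bar R) :
  (forall i, measurable_fun setT (h i)) ->
  measurable_fun setT (fun x => \prod_(i <- s) h i x).
Proof.
move=> mh; elim: s => [|i s IH].
  by under eq_fun do rewrite big_nil; exact: measurable_cst.
by under eq_fun do rewrite big_cons; exact: emeasurable_funM.
Qed.

Lemma ge0_integral_lebesgue_prod n (f : 'I_n -> R -> \bar R) :
  (forall i, measurable_fun setT (f i : measurableTypeR R -> \bar R)) ->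
  (forall i t, 0 <= f i t) ->
  \int[lebesgue_tuple R n]_x \prod_(i < n) f i (tnth x i) =
  \prod_(i < n) \int[leb]_t f i t.
Proof.
elim: n f => [|n IH] f mf f0.
  under eq_integral do rewrite big_ord0.
  by rewrite big_ord0 integral_cst//= mul1e diracT.
rewrite ge0_integral_lebesgue_cons//; last 2 first.
- apply: emeasurable_prod => i _.
  exact: (measurableT_comp (mf i) (@measurable_tnth _ (measurableTypeR R) n.+1 i)).
- by move=> x; apply: prode_ge0.
under eq_integral => t _.
  under eq_integral => y _.
    rewrite big_ord_recl (_ : tnth _ ord0 = t)//.
    under eq_bigr do rewrite tnthS.
    over.
  rewrite ge0_integralZl//; last 2 first.
  - apply: emeasurable_prod => i _.
    exact: (measurableT_comp (mf _) (@measurable_tnth _ (measurableTypeR R) n i)).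
  - by move=> x _; apply: prode_ge0.
  rewrite (IH (fun i => f (lift ord0 i)))//.
  over.
rewrite big_ord_recl ge0_integralZr//.
by apply: prode_ge0 => i _; exact: integral_ge0.
Qed.

End lebesgue_tuple_integrals.

(** * Bounded functions on the unit cube *)

Section cube_bounded.
Context {R : realType}.
Local Notation leb := (@lebesgue_measure R).

Lemma measurable_funV d (T : measurableType d) (f : T -> R) :
  measurable_fun setT f -> measurable_fun setT (fun x => (f x)^-1).
Proof.
(* Squaring makes the base of the real power nonnegative; where f vanishes both sides are 0. *)
move=> mf; rewrite (_ : (fun _ => _) = fun x => f x * (f x ^+ 2) `^ (-1)).
  apply: measurable_funM => //.
  apply: (@measurableT_comp _ _ _ _ _ _ (fun z => z `^ (-1))).
    exact: measurable_powR.
  exact: measurable_funX.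
apply/funext => x; rewrite powR_inv1 ?sqr_ge0//.
have [->|fx0] := eqVneq (f x) 0; first by rewrite invr0 mul0r.
by field.
Qed.

(** Bounds are required on the cube only, where 1 / p is under control. The class is closed under
    the algebraic operations, which gives the integrability of weights and fluxes. *)
Definition cube_bounded n (f : n.-tuple R -> R) :=
  measurable_fun setT f /\
  exists C, forall x, @unit_cube R n x -> `|f x| <= C.

Lemma cube_bounded_cst n c : cube_bounded n (fun=> c).
Proof. by split; [exact: measurable_cst|exists `|c|]. Qed.

Lemma cube_bounded_tnth n (i : 'I_n) : cube_bounded n (fun x => tnth x i).
Proof.
split; first exact: measurable_tnth.
by exists 1 => x /(_ i)/andP[x0 x1]; rewrite ger0_norm.
Qed.

Lemma cube_boundedD n f g : cube_bounded n f -> cube_bounded n g ->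
  cube_bounded n (fun x => f x + g x).
Proof.
move=> [mf [C fC]] [mg [D gD]]; split; first exact: measurable_funD.
exists (C + D) => x cx; rewrite (le_trans (ler_normD _ _))// lerD//; [exact: fC|exact: gD].
Qed.

Lemma cube_boundedM n f g : cube_bounded n f -> cube_bounded n g ->
  cube_bounded n (fun x => f x * g x).
Proof.
move=> [mf [C fC]] [mg [D gD]]; split; first exact: measurable_funM.
by exists (C * D) => x cx; rewrite normrM ler_pM//; [exact: fC|exact: gD].
Qed.

Lemma cube_boundedN n f : cube_bounded n f -> cube_bounded n (fun x => - f x).
Proof.
move=> [mf [C fC]]; split; first exact: measurable_funN.
by exists C => x cx; rewrite normrN; exact: fC.
Qed.

Lemma cube_boundedB n f g : cube_bounded n f -> cube_bounded n g ->
  cube_bounded n (fun x => f x - g x).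
Proof. by move=> bf bg; apply: cube_boundedD => //; exact: cube_boundedN. Qed.

Lemma cube_boundedX n f k : cube_bounded n f -> cube_bounded n (fun x => f x ^+ k).
Proof.
move=> bf; elim: k => [|k IH].
  by under eq_fun do rewrite expr0; exact: cube_bounded_cst.
by under eq_fun do rewrite exprS; exact: cube_boundedM.
Qed.

Lemma cube_bounded_sum n I (s : seq I) (P : pred I) (f : I -> n.-tuple R -> R) :
  (forall i, cube_bounded n (f i)) ->
  cube_bounded n (fun x => \sum_(i <- s | P i) f i x).
Proof.
move=> bf; elim: s => [|i s IH].
  by under eq_fun do rewrite big_nil; exact: cube_bounded_cst.
under eq_fun do rewrite big_cons.
by case: (P i) => //; exact: cube_boundedD.
Qed.

Lemma cube_bounded_prod n I (s : seq I) (P : pred I) (f : I -> n.-tuple R -> R) :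
  (forall i, cube_bounded n (f i)) ->
  cube_bounded n (fun x => \prod_(i <- s | P i) f i x).
Proof.
move=> bf; elim: s => [|i s IH].
  by under eq_fun do rewrite big_nil; exact: cube_bounded_cst.
under eq_fun do rewrite big_cons.
by case: (P i) => //; exact: cube_boundedM.
Qed.

Lemma cube_boundedV n f c : 0 < c -> (forall x, @unit_cube R n x -> c <= f x) ->
  cube_bounded n f -> cube_bounded n (fun x => (f x)^-1).
Proof.
move=> c0 fc [mf _]; split; first exact: measurable_funV.
exists c^-1 => x /fc cf; rewrite ger0_norm ?invr_ge0 ?(le_trans (ltW c0))//.
by rewrite lef_pV2// posrE// (lt_le_trans c0).
Qed.

Lemma cube_bounded_horner n (p : {poly R}) f : cube_bounded n f ->
  cube_bounded n (fun x => p.[f x]).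
Proof.
move=> bf; under eq_fun do rewrite horner_coef.
apply: cube_bounded_sum => i; apply: cube_boundedM; first exact: cube_bounded_cst.
exact: cube_boundedX.
Qed.

Lemma cube_bounded_delete n (k : 'I_n) f : cube_bounded n.-1 f ->
  cube_bounded n (fun x => f (tuple_delete k x)).
Proof.
move=> [mf [C fC]]; split.
  by apply: measurableT_comp => //; exact: measurable_delete.
by exists C => x cx; apply: fC => j; rewrite tnth_delete; exact: cx.
Qed.

Lemma lebesgue_unit_cube n : lebesgue_tuple R n (@unit_cube R n) = 1%E.
Proof.
transitivity (\prod_(i < n) (@lebesgue_measure R) `[0%R, 1%R]%classic)%E; last first.
  by rewrite big1// => i _; rewrite lebesgue_measure_itv/= lte_fin ltr01 sube0.
rewrite -(@lebesgue_tuple_box R n (fun=> `[0, 1]%classic))//.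
Qed.

Lemma cube_bounded_integrable n f : cube_bounded n f ->
  (lebesgue_tuple R n).-integrable (@unit_cube R n) (EFin \o f).
Proof.
move=> [mf [C fC]]; apply: measurable_bounded_integrable.
- exact: measurable_unit_cube.
- by have /= -> := @lebesgue_unit_cube n; rewrite ltry.
- exact: measurable_funTS.
- exists C; split; first exact: num_real.
  by move=> x Cx y /= yc; rewrite (le_trans (fC _ yc))// ltW.
Qed.

Definition cube_integral n (f : n.-tuple R -> R) : R :=
  \int[lebesgue_tuple R n]_(x in @unit_cube R n) f x.

Lemma cube_integralE n f : cube_bounded n f ->
  (\int[lebesgue_tuple R n]_(x in @unit_cube R n) (f x)%:E = (cube_integral n f)%:E)%E.
Proof.
move=> /cube_bounded_integrable bf; rewrite /cube_integral /Rintegral fineK//.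
by apply: integrable_fin_num => //; exact: measurable_unit_cube.
Qed.

Lemma cube_integralD n f g : cube_bounded n f -> cube_bounded n g ->
  cube_integral n (fun x => f x + g x) = cube_integral n f + cube_integral n g.
Proof.
move=> bf bg; rewrite /cube_integral RintegralD//.
- exact: measurable_unit_cube.
- exact: cube_bounded_integrable.
- exact: cube_bounded_integrable.
Qed.

Lemma cube_integralZ n c f : cube_bounded n f ->
  cube_integral n (fun x => c * f x) = c * cube_integral n f.
Proof.
move=> bf; rewrite /cube_integral RintegralZl//.
- exact: measurable_unit_cube.
- exact: cube_bounded_integrable.
Qed.

Lemma cube_integral_cst n c : cube_integral n (fun=> c) = c.
Proof.
rewrite /cube_integral (_ : (fun _ => _) = cst c)// Rintegral_cst.
  by have := @lebesgue_unit_cube n; rewrite /= => ->; rewrite mulr1.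
exact: measurable_unit_cube.
Qed.

Lemma cube_integral_sum n I (s : seq I) (f : I -> n.-tuple R -> R) :
  (forall i, cube_bounded n (f i)) ->
  cube_integral n (fun x => \sum_(i <- s) f i x) = \sum_(i <- s) cube_integral n (f i).
Proof.
move=> bf; elim: s => [|i s IH].
  by under [in LHS]eq_fun do rewrite big_nil; rewrite cube_integral_cst big_nil.
under [in LHS]eq_fun do rewrite big_cons.
by rewrite big_cons cube_integralD// ?IH//; exact: cube_bounded_sum.
Qed.

Lemma unit_cube_insert n (k : 'I_n) t (y : n.-1.-tuple R) :
  @unit_cube R n (tuple_insert k t y) <-> (0 <= t <= 1) /\ @unit_cube R n.-1 y.
Proof.
split=> [cx|[t01 cy] i].
  split; first by have := cx k; rewrite tnth_insert.
  by move=> j; have := cx (lift k j); rewrite tnth_insert_lift.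
case: (unliftP k i) => [j|] ->; first by rewrite tnth_insert_lift; exact: cy.
by rewrite tnth_insert.
Qed.

Lemma cube_integral_insert n (k : 'I_n) f g : cube_bounded n f ->
  cube_bounded n.-1 g ->
  (forall y, @unit_cube R n.-1 y ->
    (\int[leb]_(t in `[0%R, 1%R]) (f (tuple_insert k t y))%:E = (g y)%:E)%E) ->
  cube_integral n f = cube_integral n.-1 g.
Proof.
case: n k f g => [[]//|n] k f g bf bg fg.
have [mf [C fC]] := bf.
(* Tonelli asks for a nonnegative function: f is shifted by its bound C on the cube, which has
   measure 1, and the constant cancels at the end. *)
pose F x := if x \in @unit_cube R n.+1 then f x + C else 0.
have C0 x : @unit_cube R n.+1 x -> 0 <= f x + C.
  by move=> /fC; rewrite ler_norml -lerBlDr sub0r => /andP[].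
have F0 x : 0 <= F x by rewrite /F; case: ifPn => // /[!inE] /C0.
have mFE : measurable_fun setT (EFin \o F).
  rewrite (_ : _ \o _ = (fun x => (f x + C)%:E) \_ (@unit_cube R n.+1)); last first.
    by apply/funext => x; rewrite /F patchE /=; case: ifPn.
  apply/(measurable_restrictT _ (@measurable_unit_cube _ _)).
  by apply: measurable_funTS; apply/measurable_EFinP; exact: measurable_funD.
have bfC : cube_bounded n.+1 (fun x => f x + C).
  by apply: cube_boundedD => //; exact: cube_bounded_cst.
have : (\int[lebesgue_tuple R n.+1]_x (F x)%:E = (cube_integral n.+1 f + C)%:E)%E.
  transitivity (\int[lebesgue_tuple R n.+1]_(x in @unit_cube R n.+1) (f x + C)%:E)%E.
    rewrite [RHS]integral_mkcond; apply: eq_integral => x _.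
    by rewrite /F patchE; case: ifPn.
  rewrite cube_integralE// cube_integralD//; last exact: cube_bounded_cst.
  by rewrite cube_integral_cst.
rewrite (ge0_integral_lebesgue_insert n k _ mFE); last by move=> x; rewrite lee_fin.
move=> H; have : (\int[lebesgue_tuple R n]_y \int[leb]_t (F (tuple_insert k t y))%:E
    = (cube_integral n g + C)%:E)%E.
  rewrite -[in RHS](cube_integral_cst n C) -cube_integralD//; last exact: cube_bounded_cst.
  rewrite -cube_integralE; last by apply: cube_boundedD => //; exact: cube_bounded_cst.
  rewrite [RHS]integral_mkcond; apply: eq_integral => y _; rewrite patchE.
  case: ifPn => [/[!inE] cy|/negP ncy]; last first.
    apply: integral0_eq => t _; rewrite /F; case: ifPn => // /[!inE].
    by move=> /(@unit_cube_insert n.+1)[_ cy]; exfalso; apply: ncy; rewrite inE.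
  transitivity (\int[leb]_(t in `[0%R, 1%R]) ((f (tuple_insert k t y))%:E + C%:E))%E.
    rewrite [RHS]integral_mkcond; apply: eq_integral => t _; rewrite patchE /F.
    have -> : (tuple_insert k t y \in @unit_cube R n.+1) = (t \in `[0, 1]%classic).
      apply/idP/idP; rewrite !inE /= in_itv/=; first by move/(@unit_cube_insert n.+1) => [].
      by move=> t01; apply/(@unit_cube_insert n.+1).
    by case: ifPn.
  have mfk : measurable_fun (`[0, 1]%classic : set (measurableTypeR R)) (fun t : measurableTypeR R => f (tuple_insert k t y)).
    apply: measurable_funTS; apply: (measurableT_comp mf).
    exact: (measurableT_comp (@measurable_insert R n.+1 k) (pair1_measurable y)).
  rewrite integralD//=.
  - by rewrite fg// integral_cst//= lebesgue_measure_itv/= lte_fin ltr01 sube0 mule1.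
  - apply: measurable_bounded_integrable => //.
      by rewrite /= lebesgue_measure_itv/= lte_fin ltr01 sube0 ltry.
    exists C; split; first exact: num_real.
    move=> x Cx t /=; rewrite in_itv/= => t01.
    by rewrite (le_trans (fC _ _)) ?(ltW Cx)//; apply/(@unit_cube_insert n.+1).
  - apply: measurable_bounded_integrable => //.
      by rewrite /= lebesgue_measure_itv/= lte_fin ltr01 sube0 ltry.
    exact: bounded_cst.
by rewrite H => -[]/addIr.
Qed.

End cube_bounded.

(** * The recursion between Laplace integrals *)

Section laplace_recursion.
Context {R : realType}.
Local Notation leb := (@lebesgue_measure R).

(** The open and the closed cube both have measure 1. The partial fraction identity is available at
    interior points only, where no x_k collides with the ends. *)
Lemma eq_cube_integral n (f g : n.-tuple R -> R) :
  cube_bounded n f -> cube_bounded n g ->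
  (forall x, (forall k, 0 < tnth x k < 1) -> f x = g x) ->
  cube_integral n f = cube_integral n g.
Proof.
move=> bf bg fg.
pose O : set (n.-tuple R) := [set x | forall k : 'I_n, `]0, 1[%classic (tnth x k)].
have mO : measurable O.
  rewrite (_ : O = \bigcap_(k in [set: 'I_n]) ((@tnth n R ^~ k) @^-1` `]0, 1[%classic)).
    apply: fin_bigcap_measurable; first exact: finite_finset.
    by move=> k _; rewrite -[X in measurable X]setTI; exact: measurable_tnth.
  by apply/seteqP; split => x xO k; [move=> _|]; exact: xO.
have mC := @measurable_unit_cube R n.
have O1 : lebesgue_tuple R n O = 1%E.
  have /= -> := @lebesgue_tuple_box R n (fun=> `]0, 1[%classic) (fun=> measurable_itv _).
  by rewrite big1// => i _; rewrite lebesgue_measure_itv/= lte_fin ltr01 sube0.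
have OC : O `<=` @unit_cube R n.
  by move=> x xO k; have := xO k; rewrite /= in_itv/= => /andP[/ltW -> /ltW ->].
have N0 : lebesgue_tuple R n (@unit_cube R n `\` O) = 0%E.
  rewrite measureD//; last by have /= -> := @lebesgue_unit_cube R n; rewrite ltry.
  have /= -> := @lebesgue_unit_cube R n.
  by rewrite setIidr//; have /= -> := O1; rewrite subee.
have CN : @unit_cube R n `\` (@unit_cube R n `\` O) = O.
  by rewrite setDD setIidr.
rewrite /cube_integral /Rintegral; congr fine.
rewrite (negligible_integral (N := @unit_cube R n `\` O))//; last 2 first.
- exact: measurableD.
- exact: cube_bounded_integrable.
rewrite [RHS](negligible_integral (N := @unit_cube R n `\` O))//; last 2 first.
- exact: measurableD.
- exact: cube_bounded_integrable.
rewrite CN; apply: eq_integral => x /[!inE] xO; by rewrite fg.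
Qed.

Variables (p : {poly R}) (c : R).
Hypotheses (c0 : 0 < c) (pc : forall t, 0 <= t <= 1 -> c <= p.[t]).

Let p_gt0 t : 0 <= t <= 1 -> 0 < p.[t].
Proof. by move=> /pc; exact: lt_le_trans. Qed.

Let p_neq0 t : 0 <= t <= 1 -> p.[t] != 0.
Proof. by move=> /p_gt0; exact: lt0r_neq0. Qed.

Lemma cube_bounded_node_weight e0 e1 n : cube_bounded n (@node_weight R e0 e1 n).
Proof.
apply: cube_boundedM.
  apply: cube_bounded_prod => i; apply: cube_bounded_prod => j.
  by apply: cube_boundedX; apply: cube_boundedB; exact: cube_bounded_tnth.
apply: cube_bounded_prod => k; apply: cube_boundedM.
  by apply: cube_boundedX; exact: cube_bounded_tnth.
apply: cube_boundedX; apply: cube_boundedB; last exact: cube_bounded_tnth.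
exact: cube_bounded_cst.
Qed.

Lemma cube_bounded_laplace_weight e0 e1 n :
  cube_bounded n (laplace_weight e0 e1 p n).
Proof.
apply: cube_boundedM; last exact: cube_bounded_cst.
apply: cube_boundedM; first exact: cube_bounded_node_weight.
apply: cube_bounded_prod => k; apply: (@cube_boundedV _ _ _ (c ^+ 2)).
- by rewrite exprn_gt0.
- move=> x cx; rewrite lerXn2r ?nnegrE ?(ltW c0)//; last exact: pc.
  by apply/ltW/p_gt0/cx.
- by apply/cube_boundedX/cube_bounded_horner/cube_bounded_tnth.
Qed.

Let coef_bounded n (P : n.-tuple R -> {poly R}) :=
  forall i, cube_bounded n (fun y => (P y)`_i).

Let coef_boundedM n P Q : coef_bounded n P -> coef_bounded n Q ->
  coef_bounded n (fun y => P y * Q y).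
Proof.
move=> bP bQ i; under eq_fun do rewrite coefM.
by apply: cube_bounded_sum => j; exact: cube_boundedM.
Qed.

Lemma cube_bounded_coef_gap_poly e0 e1 n i :
  cube_bounded n (fun y : n.-tuple R => (gap_poly e0 e1 n y)`_i).
Proof.
move: i; apply: coef_boundedM => [i|]; first exact: cube_bounded_cst.
elim: (index_enum _) => [i|k s IH].
  by under eq_fun do rewrite big_nil; exact: cube_bounded_cst.
move=> i; under eq_fun do rewrite big_cons; move: i; apply: coef_boundedM => //.
have bX : coef_bounded n (fun y : n.-tuple R => 'X - (tnth y k)%:P).
  move=> i; under eq_fun do rewrite coefB coefX coefC.
  apply: cube_boundedB; first exact: cube_bounded_cst.
  by case: eqP => _; [exact: cube_bounded_tnth|exact: cube_bounded_cst].
exact: coef_boundedM.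
Qed.

Lemma size_gap_poly (e0 e1 : bool) n (y : n.-tuple R) :
  (size (gap_poly e0 e1 n y) <= (e0 + e1 + 2 * n).+1)%N.
Proof.
rewrite /gap_poly (leq_trans (size_polyMleq _ _))//.
have s2 : (size (\prod_(j < n) ('X - (tnth y j)%:P) ^+ 2)%R <= (2 * n).+1)%N.
  under eq_bigr do rewrite expr2.
  rewrite big_split /= (leq_trans (size_polyMleq _ _))//.
  by rewrite !size_prod_XsubC /index_enum -enumT size_enum_ord; lia.
have s1 : (size ('X^e0 * ('X - 1%:P) ^+ e1 : {poly R})%R <= (e0 + e1).+1)%N.
  rewrite (leq_trans (size_polyMleq _ _))// size_polyXn size_exp_XsubC; lia.
rewrite polyC1 in s1; move: s1 s2.
set a := size _; set b := size _; lia.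
Qed.

Lemma cube_bounded_flux (e0 e1 : bool) n (k : 'I_n) :
  cube_bounded n (fun x => flux e0 e1 p n.-1 (tnth x k) (tuple_delete k x)).
Proof.
have bk := @cube_bounded_tnth R n k.
apply: cube_boundedM.
  apply: cube_boundedN.
  exact: (cube_bounded_delete _ _ _ (cube_bounded_laplace_weight e0 e1 n.-1)).
apply: cube_boundedM; last first.
  apply: (@cube_boundedV _ _ _ (c ^+ 2)).
  - by rewrite exprn_gt0.
  - move=> x cx; rewrite lerXn2r ?nnegrE ?(ltW c0)//; last exact: pc.
    by apply/ltW/p_gt0/cx.
  - by apply/cube_boundedX/cube_bounded_horner.
(* A bound on the size of [gap_poly] that does not depend on x, so that evaluation at x_k becomes a
   sum with a fixed number of terms. *)
pose D := (e0 + e1 + 2 * n.-1).+1.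
have bq (q : n.-1.-tuple R -> {poly R}) : (forall i, cube_bounded n (fun x => (q (tuple_delete k x))`_i)) ->
    (forall x, (size (q (tuple_delete k x)) <= D)%N) ->
    cube_bounded n (fun x => (q (tuple_delete k x)).[tnth x k]).
  move=> bq sq; under eq_fun do rewrite (horner_coef_wide _ (sq _)).
  by apply: cube_bounded_sum => i; apply: cube_boundedM => //; exact: cube_boundedX.
have bg i := cube_bounded_delete _ k _ (cube_bounded_coef_gap_poly e0 e1 n.-1 i).
apply: cube_boundedB; apply: cube_boundedM; try exact: cube_bounded_horner.
- apply: (bq (fun y : n.-1.-tuple R => (gap_poly e0 e1 n.-1 y)^`())) => [i|x].
    under eq_fun do rewrite coef_deriv -mulr_natr.
    by apply: cube_boundedM => //; exact: cube_bounded_cst.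
  by rewrite (leq_trans (size_poly _ _))// (leq_trans (leq_pred _))// size_gap_poly.
- by apply: (bq (fun y : n.-1.-tuple R => gap_poly e0 e1 n.-1 y)) => // x; exact: size_gap_poly.
Qed.

Let continuous_horner_div_deriv (r : {poly R}) : {within `[0, 1],
  continuous (fun t : R => (r^`().[t] * p.[t] - r.[t] * p^`().[t]) / p.[t] ^+ 2)}.
Proof.
apply: continuous_in_subspaceT => t /[!inE]/=; rewrite in_itv/= => t01.
apply: cvgM; last first.
  apply: cvgV; first by rewrite expf_neq0// p_neq0.
  by apply: cvgM; exact: continuous_horner.
by apply: cvgB; apply: cvgM; exact: continuous_horner.
Qed.

Lemma integral_horner_div_deriv (r : {poly R}) :
  (\int[leb]_(t in `[0%R, 1%R])
     ((r^`().[t] * p.[t] - r.[t] * p^`().[t]) / p.[t] ^+ 2)%:E =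
   (r.[1] / p.[1] - r.[0] / p.[0])%:E)%E.
Proof.
pose F : R -> R := horner r * (fun t => p.[t]^-1).
have F' (t : R) : 0 <= t <= 1 -> is_derive t (1 : R) F
    ((r^`().[t] * p.[t] - r.[t] * p^`().[t]) / p.[t] ^+ 2).
  move=> t01; have pt := p_neq0 _ t01.
  have ? : is_derive t (1 : R) (fun t => p.[t]^-1) (- p.[t] ^- 2 *: p^`().[t]).
    exact: is_deriveV.
  apply: trigger_derive; rewrite /GRing.scale/=.
  by field.
have Fc (t : R) : 0 <= t <= 1 -> {for t, continuous F}.
  by move=> /F' [dF _]; exact/differentiable_continuous/derivable1_diffP.
rewrite (@continuous_FTC2 _ _ F)//.
- split.
  + by move=> t; rewrite in_itv/= => /andP[/ltW t0 /ltW t1]; have [] := F' t; rewrite ?t0.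
  + by apply: cvg_at_right_filter; apply: Fc; rewrite lexx ler01.
  + by apply: cvg_at_left_filter; apply: Fc; rewrite lexx ler01.
- move=> t; rewrite in_itv/= => /andP[/ltW t0 /ltW t1].
  by rewrite derive1E; have [] := F' t; rewrite ?t0.
Qed.

Definition laplace_integral (e0 e1 : bool) n : R :=
  cube_integral n (laplace_weight e0 e1 p n).

(** Integrating first in x_k leaves boundary values of [gap_poly] / p. They vanish at an end already
    occupied by a node, hence the factors [~~ e0] and [~~ e1]; at a free end the squared distances
    complete the weight to the one with that end added. *)
Lemma integral_flux (e0 e1 : bool) n (k : 'I_n) :
  cube_integral n (fun x => flux e0 e1 p n.-1 (tnth x k) (tuple_delete k x)) =
  ((-1) ^+ e1 * laplace_integral true e1 n.-1) *+ ~~ e0 -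
  laplace_integral e0 true n.-1 *+ ~~ e1.
Proof.
have bW e e' := cube_bounded_laplace_weight e e' n.-1.
have bc c' := @cube_bounded_cst R n.-1 c'.
pose g y := ((-1) ^+ e1 *+ ~~ e0) * laplace_weight true e1 p n.-1 y +
  (- 1 *+ ~~ e1) * laplace_weight e0 true p n.-1 y.
have bg : cube_bounded n.-1 g.
  by apply: cube_boundedD; exact: cube_boundedM.
rewrite (@cube_integral_insert _ _ k _ g)//; last 2 first.
- exact: cube_bounded_flux.
- move=> y cy.
  under eq_integral do rewrite tnth_insert insertK /flux EFinM.
  rewrite integralZl//; last first.
    by apply: continuous_compact_integrable; [exact: segment_compact|exact: continuous_horner_div_deriv].
  rewrite integral_horner_div_deriv -EFinM; congr EFin.
  rewrite !horner_gap_poly /g /laplace_weight.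
  rewrite [X in _ * (_ * X / _ - _)](eq_bigr (fun j => (1 - tnth y j) ^+ 2))//.
  rewrite [X in _ * (_ - _ * X / _)](eq_bigr (fun j => tnth y j ^+ 2)); last first.
    by move=> j _; rewrite sub0r sqrrN.
  case: e0 {bW bg g}; case: e1; rewrite ?node_weight_true0 ?node_weight_true1;
    rewrite /= ?mulr1n ?mulr0n ?expr0 ?expr1 ?subrr ?expr1n ?invr1; ring.
rewrite /g cube_integralD ?cube_integralZ//; try exact: cube_boundedM.
by rewrite /laplace_integral; clear bW bg g; case: e0; case: e1; rewrite /= ?mulr1n ?mulr0n; ring.
Qed.

(** The terms multiplied by [e0] and [e1] are the residues at the ends; the last one collects the n
    fluxes, whose integrals are equal. *)
Theorem laplace_recursion (e0 e1 : bool) n : (size p <= 2 * n + e0 + e1)%N ->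
  p`_(2 * n + e0 + e1).-1 * laplace_integral e0 e1 n =
  ((-1) ^+ e1 * laplace_integral false e1 n) *+ e0 +
  laplace_integral e0 false n *+ e1 +
  (((-1) ^+ e1 * laplace_integral true e1 n.-1) *+ ~~ e0 -
   laplace_integral e0 true n.-1 *+ ~~ e1) *+ n.
Proof.
move=> sp.
have bW e e' := cube_bounded_laplace_weight e e' n.
have bc c' := @cube_bounded_cst R n c'.
have bf k := cube_bounded_flux e0 e1 n k.
rewrite /laplace_integral -cube_integralZ//.
rewrite (@eq_cube_integral _ _ (fun x =>
  \sum_(k < n) flux e0 e1 p n.-1 (tnth x k) (tuple_delete k x) +
  (((-1) ^+ e1 *+ e0) * laplace_weight false e1 p n x +
  (1 *+ e1) * laplace_weight e0 false p n x))); last 3 first.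
- exact: cube_boundedM.
- by apply: cube_boundedD; [exact: cube_bounded_sum|apply: cube_boundedD; exact: cube_boundedM].
- move=> x x01; rewrite laplace_weight_flux// -addrA; congr (_ + _).
  by rewrite mulrnAl -mulr_natl; congr (_ + _); rewrite mulr_natl.
rewrite cube_integralD; last 2 first.
- exact: cube_bounded_sum.
- by apply: cube_boundedD; exact: cube_boundedM.
rewrite cube_integral_sum// cube_integralD; try exact: cube_boundedM.
rewrite !cube_integralZ//.
under eq_bigr do rewrite integral_flux.
rewrite sumr_const card_ord addrC; congr (_ + _).
by rewrite mulrnAl mulr_natl.
Qed.

End laplace_recursion.

(** * Uniqueness of a measure with given moments or Laplace transform *)

Section polynomial_step.
Context {R : realType}.
Implicit Types (a t : R) (k : nat).

(* With b of order k a^-k, Bernoulli's inequality makes (1 - t^k)^b tend to 1 for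
   t < a and to 0 for t > a. *)
Definition step_exponent a k : nat := (Num.truncn (k%:R * a^-1 ^+ k)).+1.

Definition polynomial_step a k t : R := (1 - t ^+ k) ^+ step_exponent a k.

Lemma polynomial_step_itv a k t : 0 <= t <= 1 -> 0 <= polynomial_step a k t <= 1.
Proof.
move=> /andP[t0 t1]; have tk1 : t ^+ k <= 1 by exact: exprn_ile1.
by rewrite exprn_ge0 ?subr_ge0//= exprn_ile1 ?subr_ge0// lerBlDr lerDl exprn_ge0.
Qed.

Lemma bernoulli_ineq (x : R) k : 0 <= x -> 1 + k%:R * x <= (1 + x) ^+ k.
Proof.
move=> x0; elim: k => [|k IH]; first by rewrite mul0r addr0 expr0.
rewrite exprS; apply: le_trans (ler_wpM2l _ IH); last by rewrite addr_ge0.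
by rewrite -natr1; have := ler0n R k; nra.
Qed.

Lemma bernoulli_ineq_sub (x : R) k : 0 <= x <= 1 -> 1 - k%:R * x <= (1 - x) ^+ k.
Proof.
move=> /andP[x0 x1]; elim: k => [|k IH]; first by rewrite mul0r subr0 expr0.
rewrite exprS; apply: le_trans (ler_wpM2l _ IH); last by rewrite subr_ge0.
by rewrite -natr1; have := ler0n R k; nra.
Qed.

Lemma cvg_natr_expr (s : R) : 0 <= s < 1 -> (fun k => k%:R * s ^+ k) @ \oo --> (0 : R).
Proof.
move=> /andP[s0 s1].
have [->|sn0] := eqVneq s 0.
  apply: cvg_near_cst; near=> k.
  have k0 : (0 < k)%N by near: k; exact: nbhs_infty_gt.
  by rewrite expr0n gtn_eqF// mulr0.
have sp : 0 < s by rewrite lt_def sn0.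
(* s^k is split as r^k r^k; Bernoulli's inequality for 1 / r = 1 + [dl] bounds k r^k by 1 / [dl],
   and the other factor r^k tends to 0. *)
pose r := Num.sqrt s.
have r0 : 0 < r by rewrite sqrtr_gt0.
have r1 : r < 1 by rewrite -[ltRHS]sqrtr1 ltr_sqrt.
pose dl := r^-1 - 1.
have d0 : 0 < dl by rewrite subr_gt0 invf_gt1.
apply: (@squeeze_cvgr _ _ _ _ (fun=> 0) (fun k => dl^-1 * r ^+ k)).
- apply: nearW => k; rewrite mulr_ge0 ?exprn_ge0//=.
  have -> : s ^+ k = r ^+ k * r ^+ k by rewrite -exprMn -expr2 sqr_sqrtr.
  rewrite mulrA ler_wpM2r// ?exprn_ge0 ?(ltW r0)//.
  have rk : 0 < r ^+ k by rewrite exprn_gt0.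
  rewrite -(ler_pM2r (_ : 0 < dl * r ^- k)); last by rewrite mulr_gt0// invr_gt0.
  rewrite mulrACA mulfV ?gt_eqF// mulr1 mulrA mulVf ?gt_eqF// mul1r.
  have := bernoulli_ineq _ k (ltW d0); rewrite (_ : 1 + dl = r^-1) ?exprVn; last by rewrite /dl addrC subrK.
  by apply: le_trans; rewrite lerDr.
- exact: cvg_cst.
- rewrite -[X in _ --> X](mulr0 dl^-1); apply: cvgMr => /=.
  by apply: cvg_expr; rewrite ger0_norm// ltW.
Unshelve. all: by end_near. Qed.

Lemma cvg_polynomial_step a t : 0 < a <= 1 -> 0 <= t <= 1 ->
  (fun k => polynomial_step a k t) @ \oo --> (((t < a)%R)%:R : R).
Proof.
move=> /andP[a0 a1] t01; have /andP[t0 t1] := t01.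
have ai0 k : 0 <= k%:R * a^-1 ^+ k by rewrite mulr_ge0// exprn_ge0// invr_ge0 ltW.
have tk0 k : 0 <= t ^+ k by rewrite exprn_ge0.
have tk1 k : t ^+ k <= 1 by exact: exprn_ile1.
case: ltP => [ta|at_].
  apply: (@squeeze_cvgr _ _ _ _ (fun k => 1 - (k%:R * (t / a) ^+ k + t ^+ k)) (fun=> 1)).
  - apply: nearW => k; have /andP[_ ->] := polynomial_step_itv a k t t01.
    rewrite andbT; apply: le_trans (bernoulli_ineq_sub _ _ _); last by rewrite tk0 tk1.
    rewrite lerB//.
    have nk : (step_exponent a k)%:R <= k%:R * a^-1 ^+ k + 1.
      by rewrite /step_exponent -natr1 lerD2r truncn_le.
    apply: le_trans (ler_wpM2r (tk0 k) nk) _.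
    by rewrite mulrDl mul1r -mulrA [a^-1 ^+ k * _]mulrC -exprMn.
  - rewrite -[X in _ --> X]subr0; apply: cvgB; first exact: cvg_cst.
    rewrite -[X in _ --> X]addr0; apply: cvgD.
      by apply: cvg_natr_expr; rewrite divr_ge0 ?(ltW a0)//= ltr_pdivrMr// mul1r.
    by apply: cvg_expr; rewrite ger0_norm// (lt_le_trans ta).
  - exact: cvg_cst.
apply: (@squeeze_cvgr _ _ _ _ (fun=> 0) (fun k => k.+1%:R^-1)).
- apply: nearW => k; have /andP[-> _] := polynomial_step_itv a k t t01.
  rewrite /= /polynomial_step; set n := step_exponent a k.
  (* For t >= a the power is at most 1 / (1 + t^k)^n, and Bernoulli makes the denominator at least 1
     + n t^k >= 1 + k by the choice of the exponent. *)
  have H1 : (1 - t ^+ k) ^+ n * (1 + t ^+ k) ^+ n <= 1.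
    rewrite -exprMn exprn_ile1//.
      by rewrite mulr_ge0 ?subr_ge0// addr_ge0.
    by have := tk0 k; nra.
  have H2 : k.+1%:R <= (1 + t ^+ k) ^+ n.
    apply: le_trans (bernoulli_ineq _ n (tk0 k)).
    rewrite -nat1r lerD2l.
    have kn : k%:R * a^-1 ^+ k <= n%:R by rewrite ltW// truncnS_gt.
    apply: le_trans (ler_wpM2r (tk0 k) kn).
    rewrite -mulrA -[leLHS]mulr1 ler_wpM2l// -exprMn exprn_ege1//.
    by rewrite mulrC ler_pdivlMr// mul1r.
  rewrite -[leRHS]mul1r ler_pdivlMr//.
  by apply: le_trans H1; rewrite ler_wpM2l// exprn_ge0// subr_ge0.
- exact: cvg_cst.
- exact: cvg_harmonic.
Qed.

End polynomial_step.

Section moment_uniqueness.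
Context {R : realType}.
Local Open Scope ereal_scope.

(** The parameter j is there for an induction on b: the integral for (b + 1, j) is the difference of
    those for (b, j) and (b, j + k), down to plain moments at b = 0. *)
Definition weighted_moment d (T : measurableType d) (mu : {measure set T -> \bar R})
  (g V : T -> R) (k b j : nat) : \bar R :=
  \int[mu]_u (g u * (V u ^+ j * (1 - V u ^+ k) ^+ b))%:E.

Section weighted_moments.
Context d (T : measurableType d) (mu : {measure set T -> \bar R}) (g V : T -> R).
Hypotheses (mg : measurable_fun setT g) (mV : measurable_fun setT V).
Hypotheses (g0 : forall u, (0 <= g u)%R) (V01 : forall u, (0 <= V u <= 1)%R).
Hypothesis gfin : \int[mu]_u (g u)%:E < +oo.

Let W k b j u := (V u ^+ j * (1 - V u ^+ k) ^+ b)%R.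

Let W01 k b j u : (0 <= W k b j u <= 1)%R.
Proof.
have /andP[v0 v1] := V01 u.
have vk : (0 <= 1 - V u ^+ k)%R by rewrite subr_ge0 exprn_ile1.
rewrite /W mulr_ge0 ?exprn_ge0//= mulr_ile1 ?exprn_ge0 ?exprn_ile1//.
by rewrite lerBlDr lerDl exprn_ge0.
Qed.

Let mW k b j : measurable_fun setT (W k b j).
Proof.
apply: measurable_funM; apply: measurable_funX => //.
by apply: measurable_funB => //; exact: measurable_funX.
Qed.

Lemma weighted_momentS k b j :
  weighted_moment d T mu g V k b.+1 j + weighted_moment d T mu g V k b (j + k) =
  weighted_moment d T mu g V k b j.
Proof.
rewrite /weighted_moment -ge0_integralD//; last 4 first.
- by move=> u _; rewrite lee_fin mulr_ge0//; have /andP[] := W01 k b.+1 j u.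
- by apply/measurable_EFinP; apply: measurable_funM => //; exact: (mW k b.+1 j).
- by move=> u _; rewrite lee_fin mulr_ge0//; have /andP[] := W01 k b (j + k) u.
- by apply/measurable_EFinP; apply: measurable_funM => //; exact: (mW k b (j + k)).
by apply: eq_integral => u _; rewrite -EFinD; congr EFin; rewrite exprS exprD; ring.
Qed.

Lemma weighted_moment_fin_num k b j :
  weighted_moment d T mu g V k b j \is a fin_num.
Proof.
rewrite ge0_fin_numE; last first.
  by apply: integral_ge0 => u _; rewrite lee_fin mulr_ge0//; have /andP[] := W01 k b j u.
apply: le_lt_trans gfin; apply: le_ge0_integral => u.
  by rewrite lee_fin mulr_ge0//; have /andP[] := W01 k b j u.
by rewrite lee_fin ler_piMr//; have /andP[] := W01 k b j u.
Qed.

Lemma cvg_weighted_step (a : R) : (0 < a <= 1)%R ->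
  (fun k => weighted_moment d T mu g V k (step_exponent a k) 0) @ \oo -->
  \int[mu]_u (g u * (V u < a)%R%:R)%:E.
Proof.
move=> a01; rewrite /weighted_moment.
apply: (@dominated_cvg _ _ _ _ setT measurableT
  (fun k u => (g u * (V u ^+ 0 * (1 - V u ^+ k) ^+ (step_exponent a k)))%:E)
  _ (EFin \o g)).
- move=> k; apply/measurable_EFinP; apply: measurable_funM => //.
  exact: (mW k (step_exponent a k) 0).
- move=> u _; apply: cvg_EFin; first exact: nearW.
  apply: cvgMr => /=; under eq_fun do rewrite expr0 mul1r.
  exact: cvg_polynomial_step.
- by [].
- apply/integrableP; split; first exact/measurable_EFinP.
  by under eq_integral do rewrite /= ger0_norm//.
- move=> k u _ /=; rewrite lee_fin normrM ger0_norm//.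
  have /andP[w0 w1] := W01 k (step_exponent a k) 0 u.
  by rewrite ler_piMr// ger0_norm.
Qed.

End weighted_moments.

(** Uniqueness in the Hausdorff moment problem: equal moments give equal integrals of each
    [polynomial_step a k], these converge to the masses of [0, a), and such rays determine a finite
    measure. *)
Lemma moments_determine_line d1 d2 (T1 : measurableType d1) (T2 : measurableType d2)
    (mu1 : {measure set T1 -> \bar R}) (mu2 : {measure set T2 -> \bar R})
    (g1 V1 : T1 -> R) (g2 V2 : T2 -> R) :
  measurable_fun setT g1 -> measurable_fun setT V1 ->
  measurable_fun setT g2 -> measurable_fun setT V2 ->
  (forall u, (0 <= g1 u)%R) -> (forall u, (0 <= V1 u <= 1)%R) ->
  (forall u, (0 <= g2 u)%R) -> (forall u, (0 <= V2 u <= 1)%R) ->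
  \int[mu1]_u (g1 u)%:E < +oo -> \int[mu2]_u (g2 u)%:E < +oo ->
  (forall k : nat, \int[mu1]_u (g1 u * V1 u ^+ k)%:E =
                   \int[mu2]_u (g2 u * V2 u ^+ k)%:E) ->
  forall B : set R, measurable B ->
  \int[mu1]_u (g1 u * \1_B (V1 u))%:E = \int[mu2]_u (g2 u * \1_B (V2 u))%:E.
Proof.
move=> mg1 mV1 mg2 mV2 g10 V101 g20 V201 fin1 fin2 H.
have E k b j : weighted_moment _ _ mu1 g1 V1 k b j = weighted_moment _ _ mu2 g2 V2 k b j.
  elim: b j => [|b IH] j.
    rewrite /weighted_moment; under eq_integral do rewrite expr0 mulr1.
    by under [RHS]eq_integral do rewrite expr0 mulr1.
  rewrite -[LHS](addeK _ (weighted_moment_fin_num _ _ mu1 g1 V1 g10 V101 fin1 k b (j + k))).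
  rewrite weighted_momentS// !IH -(weighted_momentS _ _ mu2)// addeK//.
  exact: weighted_moment_fin_num.
pose m1 := pushforward (mdensity mu1 mg1 g10) (V1 : T1 -> measurableTypeR R).
pose m2 := pushforward (mdensity mu2 mg2 g20) (V2 : T2 -> measurableTypeR R).
have mE (B : set R) : measurable B ->
    m1 B = \int[mu1]_u (g1 u * \1_B (V1 u))%:E /\
    m2 B = \int[mu2]_u (g2 u * \1_B (V2 u))%:E.
  move=> mB; rewrite /m1 /m2 /pushforward /= /mdensity; split;
    rewrite integral_mkcond; apply: eq_integral => u _; rewrite patchE indicE /=.
    have -> : (u \in V1 @^-1` B) = (V1 u \in B) by apply/idP/idP; rewrite !inE.
    by case: ifPn => _; rewrite ?mulr1 ?mulr0.
  have -> : (u \in V2 @^-1` B) = (V2 u \in B) by apply/idP/idP; rewrite !inE.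
  by case: ifPn => _; rewrite ?mulr1 ?mulr0.
have mtot : m1 setT = m2 setT.
  have [-> ->] := mE setT measurableT.
  have := H 0%N; under eq_integral do rewrite expr0.
  under [RHS]eq_integral do rewrite expr0.
  move=> H0; under eq_integral do rewrite indicT.
  by under [RHS]eq_integral do rewrite indicT.
have mfin : m1 setT < +oo.
  have [-> _] := mE setT measurableT; apply: le_lt_trans fin1.
  by apply: le_ge0_integral => u; rewrite lee_fin indicT mulr1.
have step (a : R) : (0 < a <= 1)%R -> m1 `]-oo, a[%classic = m2 `]-oo, a[%classic.
  move=> a01; have [-> ->] := mE `]-oo, a[%classic (measurable_itv _).
  have i1 u : \1_(`]-oo, a[%classic : set R) (V1 u) = ((V1 u < a)%R)%:R :> R.
    by rewrite indicE; congr ((nat_of_bool _)%:R); apply/idP/idP; rewrite inE /= in_itv.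
  have i2 u : \1_(`]-oo, a[%classic : set R) (V2 u) = ((V2 u < a)%R)%:R :> R.
    by rewrite indicE; congr ((nat_of_bool _)%:R); apply/idP/idP; rewrite inE /= in_itv.
  under eq_integral do rewrite i1; under [RHS]eq_integral do rewrite i2.
  have c1 := cvg_weighted_step _ _ mu1 _ _ mg1 mV1 g10 V101 fin1 _ a01.
  have c2 := cvg_weighted_step _ _ mu2 _ _ mg2 mV2 g20 V201 fin2 _ a01.
  rewrite -(cvg_lim (@ereal_hausdorff R) c1) -(cvg_lim (@ereal_hausdorff R) c2).
  by congr (limn _); apply/funext => k; rewrite E.
have ray (a : R) : m1 `]-oo, a[%classic = m2 `]-oo, a[%classic.
  have [a0|a0] := leP a 0%R.
    have [-> ->] := mE `]-oo, a[%classic (measurable_itv _).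
    rewrite !integral0_eq// => u _; rewrite indicE memNset ?mulr0//= in_itv/=;
      apply/negP; rewrite -leNgt (le_trans a0)//.
      by have /andP[] := V201 u.
    by have /andP[] := V101 u.
  have [a1|a1] := leP a 1%R; first by apply: step; rewrite a0.
  have h1 : m1 `]-oo, a[%classic = m1 setT.
    rewrite /m1 /pushforward; congr (mdensity _ _ _ _).
    rewrite preimage_setT -subTset => u _ /=; rewrite in_itv/= (le_lt_trans _ a1)//.
    by have /andP[] := V101 u.
  have h2 : m2 `]-oo, a[%classic = m2 setT.
    rewrite /m2 /pushforward; congr (mdensity _ _ _ _).
    rewrite preimage_setT -subTset => u _ /=; rewrite in_itv/= (le_lt_trans _ a1)//.
    by have /andP[] := V201 u.
  by rewrite h1 h2.
move=> B mB; have [<- <-] := mE B mB.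
pose M1 : {measure set (measurableTypeR R) -> \bar R} := m1.
pose M2 : {measure set (measurableTypeR R) -> \bar R} := m2.
suff Q : forall A : set (measurableTypeR R), measurable A -> M1 mV1 A = M2 mV2 A by exact: Q.
have Q := (@measure_unique _ R (measurableTypeR R) (@RGenInftyO.G R) (fun n => `]-oo, n%:R[%classic) _ _ _ _ (M1 mV1) (M2 mV2)).
apply: Q => //.
- exact: RGenInftyO.measurableE.
- move=> _ _ [x ->] [y ->]; exists (Num.min x y).
  by apply/seteqP; split => z /=; rewrite !in_itv/= lt_min => /andP.
- by move=> n; exists n%:R.
- rewrite -subTset => x _; exists (Num.truncn `|x|).+1 => //=; rewrite in_itv/=.
  by rewrite (le_lt_trans (ler_norm x))// truncnS_gt.
- by move=> _ [x ->]; exact: ray.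
- move=> k; apply: le_lt_trans mfin; apply: le_measure; rewrite ?inE//.
Qed.

End moment_uniqueness.

Section laplace_uniqueness.
Context {R : realType}.
Local Open Scope ereal_scope.

Lemma tuple_measurable_boxes n :
  @measurable _ (n.-tuple R) = <<s [set C | exists2 B : 'I_n -> set R,
    (forall i, measurable (B i)) &
    C = [set t : n.-tuple R | forall i, B i (tnth t i)] ] >>.
Proof.
apply/seteqP; split.
  apply: smallest_sub; first exact: smallest_sigma_algebra.
  move=> C; rewrite -bigcup_seq/= => -[i _ [A mA <-]].
  apply: sub_sigma_algebra.
  exists (fun j => if j == i then A else setT).
    by move=> j; case: ifP.
  apply/seteqP; split => t /=.
    by move=> [_ At] j; case: eqP => [->|].
  by move=> /(_ i); rewrite eqxx.
apply: smallest_sub; first exact: sigma_algebra_measurable.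
move=> _ [B mB ->].
rewrite (_ : [set t | _] = \bigcap_(i in [set: 'I_n]) ((@tnth n R ^~ i) @^-1` B i)).
  apply: fin_bigcap_measurable; first exact: finite_finset.
  by move=> i _; rewrite -[X in measurable X]setTI; exact: measurable_tnth.
by apply/seteqP; split => t /= Bt i; [move=> _|]; exact: Bt.
Qed.

Section moments_determine.
Context d1 d2 (T1 : measurableType d1) (T2 : measurableType d2).
Variables (mu1 : {measure set T1 -> \bar R}) (mu2 : {measure set T2 -> \bar R}).
Variables (n : nat) (g1 : T1 -> R) (U1 : T1 -> n.-tuple R)
  (g2 : T2 -> R) (U2 : T2 -> n.-tuple R).
Hypotheses (mg1 : measurable_fun setT g1) (mU1 : measurable_fun setT U1).
Hypotheses (mg2 : measurable_fun setT g2) (mU2 : measurable_fun setT U2).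
Hypotheses (g10 : forall u, (0 <= g1 u)%R) (g20 : forall u, (0 <= g2 u)%R).
Hypotheses (U101 : forall u i, (0 <= tnth (U1 u) i <= 1)%R)
  (U201 : forall u i, (0 <= tnth (U2 u) i <= 1)%R).
Hypotheses (fin1 : \int[mu1]_u (g1 u)%:E < +oo) (fin2 : \int[mu2]_u (g2 u)%:E < +oo).

(** Interpolates between a monomial (m = 0) and the indicator of a box (m = n), so that the
    coordinates can be exchanged one by one. *)
Let mixed m (k : 'I_n -> nat) (B : 'I_n -> set R) (i : 'I_n) (t : R) : R :=
  if (i < m)%N then \1_(B i) t else (t ^+ k i)%R.

Let mixed01 m k B i t : (0 <= t <= 1 -> 0 <= mixed m k B i t <= 1)%R.
Proof.
move=> /andP[t0 t1]; rewrite /mixed; case: ifP => _.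
  by rewrite indicE; case: (t \in B i); rewrite /= ?lexx ?ler01.
by rewrite exprn_ge0//= exprn_ile1.
Qed.

Let measurable_mixed m k B i d (T : measurableType d) (V : T -> n.-tuple R) :
  (forall i, measurable (B i)) -> measurable_fun setT V ->
  measurable_fun setT (fun u => mixed m k B i (tnth (V u) i)).
Proof.
move=> mB mV.
have mVi : measurable_fun setT (fun u => tnth (V u) i).
  by move/measurable_fun_tnthP : mV => /(_ i).
rewrite /mixed; case: (i < m)%N; last exact: measurable_funX.
by apply: (measurableT_comp (measurable_indic (mB i))).
Qed.

Let weight_finite d (T : measurableType d) (mu : {measure set T -> \bar R})
    (g h : T -> R) : (forall u, 0 <= g u)%R -> (forall u, 0 <= h u <= 1)%R ->
  \int[mu]_u (g u)%:E < +oo -> \int[mu]_u (g u * h u)%:E < +oo.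
Proof.
move=> g0 h01; apply: le_lt_trans; apply: le_ge0_integral => u.
  by rewrite lee_fin mulr_ge0//; have /andP[] := h01 u.
by rewrite lee_fin ler_piMr//; have /andP[] := h01 u.
Qed.

Let prod01 (P : pred 'I_n) (f : 'I_n -> R) : (forall i, 0 <= f i <= 1)%R ->
  (0 <= \prod_(i < n | P i) f i <= 1)%R.
Proof.
move=> f01; apply: (big_ind (fun x : R => 0 <= x <= 1)%R) => //.
- by rewrite ler01 lexx.
- by move=> x y /andP[x0 x1] /andP[y0 y1]; rewrite mulr_ge0//= mulr_ile1.
Qed.

Let integral_boxes (B : 'I_n -> set R) :
  (forall k : 'I_n -> nat,
    \int[mu1]_u (g1 u * \prod_(i < n) tnth (U1 u) i ^+ k i)%:E =
    \int[mu2]_u (g2 u * \prod_(i < n) tnth (U2 u) i ^+ k i)%:E) ->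
  (forall i, measurable (B i)) ->
  \int[mu1]_u (g1 u * \prod_(i < n) \1_(B i) (tnth (U1 u) i))%:E =
  \int[mu2]_u (g2 u * \prod_(i < n) \1_(B i) (tnth (U2 u) i))%:E.
Proof.
move=> H mB.
suff P m : (m <= n)%N -> forall k,
    \int[mu1]_u (g1 u * \prod_(i < n) mixed m k B i (tnth (U1 u) i))%:E =
    \int[mu2]_u (g2 u * \prod_(i < n) mixed m k B i (tnth (U2 u) i))%:E.
  have := P n (leqnn n) (fun=> 0%N).
  under eq_integral do under eq_bigr do rewrite /mixed ltn_ord.
  by under [RHS]eq_integral do under eq_bigr do rewrite /mixed ltn_ord.
elim: m => [_ k|m IH mn k]; first exact: H.
pose i0 := Ordinal mn.
have mixedS (t : n.-tuple R) : (\prod_(i < n) mixed m.+1 k B i (tnth t i) =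
    (\prod_(i < n | i != i0) mixed m k B i (tnth t i)) * \1_(B i0) (tnth t i0))%R.
  rewrite (bigD1 i0)//= mulrC /mixed ltnSn; congr (_ * _)%R.
  apply: eq_bigr => i ii0; rewrite ltnS leq_eqVlt.
  by rewrite (_ : (nat_of_ord i == m) = false)//; apply: contraNF ii0 => /eqP im; exact/eqP/val_inj.
have mixedk j (t : n.-tuple R) :
    (\prod_(i < n) mixed m (fun i => if i == i0 then j else k i) B i (tnth t i) =
    (\prod_(i < n | i != i0) mixed m k B i (tnth t i)) * tnth t i0 ^+ j)%R.
  rewrite (bigD1 i0)//= mulrC /mixed ltnn eqxx; congr (_ * _)%R.
  by apply: eq_bigr => i ii0; rewrite (negbTE ii0).
have mprod d (T : measurableType d) (V : T -> n.-tuple R) : measurable_fun setT V ->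
    measurable_fun setT (fun u => \prod_(i < n | i != i0) mixed m k B i (tnth (V u) i))%R.
  move=> mV; under eq_fun do rewrite -big_filter.
  by apply: measurable_prod => i _; exact: measurable_mixed.
have mtnth d (T : measurableType d) (V : T -> n.-tuple R) : measurable_fun setT V ->
    measurable_fun setT (fun u => tnth (V u) i0).
  by move/measurable_fun_tnthP => /(_ i0).
(* The factors of the other coordinates are absorbed into the densities, which leaves a
   one-dimensional problem in coordinate [i0]. *)
under eq_integral do rewrite mixedS mulrA.
under [RHS]eq_integral do rewrite mixedS mulrA.
apply: (moments_determine_line _ _ _ _ mu1 mu2
  (fun u => g1 u * \prod_(i < n | i != i0) mixed m k B i (tnth (U1 u) i))%R
  (fun u => tnth (U1 u) i0)
  (fun u => g2 u * \prod_(i < n | i != i0) mixed m k B i (tnth (U2 u) i))%R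
  (fun u => tnth (U2 u) i0)) => //.
- by apply: measurable_funM => //; exact: mprod.
- exact: mtnth.
- by apply: measurable_funM => //; exact: mprod.
- exact: mtnth.
- move=> u; rewrite mulr_ge0//.
  by have /andP[] := prod01 (fun i => i != i0) _ (fun i => mixed01 m k B i _ (U101 u i)).
- move=> u; rewrite mulr_ge0//.
  by have /andP[] := prod01 (fun i => i != i0) _ (fun i => mixed01 m k B i _ (U201 u i)).
- apply: weight_finite => // u.
  exact: (prod01 (fun i => i != i0) _ (fun i => mixed01 m k B i _ (U101 u i))).
- apply: weight_finite => // u.
  exact: (prod01 (fun i => i != i0) _ (fun i => mixed01 m k B i _ (U201 u i))).
move=> j; have := IH (ltnW mn) (fun i => if i == i0 then j else k i).
under eq_integral do rewrite mixedk mulrA.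
by under [in X in _ = X -> _]eq_integral do rewrite mixedk mulrA.
Qed.

Lemma moments_determine :
  (forall k : 'I_n -> nat,
    \int[mu1]_u (g1 u * \prod_(i < n) tnth (U1 u) i ^+ k i)%:E =
    \int[mu2]_u (g2 u * \prod_(i < n) tnth (U2 u) i ^+ k i)%:E) ->
  forall h : n.-tuple R -> \bar R, measurable_fun setT h -> (forall t, 0 <= h t) ->
  \int[mu1]_u ((g1 u)%:E * h (U1 u)) = \int[mu2]_u ((g2 u)%:E * h (U2 u)).
Proof.
move=> H h mh h0.
pose M1 : {measure set (n.-tuple R) -> \bar R} := pushforward (mdensity mu1 mg1 g10) U1.
pose M2 : {measure set (n.-tuple R) -> \bar R} := pushforward (mdensity mu2 mg2 g20) U2.
pose boxes : set (set (n.-tuple R)) := [set C | exists2 B : 'I_n -> set R,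
    (forall i, measurable (B i)) &
    C = [set t : n.-tuple R | forall i, B i (tnth t i)] ].
have boxE d (T : measurableType d) (mu : {measure set T -> \bar R}) (g : T -> R)
    (mg : measurable_fun setT g) (g0 : forall u, (0 <= g u)%R)
    (U : T -> n.-tuple R) (B : 'I_n -> set R) :
    pushforward (mdensity mu mg g0) U [set t : n.-tuple R | forall i, B i (tnth t i)] =
    \int[mu]_u (g u * \prod_(i < n) \1_(B i) (tnth (U u) i))%:E.
  rewrite /pushforward /= /mdensity integral_mkcond; apply: eq_integral => u _.
  rewrite patchE; case: ifPn => [/[!inE]/= uB|/negP uB].
    by rewrite big1 ?mulr1// => i _; rewrite indicE mem_set.
  have [i uBi] : exists i, ~ B i (tnth (U u) i).
    by apply/existsNP => uB'; apply: uB; rewrite inE.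
  by rewrite (bigD1 i)//= indicE memNset// mul0r mulr0.
have boxT : boxes setT.
  by exists (fun=> setT) => //; apply/seteqP; split.
have M12 A : measurable A -> M1 mU1 A = M2 mU2 A.
  have Q := (@measure_unique _ R (n.-tuple R) boxes (fun=> setT) _ _ _ _ (M1 mU1) (M2 mU2)).
  apply: Q => //.
  - exact: tuple_measurable_boxes.
  - move=> _ _ [B mB ->] [C mC ->]; exists (fun i => B i `&` C i).
      by move=> i; exact: measurableI.
    by apply/seteqP; split => t /=; [move=> [tB tC] i; split|move=> tBC; split => i; have [] := tBC i].
  - by apply/seteqP; split => // t _; exists 0%N.
  by move=> _ [B mB ->]; rewrite /M1 /M2/= !boxE; exact: integral_boxes.
have : \int[M1 mU1]_t h t = \int[M2 mU2]_t h t.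
  by apply: eq_measure_integral => A mA _; exact: M12.
rewrite (ge0_integral_pushforward mU1)//.
rewrite (ge0_integral_pushforward mU2)// !preimage_setT => H12.
have mh1 : measurable_fun setT (h \o U1) by exact: measurableT_comp.
have mh2 : measurable_fun setT (h \o U2) by exact: measurableT_comp.
have h1 u : 0 <= (h \o U1) u by exact: h0.
have h2 u : 0 <= (h \o U2) u by exact: h0.
move: H12; rewrite (ge0_integral_density mu1 g1 mg1 g10 _ mh1 h1).
by rewrite (ge0_integral_density mu2 g2 mg2 g20 _ mh2 h2).
Qed.

End moments_determine.

(* In the coordinates exp (- c_i), Laplace transforms at integers are moments. *)
Lemma laplace_determine d1 d2 (T1 : measurableType d1) (T2 : measurableType d2)
    (mu1 : {measure set T1 -> \bar R}) (mu2 : {measure set T2 -> \bar R}) n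
    (g1 : T1 -> R) (F1 : T1 -> n.-tuple R) (g2 : T2 -> R) (F2 : T2 -> n.-tuple R) :
  measurable_fun setT g1 -> measurable_fun setT F1 ->
  measurable_fun setT g2 -> measurable_fun setT F2 ->
  (forall u, 0 <= g1 u)%R -> (forall u, 0 <= g2 u)%R ->
  (forall u, g1 u != 0%R -> forall i, 0 <= tnth (F1 u) i)%R ->
  (forall u, g2 u != 0%R -> forall i, 0 <= tnth (F2 u) i)%R ->
  (forall k : 'I_n -> nat,
    \int[mu1]_u (g1 u * \prod_(i < n) expR (- tnth (F1 u) i) ^+ (k i).+1)%:E =
    \int[mu2]_u (g2 u * \prod_(i < n) expR (- tnth (F2 u) i) ^+ (k i).+1)%:E) ->
  \int[mu1]_u (g1 u * \prod_(i < n) expR (- tnth (F1 u) i))%:E < +oo ->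
  forall h : n.-tuple R -> \bar R, measurable_fun setT h -> (forall t, 0 <= h t) ->
  \int[mu1]_u ((g1 u)%:E * h (F1 u)) = \int[mu2]_u ((g2 u)%:E * h (F2 u)).
Proof.
move=> mg1 mF1 mg2 mF2 g10 g20 F10 F20 H fin h mh h0.
(* The given measures may be infinite. One factor exp (- c_i) per coordinate is set aside to make
   them finite, hence the exponents [(k i).+1], and [h'] divides it out again. The maximum with 0
   keeps [U] in the unit cube even where the density vanishes. *)
pose E (t : n.-tuple R) : R := (\prod_(i < n) expR (- Num.max (tnth t i) 0))%R.
pose U (t : n.-tuple R) : n.-tuple R := [tuple expR (- Num.max (tnth t i) 0) | i < n]%R.
pose h' (v : n.-tuple R) : \bar R :=
  (\prod_(i < n) `|tnth v i|^-1)%R%:E * h [tuple - ln (tnth v i) | i < n]%R.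
have mU d (T : measurableType d) (F : T -> n.-tuple R) : measurable_fun setT F ->
    measurable_fun setT (fun u => U (F u)).
  move=> mF; apply: measurable_mktuple => i; apply: measurableT_comp => //.
  apply: measurable_funN; apply: measurable_maxr => //.
  by move/measurable_fun_tnthP : mF => /(_ i).
have mE d (T : measurableType d) (g : T -> R) (F : T -> n.-tuple R) :
    measurable_fun setT g -> measurable_fun setT F ->
    measurable_fun setT (fun u => g u * E (F u))%R.
  move=> mg mF; apply: measurable_funM => //; apply: measurable_prod => i _.
  apply: measurableT_comp => //.
  apply: measurable_funN; apply: measurable_maxr => //.
  by move/measurable_fun_tnthP : mF => /(_ i).
have E0 t : (0 <= E t)%R by apply: prodr_ge0 => i _; exact: expR_ge0.
have U01 t i : (0 <= tnth (U t) i <= 1)%R.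
  by rewrite tnth_mktuple expR_ge0/= -expR0 ler_expR oppr_le0 le_max lexx orbT.
have gE d (T : measurableType d) (mu : {measure set T -> \bar R}) (g : T -> R) (F : T -> n.-tuple R)
    (k : 'I_n -> nat) :
    (forall u, g u != 0%R -> forall i, 0 <= tnth (F u) i)%R ->
    \int[mu]_u (g u * E (F u) * \prod_(i < n) tnth (U (F u)) i ^+ k i)%:E =
    \int[mu]_u (g u * \prod_(i < n) expR (- tnth (F u) i) ^+ (k i).+1)%:E.
  move=> F0; apply: eq_integral => u _; congr EFin.
  have [->|gu] := eqVneq (g u) 0%R; first by rewrite !mul0r.
  rewrite -mulrA /E -big_split /=; congr (_ * _)%R; apply: eq_bigr => i _.
  by rewrite tnth_mktuple -exprS max_l// F0.
have h'E d (T : measurableType d) (mu : {measure set T -> \bar R}) (g : T -> R) (F : T -> n.-tuple R) :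
    (forall u, g u != 0%R -> forall i, 0 <= tnth (F u) i)%R ->
    \int[mu]_u ((g u)%:E * h (F u)) =
    \int[mu]_u ((g u * E (F u))%:E * h' (U (F u))).
  move=> F0; apply: eq_integral => u _.
  have [->|gu] := eqVneq (g u) 0%R; first by rewrite !mul0r !mul0e.
  rewrite /h' muleA -EFinM -mulrA /E -big_split /=.
  rewrite big1 ?mulr1; last first.
    by move=> i _; rewrite tnth_mktuple ger0_norm ?expR_ge0// mulfV// gt_eqF// expR_gt0.
  congr (_ * h _); apply: eq_from_tnth => i.
  by rewrite !tnth_mktuple expRK opprK max_l// F0.
have fin0 d (T : measurableType d) (mu : {measure set T -> \bar R}) (g : T -> R) (F : T -> n.-tuple R) :
    (forall u, g u != 0%R -> forall i, 0 <= tnth (F u) i)%R ->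
    \int[mu]_u (g u * \prod_(i < n) expR (- tnth (F u) i))%:E < +oo ->
    \int[mu]_u (g u * E (F u))%:E < +oo.
  move=> F0; congr (_ < _); apply: eq_integral => u _; congr EFin.
  have [->|gu] := eqVneq (g u) 0%R; first by rewrite !mul0r.
  by congr (_ * _)%R; apply: eq_bigr => i _; rewrite max_l// F0.
rewrite (h'E _ _ _ _ _ F10) (h'E _ _ _ _ _ F20).
apply: (moments_determine _ _ _ _ mu1 mu2 n (fun u => g1 u * E (F1 u))%R (fun u => U (F1 u))
  (fun u => g2 u * E (F2 u))%R (fun u => U (F2 u))) => //.
- exact: mE.
- exact: mU.
- exact: mE.
- exact: mU.
- by move=> u; rewrite mulr_ge0.
- by move=> u; rewrite mulr_ge0.
- exact: fin0.
- apply: fin0 => //; have := H (fun=> 0%N).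
  under eq_integral do under eq_bigr do rewrite expr1.
  by under [RHS]eq_integral do under eq_bigr do rewrite expr1; move=> <-.
- by move=> k; rewrite !gE.
- apply: emeasurable_funM.
    apply/measurable_EFinP; apply: measurable_prod => i _.
    apply: measurable_funV; apply: measurableT_comp => //; exact: measurable_tnth.
  apply: (measurableT_comp mh); apply: measurable_mktuple => i.
  apply: measurable_funN; apply: measurableT_comp => //; exact: measurable_tnth.
- by move=> t; rewrite mule_ge0// lee_fin; apply: prodr_ge0 => i _; rewrite invr_ge0.
Qed.

End laplace_uniqueness.

(** * One-dimensional Gamma integrals *)

Section gamma_integrals.
Context {R : realType}.
Local Notation leb := (@lebesgue_measure R).

(** The indicator confines w to the positive half-line also for a = 0, where the power alone would
    be 1 everywhere. *)
Definition pos_power (a : nat) (w : R) : R := (0 < w)%R%:R * w ^+ a.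

Lemma pos_power_ge0 a w : 0 <= pos_power a w.
Proof.
rewrite /pos_power; case: ltP => w0; rewrite ?mul0r// mul1r.
by rewrite exprn_ge0// ltW.
Qed.

Lemma measurable_pos_power a : measurable_fun setT (pos_power a).
Proof.
apply: measurable_funM; last exact: measurable_funX.
rewrite (_ : (fun _ => _) = \1_(`]0, +oo[%classic : set R)).
  by apply: measurable_indic; exact: measurable_itv.
apply/funext => w; rewrite indicE; congr ((nat_of_bool _)%:R).
by apply/idP/idP; rewrite inE /= in_itv/= andbT.
Qed.

Lemma integral_pos_power (a : bool) (p : R) : 0 < p ->
  (\int[leb]_w (pos_power a w * expR (- (w * p)))%:E = (p ^- a.+1)%:E)%E.
Proof.
move=> p0.
pose f w := w ^+ a * expR (- (w * p)).
transitivity (\int[leb]_(w in `[0%R, +oo[) (f w)%:E)%E.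
  rewrite -integral_itv_obnd_cbnd; last first.
    apply/measurable_EFinP/measurable_funTS; apply: measurable_funM.
      exact: measurable_funX.
    apply: measurableT_comp => //; apply: measurable_funN.
    exact: measurable_funM.
  rewrite [RHS]integral_mkcond; apply: eq_integral => w _.
  rewrite patchE /pos_power /f; case: ifPn => [|/negP].
    by rewrite inE/= in_itv/= andbT => ->; rewrite mul1r.
  by rewrite inE/= in_itv/= andbT => /negP/negbTE ->; rewrite !mul0r.
pose F : R -> R := (fun w => - (if a then w / p + p ^- 2 else p^-1)) * (fun w => expR (- (w * p))).
have F' (w : R) : is_derive w (1 : R) F (f w).
  have D1 : is_derive w (1 : R) (fun w => - (if a then w / p + p ^- 2 else p^-1)) (- (p^-1 *+ a)).
    rewrite /f /F; case: (a) => /=.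
      have -> : (fun w : R => - (w / p + p ^- 2)) = - (id * cst p^-1 + cst (p ^- 2)) by [].
      by apply: trigger_derive; rewrite /GRing.scale/= mulr0 add0r addr0 mulr1.
    by apply: trigger_derive; rewrite mulr0n oppr0.
  have D2 : is_derive w (1 : R) (fun w => expR (- (w * p))) (- p * expR (- (w * p))).
    have -> : (fun w => expR (- (w * p))) = expR \o (- (id * cst p)) by [].
    apply: trigger_derive.
    by rewrite scaler0 add0r mulrC; congr (- _ * _); rewrite /GRing.scale/= mulr1.
  apply: trigger_derive; rewrite /f /GRing.scale/=.
  by case: (a) => /=; field; rewrite gt_eqF.
rewrite (@ge0_continuous_FTC2y _ f F 0 0).
- have -> : F 0 = - p ^- a.+1.
    rewrite [LHS](_ : _ = - (if a then 0 / p + p ^- 2 else p^-1) * expR (- (0 * p)))//.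
    by case: (a); rewrite !mul0r ?add0r oppr0 expR0 mulr1 ?expr1.
  by rewrite EFinN oppeK add0e.
- by move=> w w0; rewrite mulr_ge0 ?expR_ge0// exprn_ge0.
- apply: continuous_subspaceT => w; apply: cvgM; first exact: exprn_continuous.
  apply: (@continuous_comp _ _ _ (fun w : R => - (w * p)) expR); last exact: continuous_expR.
  by apply: cvgN; apply: cvgMl.
(* Half of the exponential absorbs the linear factor: w / p contributes 2 / p^2 by (p / 2) w exp (-
   (p / 2) w) <= 1, the constant term contributes 1 / p^2, and the case of exponent 0 contributes 1
   / p. *)
- apply: (@squeeze_cvgr _ _ _ _ (fun w => - (3 / p ^+ 2 + p^-1) * expR (- (p / 2 * w))) (fun=> 0)).
  + near=> w.
    have w0 : 0 <= w by near: w; exact: nbhs_pinfty_ge.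
    have e1 : expR (- (p / 2 * w)) <= 1 by rewrite -expR0 ler_expR oppr_le0 mulr_ge0// divr_ge0// ltW.
    have e2 : p / 2 * w * expR (- (p / 2 * w)) <= 1.
      rewrite expRN ler_pdivrMr ?expR_gt0// mul1r.
      by rewrite (le_trans _ (expR_ge1Dx _))// lerDr.
    have e0 := expR_ge0 (- (p / 2 * w)).
    have eE : expR (- (w * p)) = expR (- (p / 2 * w)) * expR (- (p / 2 * w)).
      by rewrite -expRD; congr expR; field.
    have q0 : 0 < p^-1 by rewrite invr_gt0.
    have pq : p * p^-1 = 1 by rewrite mulfV// gt_eqF.
    set e := expR (- (p / 2 * w)) in e0 e1 e2 eE *.
    have H : 0 <= (if a then w / p + p ^- 2 else p^-1) * e <= 3 / p ^+ 2 + p^-1.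
      have pp : p ^- 2 = p^-1 * p^-1 by rewrite -invfM expr2.
      have wq : w / p * e <= 2 * (p^-1 * p^-1).
        have -> : w / p * e = 2 * (p^-1 * p^-1) * (p / 2 * w * e) by field; rewrite gt_eqF.
        by rewrite ler_piMr// mulr_ge0// mulr_ge0// ltW.
      have qq : 0 <= p^-1 * p^-1 by rewrite mulr_ge0// ltW.
      have wp0 : 0 <= w / p by rewrite divr_ge0// ltW.
      rewrite pp; set q := p^-1 in q0 qq wq wp0 *.
      have qe : 0 <= q * e <= q by rewrite mulr_ge0 ?ler_piMr// ltW.
      have qqe : 0 <= q * q * e <= q * q by rewrite mulr_ge0 ?ler_piMr.
      have wqe : 0 <= w * q * e by rewrite mulr_ge0.
      by case: (a); lra.
    rewrite /F !fctE eE mulrA !mulNr lerN2 ?oppr_le0 -/e.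
    have /andP[H1 H2] := H; apply/andP; split; first by rewrite ler_wpM2r.
    by rewrite mulr_ge0.
  + rewrite -(mulr0 (- (3 / p ^+ 2 + p^-1))); apply: cvgMr.
    apply: (@cvg_comp _ _ _ (fun w => p / 2 * w) (fun z => expR (- z)) _ (pinfty_nbhs R)).
      by apply: gt0_cvgMry; [rewrite divr_gt0|exact: cvg_id].
    exact: cvgr_expR.
  + exact: cvg_cst.
- by move=> w _; have [] := F' w.
- apply/cvg_at_right_filter/differentiable_continuous/derivable1_diffP.
  by have [] := F' 0.
- by move=> w _; rewrite derive1E; have [] := F' w.
Unshelve. all: by end_near. Qed.

End gamma_integrals.

(** * Closed sets of tuples are measurable *)

Section closed_sets.
Context {R : realType}.

(** For each k the set is covered by the countably many boxes of radius 1 / (k + 1) with rational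
    centre that meet it. A point lying in all these covers is within 2 / (k + 1) of the set for
    every k. *)
Lemma measurable_closed_tuple n (S : set (n.-tuple R)) :
  (forall c, (forall e, 0 < e -> exists2 s, S s & forall i, `|tnth s i - tnth c i| < e) -> S c) ->
  measurable S.
Proof.
move=> Scl.
pose box (q : n.-tuple rat) (k : nat) : set (n.-tuple R) :=
  [set c | forall i, `|tnth c i - ratr (tnth q i)| < k.+1%:R^-1].
have mbox q k : measurable (box q k).
  rewrite (_ : box q k = \bigcap_(i in [set: 'I_n])
      ((fun c => `|tnth c i - ratr (tnth q i)|) @^-1` `]-oo, k.+1%:R^-1[%classic)).
    apply: fin_bigcap_measurable; first exact: finite_finset.
    move=> i _; rewrite -[X in measurable X]setTI.
    have mf : measurable_fun setT (fun c : n.-tuple R => `|tnth c i - ratr (tnth q i)|).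
      apply: measurableT_comp => //; apply: measurable_funB => //; exact: measurable_tnth.
    by apply: mf => //; exact: measurable_itv.
  by apply/seteqP; split => c /= cb i; [move=> _|]; have := cb i; rewrite /= in_itv => H; [|exact: H].
rewrite (_ : S = \bigcap_k \bigcup_(q in [set q | exists2 s, S s & box q k s]) box q k).
  apply: bigcapT_measurable => k; rewrite bigcup_mkcond.
  apply: countable_bigcupT_measurable; first exact: countableP.
  move=> q.
  by case: ifP.
apply/seteqP; split => c.
  move=> Sc k _.
  have H i : exists q : rat, `|tnth c i - ratr q| < k.+1%:R^-1.
    have [q] : exists q, ratr q \in `](tnth c i - k.+1%:R^-1), (tnth c i + k.+1%:R^-1)[.
      by apply: rat_in_itvoo; rewrite ltrD2l -subr_gt0 opprK addr_gt0.
    rewrite in_itv/= => q12; exists q.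
    by rewrite distrC ltr_distl.
  have [q cq] := choice H.
  have bc : box [tuple q i | i < n] k c by move=> i; rewrite tnth_mktuple.
  by exists [tuple q i | i < n] => //; exists c.
move=> Sc; apply: Scl => e e0.
pose k := Num.truncn (2 / e).
have ke : 2 * k.+1%:R^-1 < e.
  by rewrite -ltr_pdivlMl// -ltf_pV2 ?posrE ?mulr_gt0 ?invr_gt0// invrK invfM invrK truncnS_gt.
have [q [s Ss qs] qc] := Sc k I.
exists s => // i.
have := qs i; have := qc i; rewrite [`|tnth c i - _|]distrC => c1 s1.
rewrite (_ : _ - _ = (tnth s i - ratr (tnth q i)) + (ratr (tnth q i) - tnth c i)); last by ring.
apply: (le_lt_trans (ler_normD _ _)); apply: (lt_trans (ltrD s1 c1)).
by move: ke; rewrite mulr_natl mulr2n.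
Qed.

End closed_sets.

(** * The cone and the ends of its fibres *)

Section cone.
Context {R : realType}.

Definition nonneg01 (q : {poly R}) := forall t, 0 <= t <= 1 -> 0 <= q.[t].

Definition pairing D (q : {poly R}) (c : D.-tuple R) : R :=
  \sum_(i < D) q`_i * tnth c i.

Definition dual_cone D : set (D.-tuple R) :=
  [set c | forall q : {poly R}, (size q <= D)%N -> nonneg01 q -> 0 <= pairing D q c].

(* Over a point of dual_cone D, e = false bounds the last coordinate from below
   and e = true bounds it from above. *)
Definition half_cone (e : bool) D : set (D.+1.-tuple R) :=
  [set c | forall q : {poly R}, (size q <= D.+1)%N -> nonneg01 q ->
    0 < (-1) ^+ e * q`_D -> 0 <= pairing D.+1 q c].

(** An intersection of possibly uncountably many half-spaces, measurable because it is closed; [M]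
    exceeds the Lipschitz constant of the pairing in the sup norm. *)
Lemma measurable_pairing_ge0 D (Q : set {poly R}) :
  measurable [set c | forall q, Q q -> 0 <= pairing D q c].
Proof.
apply: measurable_closed_tuple => c ccl q Qq; rewrite leNgt; apply/negP => q0.
pose M := 1 + \sum_(i < D) `|q`_i|.
have M0 : 0 < M by rewrite ltr_wpDr// sumr_ge0.
have [|s Ss sc] := ccl (- pairing D q c / M).
  by rewrite divr_gt0// oppr_gt0.
have := Ss q Qq; apply/negP; rewrite -ltNge.
have -> : pairing D q s = pairing D q c + \sum_(i < D) q`_i * (tnth s i - tnth c i).
  by rewrite -big_split/=; apply: eq_bigr => i _; ring.
rewrite -ltrBrDl sub0r (le_lt_trans (ler_norm _))// (le_lt_trans (ler_norm_sum _ _ _))//.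
have := ltr_pdivrMr (- pairing D q c) (\sum_(i < D) `|q`_i * (tnth s i - tnth c i)|) M0.
set e := - pairing D q c / M in sc *.
have -> : - pairing D q c = e * M by rewrite divfK// gt_eqF.
move=> _; have e0 : 0 < e by rewrite divr_gt0// oppr_gt0.
rewrite (@le_lt_trans _ _ (e * \sum_(i < D) `|q`_i|))//; last by rewrite ltr_pM2l// ltrDr.
rewrite mulr_sumr ler_sum// => i _; rewrite normrM mulrC ler_wpM2r//.
exact/ltW/sc.
Qed.

Lemma measurable_dual_cone D : measurable (dual_cone D).
Proof.
rewrite (_ : dual_cone D = [set c | forall q, [set q : {poly R} | (size q <= D)%N /\ nonneg01 q] q
  -> 0 <= pairing D q c]); first exact: measurable_pairing_ge0.
by apply/seteqP; split => c H q => [[]|sq nq]; exact: H.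
Qed.

Lemma measurable_half_cone e D : measurable (half_cone e D).
Proof.
rewrite (_ : half_cone e D = [set c | forall q, [set q : {poly R} |
    [/\ (size q <= D.+1)%N, nonneg01 q & 0 < (-1) ^+ e * q`_D]] q ->
    0 <= pairing D.+1 q c]); first exact: measurable_pairing_ge0.
by apply/seteqP; split => c H q => [[]|sq nq qD]; exact: H.
Qed.

Lemma pairing_insert D (q : {poly R}) t (c : D.-tuple R) :
  pairing D.+1 q (@tuple_insert R D.+1 ord_max t c) = pairing D q c + q`_D * t.
Proof.
rewrite /pairing (big_ord_lift D.+1 ord_max) tnth_insert addrC; congr (_ + _).
by apply: eq_bigr => j _; rewrite (@tnth_insert_lift _ D.+1) lift_max.
Qed.

(** Test polynomials are sorted by their top coefficient: a zero one gives a condition on c alone, a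
    positive one bounds t from below, a negative one from above. *)
Lemma dual_cone_insert D t (c : D.-tuple R) :
  dual_cone D.+1 (@tuple_insert R D.+1 ord_max t c) <->
  [/\ dual_cone D c, half_cone false D (@tuple_insert R D.+1 ord_max t c) &
      half_cone true D (@tuple_insert R D.+1 ord_max t c)].
Proof.
split=> [H|[H0 H1 H2] q sq nq].
  split=> [q sq nq|q sq nq _|q sq nq _]; try exact: H.
  have := H q (leqW sq) nq; rewrite pairing_insert.
  by rewrite (nth_default _ sq) mul0r addr0.
have [qD|qD|qD] := ltgtP q`_D 0.
- by apply: H2 => //; rewrite expr1 mulN1r oppr_gt0.
- by apply: H1 => //; rewrite expr0 mul1r.
rewrite pairing_insert qD mul0r addr0; apply: H0 => //.
apply/leq_sizeP => j; rewrite leq_eqVlt => /predU1P[<-//|Dj].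
by rewrite nth_default// (leq_trans sq).
Qed.

Definition cone_nodes (e0 e1 : bool) (x : seq R) : seq R :=
  nseq e0 0 ++ x ++ nseq e1 1.

(* Interior nodes have Dirichlet parameter 2, the nodes 0 and 1 parameter 1. *)
Definition node_double (e0 : bool) n k : bool := (e0 <= k < e0 + n)%N.

Definition power_sum m (z : seq R) (w : m.-tuple R) (j : nat) : R :=
  \sum_(k < m) tnth w k * z`_k ^+ j.

Definition cone_map D e0 e1 n m (u : n.-tuple R * m.-tuple R) : D.-tuple R :=
  [tuple power_sum m (cone_nodes e0 e1 u.1) u.2 j | j < D].

Definition cone_weight e0 e1 n m (u : n.-tuple R * m.-tuple R) : R :=
  \1_(@unit_cube R n) u.1 * node_weight e0 e1 n u.1 *
  \prod_(k < m) pos_power (node_double e0 n k) (tnth u.2 k).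

Lemma nth_cone_nodes e0 e1 n (x : n.-tuple R) k : (cone_nodes e0 e1 x)`_k =
  if (k < e0)%N then 0 else if (k < e0 + n)%N then x`_(k - e0)
  else if (k < e0 + n + e1)%N then 1 else 0.
Proof.
rewrite /cone_nodes !nth_cat !size_nseq size_tuple !nth_nseq.
case: ltnP => // ke; rewrite ltn_subLR//; case: ifPn => // kn.
by congr (if _ then _ else _); apply/idP/idP; lia.
Qed.

Lemma cone_nodes_itv e0 e1 n (x : n.-tuple R) k : @unit_cube R n x ->
  0 <= (cone_nodes e0 e1 x)`_k <= 1.
Proof.
move=> cx; rewrite nth_cone_nodes; case: ltnP => [|ek]; first by rewrite lexx ler01.
case: ltnP => [kn|_]; last by case: ifP => _; rewrite ?lexx ?ler01.
have kn' : (k - e0 < n)%N by rewrite ltn_subLR.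
by have := cx (Ordinal kn'); rewrite (tnth_nth 0).
Qed.

Lemma measurable_cone_nodes e0 e1 n k :
  measurable_fun setT (fun x : n.-tuple R => (cone_nodes e0 e1 x)`_k).
Proof.
under eq_fun do rewrite nth_cone_nodes.
case: ltnP => [|ek]; first by move=> _; exact: measurable_cst.
case: ltnP => [kn|_]; last by case: ifP => _; exact: measurable_cst.
have kn' : (k - e0 < n)%N by rewrite ltn_subLR.
have := @measurable_tnth _ R n (Ordinal kn').
by under eq_fun do rewrite (tnth_nth 0).
Qed.

Lemma measurable_cone_map D e0 e1 n m : measurable_fun setT (cone_map D e0 e1 n m).
Proof.
apply: measurable_mktuple => j; apply: measurable_sum => k.
apply: measurable_funM.
  exact: (measurableT_comp (@measurable_tnth _ R m k)).
apply: measurable_funX; exact: (measurableT_comp (@measurable_cone_nodes e0 e1 n k)).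
Qed.

Lemma measurable_cone_weight e0 e1 n m : measurable_fun setT (cone_weight e0 e1 n m).
Proof.
apply: measurable_funM.
  apply: measurable_funM.
    apply: (measurableT_comp (measurable_indic (@measurable_unit_cube R n))).
    exact: measurable_fst.
  apply: (measurableT_comp (cube_bounded_node_weight e0 e1 n).1); exact: measurable_fst.
apply: measurable_prod => k _.
apply: (measurableT_comp (measurable_pos_power _)).
exact: (measurableT_comp (@measurable_tnth _ R m k)).
Qed.

Lemma cone_weight_ge0 e0 e1 n m u : 0 <= cone_weight e0 e1 n m u.
Proof.
rewrite /cone_weight mulr_ge0//.
  by rewrite mulr_ge0// node_weight_ge0.
by apply: prodr_ge0 => k _; exact: pos_power_ge0.
Qed.

Lemma cone_weight_neq0 e0 e1 n m u : cone_weight e0 e1 n m u != 0 ->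
  @unit_cube R n u.1 /\ forall k, 0 < tnth u.2 k.
Proof.
rewrite /cone_weight !mulf_eq0 !negb_or => /andP[/andP[c1 _] p].
split.
  by move: c1; rewrite indicE pnatr_eq0 eqb0 negbK inE.
move=> k; have /prodf_neq0/(_ k isT) := p.
by rewrite /pos_power; case: ltP => //; rewrite mul0r eqxx.
Qed.

Lemma pairing_cone_map D e0 e1 n m (q : {poly R}) u : (size q <= D)%N ->
  pairing D q (cone_map D e0 e1 n m u) =
  \sum_(k < m) tnth u.2 k * q.[(cone_nodes e0 e1 u.1)`_k].
Proof.
move=> sq; rewrite /pairing.
under eq_bigr do rewrite tnth_mktuple mulr_sumr.
rewrite exchange_big/=; apply: eq_bigr => k _.
rewrite (horner_coef_wide _ sq) mulr_sumr; apply: eq_bigr => i _.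
by rewrite mulrCA.
Qed.

Lemma cone_map_dual D e0 e1 n m u : @unit_cube R n u.1 ->
  (forall k, 0 <= tnth u.2 k) -> dual_cone D (cone_map D e0 e1 n m u).
Proof.
move=> cu w0 q sq nq; rewrite pairing_cone_map//; apply: sumr_ge0 => k _.
by rewrite mulr_ge0// nq// cone_nodes_itv.
Qed.

Lemma cone_map_insert D e0 e1 n m (u : n.-tuple R * m.-tuple R) :
  @tuple_insert R D.+1 ord_max (power_sum m (cone_nodes e0 e1 u.1) u.2 D)
    (cone_map D e0 e1 n m u) = cone_map D.+1 e0 e1 n m u.
Proof.
rewrite -[RHS](@deleteK _ _ ord_max) tnth_mktuple; congr tuple_insert.
by apply: eq_from_tnth => j; rewrite tnth_delete !tnth_mktuple lift_max.
Qed.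

Lemma gap_poly_coef (e0 e1 : bool) n (y : n.-tuple R) :
  (size (gap_poly e0 e1 n y) <= (2 * n + e0 + e1).+1)%N /\
  (gap_poly e0 e1 n y)`_(2 * n + e0 + e1) = 1.
Proof.
have mX k (a : R) : ('X - a%:P) ^+ k \is monic by rewrite monic_exp// monicXsubC.
have m1 : \prod_(j < n) ('X - (tnth y j)%:P) ^+ 2 \is monic by apply: monic_prod.
have s1 : size (\prod_(j < n) ('X - (tnth y j)%:P) ^+ 2) = (2 * n).+1.
  rewrite prodrXl.
  rewrite expr2 size_monicM ?monic_neq0// ?monic_prod_XsubC//.
  by rewrite !size_prod_XsubC /index_enum -enumT size_enum_ord; lia.
have mX1 : ('X - 1) ^+ e1 \is @monic R by rewrite -polyC1.
have m2 : 'X ^+ e0 * ('X - 1) ^+ e1 \is @monic R by rewrite rpredM// monicXn.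
have mg : gap_poly e0 e1 n y \is monic by rewrite rpredM.
have sg : size (gap_poly e0 e1 n y) = (2 * n + e0 + e1).+1.
  rewrite /gap_poly size_monicM ?monic_neq0// s1 size_monicM ?monicXn ?monic_neq0//.
  by rewrite size_polyXn -polyC1 size_exp_XsubC; lia.
split; first by rewrite sg.
by move/monicP : mg; rewrite /lead_coef sg.
Qed.

Lemma gap_poly_root (e0 e1 : bool) n (y : n.-tuple R) k : (k < n + e0 + e1)%N ->
  (gap_poly e0 e1 n y).[(cone_nodes e0 e1 y)`_k] = 0.
Proof.
move=> km; rewrite horner_gap_poly nth_cone_nodes.
case: (ltnP k e0) => [ke|ke].
  by case: e0 ke {km} => //= _; rewrite expr1 !mul0r.
case: (ltnP k) => [kn|kn].
  have kn' : (k - e0 < n)%N by rewrite ltn_subLR.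
  rewrite (bigD1 (Ordinal kn'))//= (tnth_nth 0)/= subrr.
  by rewrite expr0n/= mul0r mulr0.
rewrite ifT; last by lia.
have -> : e1 = true :> bool by move: km kn; case: e1 => //; lia.
by rewrite subrr expr1 mulr0 mul0r.
Qed.

(** The pairing with q is a weighted sum of values of q at the nodes plus q_D (t - tau). The sum is
    nonnegative, which gives sufficiency; for necessity, [gap_poly] up to sign is an admissible q
    that vanishes at all nodes. So a representation with the node 1 yields the upper end of the
    fibre, one without it the lower end. *)
Lemma half_cone_section (e0 e1 : bool) n m (u : n.-tuple R * m.-tuple R) t :
  let D := (2 * n + e0 + e1)%N in
  m = (n + e0 + e1)%N -> @unit_cube R n u.1 -> (forall k, 0 < tnth u.2 k) ->
  half_cone e1 D (@tuple_insert R D.+1 ord_max t (cone_map D e0 e1 n m u)) <->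
  0 <= (-1) ^+ e1 * (t - power_sum m (cone_nodes e0 e1 u.1) u.2 D).
Proof.
move=> D mE cu w0; set tau := power_sum _ _ _ _.
have E (q : {poly R}) : (size q <= D.+1)%N ->
    pairing D.+1 q (@tuple_insert R D.+1 ord_max t (cone_map D e0 e1 n m u)) =
    \sum_(k < m) tnth u.2 k * q.[(cone_nodes e0 e1 u.1)`_k] + q`_D * (t - tau).
  move=> sq; rewrite -(pairing_cone_map D.+1)// -cone_map_insert !pairing_insert.
  by rewrite -/tau; ring.
split=> [H|H q sq nq qD].
  have [sg gD] := gap_poly_coef e0 e1 n u.1.
  have := H ((-1) ^+ e1 *: gap_poly e0 e1 n u.1).
  rewrite E; last by rewrite (leq_trans (size_scale_leq _ _)).
  rewrite big1 ?add0r; last first.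
    by move=> k _; rewrite hornerZ gap_poly_root ?mulr0// -mE.
  rewrite coefZ gD mulr1; apply.
  - by rewrite (leq_trans (size_scale_leq _ _)).
  - move=> s /andP[s0 s1]; rewrite hornerZ horner_gap_poly.
    have H3 : 0 <= (-1) ^+ e1 * (s - 1) ^+ e1.
      by rewrite -exprMn mulN1r opprB exprn_ge0// subr_ge0.
    rewrite -!mulrA mulrCA mulr_ge0 ?exprn_ge0// mulrA mulr_ge0//.
    by apply: prodr_ge0 => j _; exact: sqr_ge0.
  - by rewrite -expr2 sqrr_sign.
rewrite E// addr_ge0//.
  by apply: sumr_ge0 => k _; rewrite mulr_ge0 ?(ltW (w0 k))// nq// cone_nodes_itv.
have -> : q`_D * (t - tau) = ((-1) ^+ e1 * q`_D) * ((-1) ^+ e1 * (t - tau)).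
  by rewrite mulrACA -expr2 sqrr_sign mul1r.
by rewrite mulr_ge0// ltW.
Qed.

End cone.

(** * Laplace transform of the measure on nodes and weights *)

Section cone_laplace.
Context {R : realType}.
Local Notation leb := (@lebesgue_measure R).

Lemma ge0_integral_affine (r s : R) (f : R -> \bar R) : 0 < r ->
  measurable_fun setT (f : measurableTypeR R -> \bar R) -> (forall x, (0 <= f x)%E) ->
  (\int[leb]_x f x = r%:E * \int[leb]_x f (r * x + s)%R)%E.
Proof.
move=> r0 mf f0.
pose phi (x : measurableTypeR R) : measurableTypeR R := r * x + s.
have mphi : measurable_fun setT phi.
  by apply: measurable_funD => //; exact: measurable_funM.
have [rn rE] : exists rn : {nonneg R}, rn%:num = r by exists (NngNum (ltW r0)).
(* This measure gives every half-open interval its length, hence it is Lebesgue measure. *)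
pose M : {measure set (measurableTypeR R) -> \bar R} :=
  mscale rn (pushforward leb phi).
have phi_itv (a b : R) : phi @^-1` `]a, b]%classic = `](a - s) / r, (b - s) / r]%classic.
  apply/seteqP; split => x; rewrite /phi/= !in_itv/=.
    by rewrite ltr_pdivrMr// ler_pdivlMr// ltrBlDr lerBrDr mulrC.
  by rewrite ltr_pdivrMr// ler_pdivlMr// ltrBlDr lerBrDr mulrC.
have ME A : measurable A -> leb A = M mphi A.
  apply: (@lebesgue_measure_unique R (M mphi)) => _ [[a b]] _ <-/=.
  rewrite /M /mscale /= /pushforward phi_itv !lebesgue_measure_itv /= !lte_fin rE.
  rewrite ltr_pM2r ?invr_gt0// ltrD2r; case: ifPn => _; last by rewrite mule0.
  by rewrite -!EFinB -EFinM; congr EFin; field; rewrite gt_eqF.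
transitivity (\int[M mphi]_x f x)%E.
  by apply: eq_measure_integral => A mA _; exact: ME.
rewrite /M ge0_integral_mscale// rE; congr (_ * _)%E.
by rewrite ge0_integral_pushforward// preimage_setT.
Qed.

Lemma measurable_le_indic (a : R) : measurable_fun setT (fun t : R => (a <= t)%R%:R : R).
Proof.
rewrite (_ : (fun _ => _) = \1_(`[a, +oo[%classic : set R)).
  by apply: measurable_indic; exact: measurable_itv.
apply/funext => w; rewrite indicE; congr ((nat_of_bool _)%:R).
by apply/idP/idP; rewrite inE /= in_itv/= andbT.
Qed.

Lemma integral_expR_tail (a l : R) : 0 < l ->
  (\int[leb]_t ((a <= t)%R%:R * expR (- (l * t)))%:E = (expR (- (l * a)) / l)%:E)%E.
Proof.
move=> l0.
have mf : measurable_fun setT (fun t : R => (a <= t)%R%:R * expR (- (l * t))).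
  apply: measurable_funM; first exact: measurable_le_indic.
  by apply: measurableT_comp => //; apply: measurable_funN; exact: measurable_funM.
rewrite (ge0_integral_affine 1 a _ ltr01); last 2 first.
- exact/measurable_EFinP.
- by move=> t; rewrite lee_fin mulr_ge0// expR_ge0.
rewrite mul1e; transitivity (\int[leb]_(t in `[0%R, +oo[) (expR (- (l * a)) * expR (- (t * l)))%:E)%E.
  rewrite [RHS]integral_mkcond; apply: eq_integral => t _; rewrite patchE.
  rewrite mul1r lerDr; have -> : (t \in `[0%R, +oo[%classic) = (0 <= t).
    by apply/idP/idP; rewrite inE /= in_itv/= andbT.
  by case: ifPn => _; rewrite ?mul0r// mul1r -expRD; congr (expR _)%:E; ring.
have me : measurable_fun setT (fun t : R => expR (- (t * l))).
  by apply: measurableT_comp => //; apply: measurable_funN; exact: measurable_funM.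
rewrite -integral_itv_obnd_cbnd; last first.
  by apply/measurable_EFinP/measurable_funTS/measurable_funM.
transitivity (\int[leb]_t ((expR (- (l * a)))%:E * (pos_power 0 t * expR (- (t * l)))%:E))%E.
  rewrite [LHS]integral_mkcond; apply: eq_integral => t _; rewrite patchE /pos_power.
  have -> : (t \in `]0%R, +oo[%classic) = (0 < t).
    by apply/idP/idP; rewrite inE /= in_itv/= andbT.
  by case: ifPn => _; rewrite ?mul0r ?mule0// expr0 !mul1r.
rewrite ge0_integralZl_EFin ?expR_ge0//; last 2 first.
- by move=> t _; rewrite lee_fin mulr_ge0 ?pos_power_ge0// expR_ge0.
- by apply/measurable_EFinP/measurable_funM => //; exact: measurable_pos_power.
by rewrite (integral_pos_power false)// expr1 -EFinM.
Qed.

Lemma prod_cone_nodes (e0 e1 : bool) n m (x : n.-tuple R) (p : {poly R}) :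
  m = (n + e0 + e1)%N ->
  \prod_(k < m) p.[(cone_nodes e0 e1 x)`_k] ^- (node_double e0 n k).+1 =
  (\prod_(k < n) p.[tnth x k] ^- 2) * (p.[0] ^- e0 * p.[1] ^- e1).
Proof.
move=> ->.
pose G k := p.[(cone_nodes e0 e1 x)`_k] ^- (node_double e0 n k).+1.
rewrite -/(G _) -(big_mkord xpredT G) /= (_ : (n + e0 + e1)%N = (e0 + (n + e1))%N); last by lia.
rewrite (@big_cat_nat _ _ _ e0)//= ?leq_addr//.
rewrite (@big_cat_nat _ _ _ (e0 + n) e0)//= ?leq_add2l ?leq_addr//.
rewrite mulrCA; congr (_ * (_ * _)).
- rewrite -{1}[nat_of_bool e0]add0n big_addn addKn big_mkord; apply: eq_bigr => k _.
  rewrite /G nth_cone_nodes /node_double leq_addl addnC ltn_add2l ltn_ord.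
  by rewrite ltnNge leq_addr/= addKn (tnth_nth 0).
- rewrite /G /node_double; case: e0 {G} => /=; last by rewrite big_geq// expr0 invr1.
  by rewrite big_nat1 /= expr1.
- rewrite addnA -{1}[(e0 + n)%N]add0n big_addn addKn big_mkord.
  have GE k : (k < e1)%N -> G (k + (e0 + n))%N = p.[1]^-1.
    move=> ke; rewrite /G nth_cone_nodes /node_double.
    rewrite (_ : (k + (e0 + n) < e0)%N = false); last by apply/negbTE; rewrite -leqNgt; lia.
    rewrite (_ : (k + (e0 + n) < e0 + n)%N = false); last by apply/negbTE; rewrite -leqNgt; lia.
    rewrite (_ : (k + (e0 + n) < e0 + n + e1)%N); last by lia.
    by rewrite andbF expr1.
  rewrite (eq_bigr (fun=> p.[1]^-1)); last by move=> k _; exact: GE.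
  by rewrite prodr_const card_ord exprVn.
Qed.

(** For fixed nodes the pairing is linear in the weights, so their integral factors. D is any bound
    on the size of p: the induction also applies the formula one dimension above 2 n + e0 + e1. *)
Lemma laplace_cone (e0 e1 : bool) n m D (p : {poly R}) (c : R) :
  0 < c -> (forall t, 0 <= t <= 1 -> c <= p.[t]) -> (size p <= D)%N ->
  m = (n + e0 + e1)%N ->
  (\int[lebesgue_tuple R n \x lebesgue_tuple R m]_u
    (cone_weight e0 e1 n m u * expR (- pairing D p (cone_map D e0 e1 n m u)))%:E =
   (laplace_integral p e0 e1 n)%:E)%E.
Proof.
move=> c0 pc sp mE.
have mpair : measurable_fun setT (fun u => cone_weight e0 e1 n m u *
    expR (- pairing D p (cone_map D e0 e1 n m u))).
  apply: measurable_funM; first exact: measurable_cone_weight.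
  apply: measurableT_comp => //; apply: measurable_funN.
  apply: measurable_sum => i; apply: measurable_funM => //.
  exact: (measurableT_comp (@measurable_tnth _ R D i) (measurable_cone_map D e0 e1 n m)).
rewrite fubini_tonelli1/=; last 2 first.
- exact/measurable_EFinP.
- by move=> u; rewrite lee_fin mulr_ge0 ?expR_ge0// cone_weight_ge0.
rewrite /laplace_integral -cube_integralE; last exact: (cube_bounded_laplace_weight p c).
rewrite [RHS]integral_mkcond; apply: eq_integral => x _; rewrite patchE /fubini_F.
case: ifPn => [/[!inE] cx|ncx]; last first.
  apply: integral0_eq => w _.
  by rewrite /cone_weight /= indicE (negbTE ncx) !mul0r.
have pz k : 0 < p.[(cone_nodes e0 e1 x)`_k].
  by apply: (lt_le_trans c0); apply: pc; exact: cone_nodes_itv.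
transitivity (\int[lebesgue_tuple R m]_w ((node_weight e0 e1 n x)%:E *
    \prod_(k < m) (pos_power (node_double e0 n k) (tnth w k) *
      expR (- (tnth w k * p.[(cone_nodes e0 e1 x)`_k])))%:E))%E.
  apply: eq_integral => w _; rewrite pairing_cone_map//= /cone_weight /= indicE mem_set// mul1r.
  rewrite prodEFin -EFinM; congr EFin; rewrite -mulrA; congr (_ * _).
  by rewrite -sumrN expR_sum -big_split.
have mt k : measurable_fun setT (fun t : R =>
    (pos_power (node_double e0 n k) t * expR (- (t * p.[(cone_nodes e0 e1 x)`_k])))%:E).
  apply/measurable_EFinP/measurable_funM; first exact: measurable_pos_power.
  by apply: measurableT_comp => //; apply: measurable_funN; exact: measurable_funM.
have t0 k t : (0 <= (pos_power (node_double e0 n k) t *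
    expR (- (t * p.[(cone_nodes e0 e1 x)`_k])))%:E)%E.
  by rewrite lee_fin mulr_ge0 ?expR_ge0// pos_power_ge0.
rewrite ge0_integralZl_EFin ?node_weight_ge0//; last 2 first.
- by move=> w _; apply: prode_ge0.
- apply: emeasurable_prod => k.
  exact: (measurableT_comp (mt k) (@measurable_tnth _ (measurableTypeR R) m k)).
rewrite (ge0_integral_lebesgue_prod m (fun k t =>
  (pos_power (node_double e0 n k) t * expR (- (t * p.[(cone_nodes e0 e1 x)`_k])))%:E)); [|by move=> k; exact: mt|by []].
under eq_bigr do rewrite integral_pos_power//.
by rewrite prodEFin -EFinM prod_cone_nodes// /laplace_weight -[in RHS]mulrA.
Qed.

End cone_laplace.

(** * From Laplace transforms to the identity of measures *)

Section cone_uniform.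
Context {R : realType}.
Local Notation leb := (@lebesgue_measure R).

(** Open rays arise as fibres of the complement of [half_cone true]; the end point is negligible. *)
Lemma integral_expR_tail_strict (a l : R) : 0 < l ->
  (\int[leb]_t ((a < t)%R%:R * expR (- (l * t)))%:E = (expR (- (l * a)) / l)%:E)%E.
Proof.
move=> l0; rewrite -(integral_expR_tail a l l0).
have me : measurable_fun setT (fun t : R => expR (- (l * t))).
  by apply: measurableT_comp => //; apply: measurable_funN; exact: measurable_funM.
transitivity (\int[leb]_(t in `]a, +oo[) (expR (- (l * t)))%:E)%E.
  rewrite [RHS]integral_mkcond; apply: eq_integral => t _; rewrite patchE.
  have -> : (t \in `]a, +oo[%classic) = (a < t).
    by apply/idP/idP; rewrite inE /= in_itv/= andbT.
  by case: ifPn => _; rewrite ?mul0r// mul1r.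
rewrite integral_itv_obnd_cbnd; last exact/measurable_EFinP/measurable_funTS.
rewrite [LHS]integral_mkcond; apply: eq_integral => t _; rewrite patchE.
have -> : (t \in `[a, +oo[%classic) = (a <= t).
  by apply/idP/idP; rewrite inE /= in_itv/= andbT.
by case: ifPn => _; rewrite ?mul0r// mul1r.
Qed.

Definition cone_laplace D (p : {poly R}) : \bar R :=
  (\int[lebesgue_tuple R D]_c (\1_(@dual_cone R D) c * expR (- pairing D p c))%:E)%E.

Definition cone_uniform D := forall (e0 e1 : bool) n m,
  (2 * n + e0 + e1)%N = D -> m = (n + e0 + e1)%N ->
  forall h : D.-tuple R -> \bar R, measurable_fun setT h -> (forall c, 0 <= h c)%E ->
  (\int[lebesgue_tuple R n \x lebesgue_tuple R m]_u
     ((cone_weight e0 e1 n m u)%:E * h (cone_map D e0 e1 n m u)) =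
   \int[lebesgue_tuple R D]_c ((n`!%:R * \1_(@dual_cone R D) c)%:E * h c))%E.

(** The top coefficient is taken positive so that the exponential is integrable over rays going up
    in the last coordinate. *)
Definition cone_laplace_uniform D := forall (e0 e1 : bool) n (p : {poly R}) (c : R),
  0 < c -> (forall t, 0 <= t <= 1 -> c <= p.[t]) -> (size p <= D)%N -> 0 < p`_D.-1 ->
  (2 * n + e0 + e1)%N = D ->
  ((n`!%:R)%:E * cone_laplace D p = (laplace_integral p e0 e1 n)%:E)%E.

Lemma measurable_pairing D (p : {poly R}) : measurable_fun setT (@pairing R D p).
Proof.
apply: measurable_sum => i; apply: measurable_funM => //.
exact: (@measurable_tnth _ R D i).
Qed.

Lemma measurable_expR_pairing D (p : {poly R}) :
  measurable_fun setT (fun c : D.-tuple R => expR (- pairing D p c)).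
Proof.
by apply: measurableT_comp => //; apply: measurable_funN; exact: measurable_pairing.
Qed.

Lemma dual_cone_ge0 D (c : D.-tuple R) : dual_cone D c -> forall i, 0 <= tnth c i.
Proof.
move=> cK i; have := cK 'X^i.
rewrite size_polyXn ltn_ord => /(_ isT).
have -> : pairing D 'X^i c = tnth c i.
  rewrite /pairing (bigD1 i)//= coefXn eqxx mul1r big1 ?addr0// => j ji.
  by rewrite coefXn (_ : (j == i :> nat) = false) ?mul0r//; exact/negbTE.
by apply => t /andP[t0 _]; rewrite hornerXn exprn_ge0.
Qed.

(** Integer Laplace points determine the measure. [P k] has the coefficients k_i + 1, so it is at
    least 1 on [0, 1] and its top coefficient is positive. *)
Lemma cone_uniform_of_laplace D : (0 < D)%N -> cone_laplace_uniform D -> cone_uniform D.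
Proof.
move=> D0 HL e0 e1 n m DE mE h mh h0.
pose P (k : 'I_D -> nat) : {poly R} :=
  \poly_(j < D) (if insub j is Some i then (k i).+1%:R else 0).
have PE k i : (P k)`_i = if insub i is Some j then (k j).+1%:R else 0.
  rewrite coef_poly; case: insubP => [j ij _|]; first by rewrite ij.
  by move/negbTE ->.
have Pi k (i : 'I_D) : (P k)`_i = (k i).+1%:R by rewrite PE valK.
have P0 k t : 0 <= t <= 1 -> 1 <= (P k).[t].
  move=> /andP[t0 t1]; rewrite (horner_coef_wide _ (size_poly _ _)).
  under eq_bigr do rewrite Pi.
  rewrite (bigD1 (Ordinal D0))//= expr0 mulr1.
  rewrite -[leLHS]addr0 lerD ?ler1n//; apply: sumr_ge0 => i _.
  by rewrite mulr_ge0// exprn_ge0.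
have sP k : (size (P k) <= D)%N by exact: size_poly.
have lapE k (c : D.-tuple R) :
    \prod_(i < D) expR (- tnth c i) ^+ (k i).+1 = expR (- pairing D (P k) c).
  rewrite /pairing -sumrN expR_sum; apply: eq_bigr => i _.
  by rewrite Pi -expRM_natr; congr expR; ring.
have LP k : (\int[lebesgue_tuple R D]_c
    (n`!%:R * \1_(@dual_cone R D) c * expR (- pairing D (P k) c))%:E =
    (laplace_integral (P k) e0 e1 n)%:E)%E.
  rewrite -(HL e0 e1 n (P k) 1)//; last 2 first.
  - exact: P0.
  - by rewrite (Pi k (Ordinal (ltac:(by rewrite prednK) : (D.-1 < D)%N))).
  rewrite /cone_laplace -ge0_integralZl_EFin//.
  - by apply: eq_integral => c _; rewrite -EFinM mulrA.
  apply/measurable_EFinP/measurable_funM; last exact: measurable_expR_pairing.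
  exact: measurable_indic (@measurable_dual_cone R D).
apply: (laplace_determine _ _ _ _ (lebesgue_tuple R n \x lebesgue_tuple R m)%E
  (lebesgue_tuple R D) D (cone_weight e0 e1 n m) (cone_map D e0 e1 n m)
  (fun c => n`!%:R * \1_(@dual_cone R D) c) id) => //.
- exact: measurable_cone_weight.
- exact: measurable_cone_map.
- by apply: measurable_funM => //; exact: measurable_indic (@measurable_dual_cone R D).
- exact: cone_weight_ge0.
- move=> u /cone_weight_neq0[cu w0]; apply: dual_cone_ge0; apply: cone_map_dual => // k.
  exact/ltW/w0.
- move=> c; rewrite mulf_eq0 negb_or => /andP[_]; rewrite indicE pnatr_eq0 eqb0 negbK inE.
  exact: dual_cone_ge0.
- move=> k; under eq_integral do rewrite lapE.
  under [RHS]eq_integral do rewrite lapE.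
  by rewrite LP; apply: (@laplace_cone R e0 e1 n m D (P k) 1) => //; exact: P0.
- have := @laplace_cone R e0 e1 n m D (P (fun=> 0%N)) 1 ltr01 (P0 _) (sP _) mE.
  move=> L0; apply: (@le_lt_trans _ _ (laplace_integral (P (fun=> 0%N)) e0 e1 n)%:E); last exact: ltry.
  rewrite -L0 le_eqVlt; apply/orP; left; apply/eqP; apply: eq_integral => u _.
  by rewrite -lapE; congr (_ * _)%:E; apply: eq_bigr => i _; rewrite expr1.
Qed.

(** In dimension 1 there is no interior node and exactly one end is a node; the cone is a half-line
    and both sides are 1 / p_0. *)
Lemma cone_laplace_uniform1 : cone_laplace_uniform 1.
Proof.
move=> e0 e1 n p c c0 pc sp p0 nE.
have n0 : n = 0%N by lia.
have pC : p = (p`_0)%:P by exact: size1_polyC.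
rewrite n0 mul1e.
have -> : laplace_integral p e0 e1 0 = (p`_0)^-1.
  rewrite /laplace_integral (_ : laplace_weight _ _ _ _ = fun=> (p`_0)^-1) ?cube_integral_cst//.
  apply/funext => x; rewrite /laplace_weight /node_weight /sqdisc !big_ord0 !mulr1 mul1r.
  rewrite pC !hornerC coefC eqxx.
  by case: e0 nE; case: e1; rewrite n0//= expr0 expr1 invr1 ?mul1r ?mulr1.
rewrite -[RHS](_ : (expR (- (p`_0 * 0)) / p`_0)%:E = _); last first.
  by rewrite mulr0 oppr0 expR0 mul1r.
rewrite -integral_expR_tail// /cone_laplace.
pose f (i : 'I_1) t := ((0 <= t)%R%:R * expR (- (p`_0 * t)))%:E.
transitivity (\int[lebesgue_tuple R 1]_x \prod_(i < 1) f i (tnth x i))%E.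
  apply: eq_integral => x _; rewrite big_ord1 /f; congr EFin.
  have -> : pairing 1 p x = p`_0 * tnth x ord0 by rewrite /pairing big_ord1.
  congr (_ * _); rewrite indicE; congr ((nat_of_bool _)%:R).
  apply/idP/idP; first by rewrite inE => xK; exact: dual_cone_ge0.
  move=> x0; rewrite inE => q sq nq.
  rewrite /pairing big_ord1 mulr_ge0//.
  by have := nq 0; rewrite lexx ler01 horner_coef0; apply.
rewrite ge0_integral_lebesgue_prod ?big_ord1//.
  move=> i; apply/measurable_EFinP/measurable_funM; first exact: measurable_le_indic.
  by apply: measurableT_comp => //; apply: measurable_funN; exact: measurable_funM.
by move=> i t; rewrite lee_fin mulr_ge0// expR_ge0.
Qed.

End cone_uniform.

(** * Induction on the dimension of the cone *)

Section cone_induction.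
Context {R : realType}.
Local Notation leb := (@lebesgue_measure R).

(** Subtraction in the extended reals: that b is finite follows from the finite value of N a. *)
Lemma ereal_balance (N N' r r' : R) (a b d : \bar R) : 0 < N -> 0 < N' ->
  (0 <= b)%E -> (N%:E * a = r%:E)%E -> (N'%:E * d = r'%:E)%E ->
  (N%:E * a = N%:E * b + N%:E * d)%E -> b = (r / N - r' / N')%:E.
Proof.
move=> N0 N'0 b0 aE dE; rewrite aE.
have -> : d = (r' / N')%:E by rewrite mulrC EFinM -dE muleA -EFinM mulVf ?gt_eqF// mul1e.
case: b b0 => [b _|_|]//; last by rewrite gt0_muley.
by rewrite -!EFinM -EFinD => -[] ->; congr EFin; field; rewrite !gt_eqF.
Qed.

Section step.
Variables (D : nat) (p : {poly R}) (c : R).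
Hypotheses (c0 : 0 < c) (pc : forall t, 0 <= t <= 1 -> c <= p.[t]).
Hypotheses (sp : (size p <= D.+1)%N) (pD : 0 < p`_D).

Local Notation ins t y := (@tuple_insert R D.+1 ord_max t y).

Let slice (A : set (D.+1.-tuple R)) (y : D.-tuple R) : \bar R :=
  (\int[leb]_t (\1_A (ins t y) * expR (- (p`_D * t)))%:E)%E.

Let mslice_fun (A : set (D.+1.-tuple R)) : measurable A ->
  measurable_fun setT (fun u : D.-tuple R * measurableTypeR R =>
    (\1_A (ins u.2 u.1) * expR (- (p`_D * u.2)))%:E).
Proof.
move=> mA; apply/measurable_EFinP/measurable_funM.
  exact: (measurableT_comp (measurable_indic mA) (@measurable_insert R D.+1 ord_max)).
apply: measurableT_comp => //; apply: measurable_funN; exact: measurable_funM.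
Qed.

Let mslice_sect (A : set (D.+1.-tuple R)) y : measurable A ->
  measurable_fun setT (fun t : measurableTypeR R =>
    (\1_A (ins t y) * expR (- (p`_D * t)))%:E).
Proof.
by move=> mA; exact: (measurableT_comp (mslice_fun A mA) (pair1_measurable y)).
Qed.

Let slice_ge0 A y : (0 <= slice A y)%E.
Proof. by apply: integral_ge0 => t _; rewrite lee_fin mulr_ge0// expR_ge0. Qed.

Let measurable_slice A : measurable A -> measurable_fun setT (slice A).
Proof.
move=> mA; apply: (measurable_fun_fubini_tonelli_F _ (mslice_fun A mA)) => u.
by rewrite lee_fin mulr_ge0// expR_ge0.
Qed.

Let weighted (A : set (D.+1.-tuple R)) : \bar R :=
  (\int[lebesgue_tuple R D]_y
    ((\1_(@dual_cone R D) y * expR (- pairing D p y))%:E * slice A y))%E.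

Let HF := @half_cone R false D.
Let HT := @half_cone R true D.

Let mHF : measurable HF. Proof. exact: measurable_half_cone. Qed.
Let mHT : measurable HT. Proof. exact: measurable_half_cone. Qed.

Let cone_laplaceE : cone_laplace D.+1 p = weighted (HF `&` HT).
Proof.
rewrite /cone_laplace (ge0_integral_lebesgue_insert D ord_max); last 2 first.
- apply/measurable_EFinP/measurable_funM; last exact: measurable_expR_pairing.
  exact: measurable_indic (@measurable_dual_cone R D.+1).
- by move=> y; rewrite lee_fin mulr_ge0// expR_ge0.
apply: eq_integral => y _; rewrite /slice -ge0_integralZl_EFin; last 4 first.
- exact: measurableT.
- by move=> t _; rewrite lee_fin mulr_ge0// expR_ge0.
- exact: (mslice_sect (HF `&` HT) y (measurableI _ _ mHF mHT)).
- by rewrite mulr_ge0// expR_ge0.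
apply: eq_integral => t _; rewrite -EFinM; congr EFin.
rewrite pairing_insert opprD expRD mulrACA; congr (_ * _).
rewrite !indicE -natrM mulnb; congr ((nat_of_bool _)%:R).
apply/idP/andP; rewrite !inE.
  by move/dual_cone_insert => [].
by move=> [K [F T]]; exact/dual_cone_insert.
Qed.

(** The induction hypothesis moves an integral over the cone to nodes and weights, in whichever type
    of representation suits A. *)
Let transfer (A : set (D.+1.-tuple R)) (e0 e1 : bool) n m : measurable A ->
  cone_uniform (R := R) D -> (2 * n + e0 + e1)%N = D -> m = (n + e0 + e1)%N ->
  ((n`!%:R)%:E * weighted A =
   \int[lebesgue_tuple R n \x lebesgue_tuple R m]_u
     ((cone_weight e0 e1 n m u)%:E *
      ((expR (- pairing D p (cone_map D e0 e1 n m u)))%:E *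
       slice A (cone_map D e0 e1 n m u))))%E.
Proof.
move=> mA HU DE mE.
have mh : measurable_fun setT (fun y => (expR (- pairing D p y))%:E * slice A y)%E.
  apply: emeasurable_funM; last exact: measurable_slice.
  by apply/measurable_EFinP; exact: measurable_expR_pairing.
rewrite (HU e0 e1 n m DE mE _ mh); last first.
  by move=> y; rewrite mule_ge0// lee_fin expR_ge0.
rewrite /weighted -ge0_integralZl_EFin//; last 2 first.
- by move=> y _; rewrite mule_ge0// lee_fin mulr_ge0// expR_ge0.
- apply: emeasurable_funM; last exact: measurable_slice.
  apply/measurable_EFinP/measurable_funM; last exact: measurable_expR_pairing.
  exact: measurable_indic (@measurable_dual_cone R D).
by apply: eq_integral => y _; rewrite !EFinM !muleA.
Qed.

(** When the fibre integral is that of a ray starting at the next moment, the exponentials combine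
    into the one for the pairing in dimension D + 1 at the same nodes, and [laplace_cone] applies
    again. *)
Let boundary (A : set (D.+1.-tuple R)) (e0 e1 : bool) n m : measurable A ->
  cone_uniform (R := R) D -> (2 * n + e0 + e1)%N = D -> m = (n + e0 + e1)%N ->
  (forall u, cone_weight e0 e1 n m u != 0 -> slice A (cone_map D e0 e1 n m u) =
    (expR (- (p`_D * power_sum m (cone_nodes e0 e1 u.1) u.2 D)) / p`_D)%:E) ->
  ((n`!%:R)%:E * weighted A = (laplace_integral p e0 e1 n / p`_D)%:E)%E.
Proof.
move=> mA HU DE mE HA; rewrite (transfer A e0 e1 n m)//.
have L := @laplace_cone R e0 e1 n m D.+1 p c c0 pc sp mE.
rewrite mulrC EFinM -L -ge0_integralZl_EFin; last 4 first.
- exact: measurableT.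
- by move=> u _; rewrite lee_fin mulr_ge0 ?expR_ge0// cone_weight_ge0.
- apply/measurable_EFinP/measurable_funM; first exact: measurable_cone_weight.
  exact: (measurableT_comp (measurable_expR_pairing D.+1 p) (measurable_cone_map _ _ _ _ _)).
- by rewrite invr_ge0 ltW.
apply: eq_integral => u _.
have [->|u0] := eqVneq (cone_weight e0 e1 n m u) 0; first by rewrite mul0r mul0e mule0.
rewrite HA// -!EFinM; congr EFin.
by rewrite -cone_map_insert pairing_insert opprD expRD; ring.
Qed.

(* Almost every point of dual_cone D is represented once with 1 as a node and once
   without; the D-th moments of the two representations are the ends of the fibre
   of dual_cone D.+1 above it. *)
Lemma cone_laplace_step (e0 e0' : bool) n n' : cone_uniform (R := R) D ->
  (2 * n + e0 + false)%N = D -> (2 * n' + e0' + true)%N = D ->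
  (cone_laplace D.+1 p = ((laplace_integral p e0 false n / n`!%:R -
    laplace_integral p e0' true n' / n'`!%:R) / p`_D)%:E)%E.
Proof.
move=> HU DE DE'.
have l0 := pD.
have Lw : ((n`!%:R)%:E * weighted HF = (laplace_integral p e0 false n / p`_D)%:E)%E.
  apply: (boundary HF e0 false n _ mHF HU DE erefl) => u /cone_weight_neq0[cu w0].
  rewrite /slice -integral_expR_tail//; apply: eq_integral => t _.
  congr (_ * _)%:E; rewrite indicE; congr ((nat_of_bool _)%:R).
  have := half_cone_section e0 false n _ u t erefl cu w0.
  rewrite /= DE expr0 mul1r subr_ge0 => HS.
  by apply/idP/idP; rewrite inE => /HS.
(* Only upward rays have a finite integral since p_D > 0, so the upper bound enters through the
   complement of [HT]. *)
have Up : ((n'`!%:R)%:E * weighted (~` HT) = (laplace_integral p e0' true n' / p`_D)%:E)%E.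
  apply: (boundary (~` HT) e0' true n' _ (measurableC mHT) HU DE' erefl) => u /cone_weight_neq0[cu w0].
  rewrite /slice -integral_expR_tail_strict//; apply: eq_integral => t _.
  congr (_ * _)%:E; rewrite indicE; congr ((nat_of_bool _)%:R).
  have := half_cone_section e0' true n' _ u t erefl cu w0.
  rewrite /= DE' expr1 mulN1r opprB subr_ge0 => HS.
  rewrite ltNge; apply/idP/negP; rewrite inE => H; [by move/HS|move/HS].
  by [].
have mT (A : set (D.+1.-tuple R)) : measurable A ->
    measurable_fun setT (fun u => (cone_weight e0 false n (n + e0 + false) u)%:E *
      ((expR (- pairing D p (cone_map D e0 false n (n + e0 + false) u)))%:E *
       slice A (cone_map D e0 false n (n + e0 + false) u)))%E.
  move=> mA; apply: emeasurable_funM.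
    by apply/measurable_EFinP; exact: measurable_cone_weight.
  apply: emeasurable_funM.
    apply/measurable_EFinP.
    exact: (measurableT_comp (measurable_expR_pairing D p) (measurable_cone_map _ _ _ _ _)).
  exact: (measurableT_comp (measurable_slice A mA) (measurable_cone_map _ _ _ _ _)).
have T0 (A : set (D.+1.-tuple R)) u : (0 <= (cone_weight e0 false n (n + e0 + false) u)%:E *
      ((expR (- pairing D p (cone_map D e0 false n (n + e0 + false) u)))%:E *
       slice A (cone_map D e0 false n (n + e0 + false) u)))%E.
  by rewrite mule_ge0 ?lee_fin ?cone_weight_ge0// mule_ge0// lee_fin expR_ge0.
have mST := measurableI _ _ mHF mHT.
have mCT := measurableC mHT.
(* All three terms are moved to the same representation, the one without the node 1; the inclusion
   of the complement of [HT] in [HF] is then checked at represented points only. *)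
have Sp : ((n`!%:R)%:E * weighted HF =
    (n`!%:R)%:E * weighted (HF `&` HT) + (n`!%:R)%:E * weighted (~` HT))%E.
  have T1 := transfer HF e0 false n _ mHF HU DE erefl.
  have T2 := transfer (HF `&` HT) e0 false n _ mST HU DE erefl.
  have T3 := transfer (~` HT) e0 false n _ mCT HU DE erefl.
  rewrite [LHS]T1 [X in (X + _)%E]T2 [X in (_ + X)%E]T3.
  rewrite -ge0_integralD; last 5 first.
  - exact: measurableT.
  - by move=> u _; exact: T0.
  - exact: (mT (HF `&` HT)).
  - by move=> u _; exact: T0.
  - exact: (mT (~` HT)).
  apply: eq_integral => u _.
  have [->|u0] := eqVneq (cone_weight e0 false n (n + e0 + false) u) 0.
    by rewrite !mul0e adde0.
  have [cu w0] := cone_weight_neq0 _ _ _ _ _ u0.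
  rewrite -muleDr ?ge0_adde_def ?inE ?mule_ge0 ?lee_fin ?expR_ge0//.
  rewrite -muleDr ?ge0_adde_def ?inE//; congr (_ * (_ * _))%E.
  have sl0 (A : set (D.+1.-tuple R)) t :
      (0 <= (\1_A (ins t (cone_map D e0 false n (n + e0 + false) u)) *
        expR (- (p`_D * t)))%:E)%E.
    by rewrite lee_fin mulr_ge0// expR_ge0.
  rewrite /slice -ge0_integralD//; last 2 first.
  - exact: (mslice_sect (HF `&` HT) _ mST).
  - exact: (mslice_sect (~` HT) _ mCT).
  apply: eq_integral => t _; rewrite -EFinD -mulrDl; congr (_ * _)%:E.
  set y := ins t _.
  have [yT|yT] := pselect (HT y).
    rewrite !indicE [y \in ~` HT]memNset ?addr0; last by move=> /(_ yT).
    by congr ((nat_of_bool _)%:R); apply/idP/idP => /[!inE]; [move=> yF; split|case].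
  (* If t were below the lower end tau, then, since the point with last coordinate tau lies in the
     cone and lowering this coordinate preserves the conditions of [HT], the point [y] would lie in
     [HT]. *)
  have yF : HF y.
    have := half_cone_section e0 false n _ u t erefl cu w0.
    rewrite /= DE expr0 mul1r subr_ge0 => HS; apply/HS.
    rewrite leNgt; apply/negP => ttau; apply: yT => q sq nq qD.
    have := cone_map_dual D.+1 e0 false n _ u cu (fun k => ltW (w0 k)) q sq nq.
    rewrite -cone_map_insert !pairing_insert => H; apply: (le_trans H).
    by rewrite lerD2l ler_wnM2l ?(ltW ttau)// ltW// -oppr_gt0 -mulN1r -(expr1 (-1)).
  rewrite !indicE (mem_set yF) memNset; last by case.
  by rewrite mem_set// add0r.
have nf k : 0 < (k`!%:R : R) by rewrite ltr0n fact_gt0.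
have v0 : (0 <= weighted (HF `&` HT))%E.
  by apply: integral_ge0 => y _; rewrite mule_ge0// lee_fin mulr_ge0// expR_ge0.
have := ereal_balance _ _ _ _ _ _ _ (nf n) (nf n') v0 Lw Up Sp.
rewrite cone_laplaceE => ->; congr EFin.
by field; rewrite !gt_eqF.
Qed.

End step.

(** For every choice of ends the recursion has on its right one integral without the node 1 and one
    with it, both one dimension lower. The factor n of the fluxes turns 1 / n! into 1 / (n - 1)!
    where an interior node is lost. *)
Lemma laplace_integral_step (e0 e1 : bool) n (p : {poly R}) (c : R) :
  0 < c -> (forall t, 0 <= t <= 1 -> c <= p.[t]) ->
  (size p <= 2 * n + e0 + e1)%N -> p`_(2 * n + e0 + e1).-1 != 0 ->
  (1 < 2 * n + e0 + e1)%N ->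
  exists eL nL eU nU,
    [/\ (2 * nL + nat_of_bool eL + false = (2 * n + e0 + e1).-1)%N,
        (2 * nU + nat_of_bool eU + true = (2 * n + e0 + e1).-1)%N &
        (laplace_integral p eL false nL / nL`!%:R -
         laplace_integral p eU true nU / nU`!%:R) / p`_(2 * n + e0 + e1).-1 =
        laplace_integral p e0 e1 n / n`!%:R].
Proof.
move=> c0 pc sp l0 D1.
have nf k : k`!%:R != 0 :> R by rewrite pnatr_eq0 -lt0n fact_gt0.
have Rec := laplace_recursion p c c0 pc e0 e1 n sp.
set l := p`_ _ in l0 Rec *.
suff [eL [nL [eU [nU [EL EU E]]]]] : exists eL nL eU nU,
    [/\ (2 * nL + nat_of_bool eL + false = (2 * n + e0 + e1).-1)%N,
        (2 * nU + nat_of_bool eU + true = (2 * n + e0 + e1).-1)%N &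
        laplace_integral p eL false nL / nL`!%:R -
         laplace_integral p eU true nU / nU`!%:R =
        l * laplace_integral p e0 e1 n / n`!%:R].
  exists eL, nL, eU, nU; split => //; rewrite E.
  by field; rewrite l0 nf.
rewrite Rec {Rec l l0 sp}; case: e0 D1; case: e1 => /= D1.
- exists true, n, false, n; split; [lia|lia|].
  by rewrite mulr1n !mulr0n subr0 mul0rn addr0 expr1; ring.
- case: n D1 => [|n] D1; first by lia.
  exists false, n.+1, true, n; split; [lia|lia|].
  rewrite mulr1n !mulr0n mulr1n addr0 expr0 mul1r sub0r factS natrM/=.
  have a0 : n.+1%:R != 0 :> R by rewrite pnatr_eq0.
  have M (x : R) : x *+ n.+1 = x * n.+1%:R by rewrite mulr_natr.
  rewrite [X in _ = (_ + X) / _]M; move: (n.+1%:R) a0 {M} => a a0.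
  by field; rewrite ?nf ?a0.
- case: n D1 => [|n] D1; first by lia.
  exists false, n.+1, true, n; split; [lia|lia|].
  rewrite mulr1n !mulr0n mulr1n add0r subr0 expr1 factS natrM/=.
  have a0 : n.+1%:R != 0 :> R by rewrite pnatr_eq0.
  have M (x : R) : x *+ n.+1 = x * n.+1%:R by rewrite mulr_natr.
  rewrite [X in _ = (_ + X) / _]M; move: (n.+1%:R) a0 {M} => a a0.
  by field; rewrite ?nf ?a0.
- case: n D1 => [|n] D1; first by lia.
  exists true, n, false, n; split; [lia|lia|].
  rewrite !mulr0n !mulr1n addr0 add0r expr0 mul1r factS natrM/=.
  have a0 : n.+1%:R != 0 :> R by rewrite pnatr_eq0.
  have M (x : R) : x *+ n.+1 = x * n.+1%:R by rewrite mulr_natr.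
  rewrite [X in _ = X / _]M; move: (n.+1%:R) a0 {M} => a a0.
  by field; rewrite ?nf ?a0.
Qed.

(** The induction runs on the Laplace identity, which is converted into [cone_uniform] at each stage
    because the step transports integrals over the lower cone to nodes. *)
Theorem cone_uniformP D : (0 < D)%N -> cone_uniform (R := R) D.
Proof.
case: D => // D _; apply: cone_uniform_of_laplace => //.
elim: D => [|D IH]; first exact: cone_laplace_uniform1.
have HU : cone_uniform (R := R) D.+1 by exact: cone_uniform_of_laplace.
move=> e0 e1 n p c c0 pc sp p0 DE.
have sp' : (size p <= 2 * n + e0 + e1)%N by rewrite DE.
have l0 : p`_(2 * n + e0 + e1).-1 != 0 by rewrite DE gt_eqF.
have D1 : (1 < 2 * n + e0 + e1)%N by rewrite DE.
have [eL [nL [eU [nU [EL EU E]]]]] := laplace_integral_step e0 e1 n p c c0 pc sp' l0 D1.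
rewrite DE /= in EL EU E.
rewrite (cone_laplace_step D.+1 p c c0 pc sp p0 eL eU nL nU HU EL EU) E -EFinM.
by congr EFin; rewrite mulrC divfK// pnatr_eq0 -lt0n fact_gt0.
Qed.

End cone_induction.

(** * Total mass and normalized weights as coordinates *)

Section polar.
Context {R : realType}.
Local Notation leb := (@lebesgue_measure R).

Definition tuple_scale n (s : R) (t : n.-tuple R) : n.-tuple R :=
  [tuple s * tnth t i | i < n].

Lemma measurable_scale n s : measurable_fun setT (tuple_scale n s).
Proof.
by apply: measurable_mktuple => i; apply: measurable_funM => //; exact: measurable_tnth.
Qed.

Lemma tuple_scale_cons n s t (y : n.-tuple R) :
  tuple_scale n.+1 s [tuple of t :: y] = [tuple of (s * t) :: tuple_scale n s y].
Proof.
apply: eq_from_tnth => i; rewrite tnth_mktuple; case: (unliftP ord0 i) => [j|] ->.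
  by rewrite !tnthS tnth_mktuple.
by [].
Qed.

Lemma ge0_integral_scale n s (g : n.-tuple R -> \bar R) : 0 < s ->
  measurable_fun setT g -> (forall t, 0 <= g t)%E ->
  (\int[lebesgue_tuple R n]_t g t =
   (s ^+ n)%:E * \int[lebesgue_tuple R n]_t g (tuple_scale n s t))%E.
Proof.
move=> s0; elim: n g => [|n IH] g mg g0.
  rewrite expr0 mul1e; apply: eq_integral => t _; congr g.
  by apply: eq_from_tnth => -[].
have mc t : measurable_fun setT (fun y : n.-tuple R => g [tuple of t :: y]).
  by apply: (measurableT_comp mg); apply: (@measurable_cons _ _ _ _ (fun=> t) n id) => //.
have mgs : measurable_fun setT (fun y => g (tuple_scale n.+1 s y)).
  by apply: (measurableT_comp mg); exact: measurable_scale.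
rewrite ge0_integral_lebesgue_cons// ge0_integral_lebesgue_cons//.
pose G t := (\int[lebesgue_tuple R n]_y g [tuple of t :: y])%E.
have mG : measurable_fun setT (G : measurableTypeR R -> \bar R).
  apply: (measurable_fun_fubini_tonelli_F (fun u : measurableTypeR R * n.-tuple R => g [tuple of u.1 :: u.2])) => //.
  by apply: (measurableT_comp mg); exact: measurable_tuple_cons.
rewrite (ge0_integral_affine s 0 G s0 mG); last by move=> t; exact: integral_ge0.
rewrite exprS EFinM -muleA; congr (_ * _)%E.
rewrite -ge0_integralZl_EFin; last 4 first.
- exact: measurableT.
- by move=> t _; exact: integral_ge0.
- apply: (measurable_fun_fubini_tonelli_F (fun u : measurableTypeR R * n.-tuple R =>
    g (tuple_scale n.+1 s [tuple of u.1 :: u.2]))) => //.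
  by apply: (measurableT_comp mgs); exact: measurable_tuple_cons.
- by rewrite exprn_ge0// ltW.
apply: eq_integral => t _; rewrite /G addr0 (IH (fun y => g [tuple of s * t :: y])%R)//.
by congr (_ * _)%E; apply: eq_integral => y _; rewrite tuple_scale_cons.
Qed.

Lemma sum_complete_simplex n (y : n.-tuple R) :
  \sum_(i < n.+1) tnth (@complete_simplex R n.+1 y) i = 1.
Proof.
rewrite big_ord_recr/= tnth_mktuple nth_default ?size_tuple//= addrC.
rewrite big_tuple -[RHS](subrK (\sum_(i < n) tnth y i)); congr (_ + _).
apply: eq_bigr => i _; rewrite tnth_mktuple (tnth_nth (1 - \sum_(z <- y) z)).
by rewrite big_tuple.
Qed.

Lemma insert_complete_simplex n s (y : n.-tuple R) :
  @tuple_insert R n.+1 ord_max (s - \sum_(i < n) s * tnth y i) (tuple_scale n s y) =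
  tuple_scale n.+1 s (@complete_simplex R n.+1 y).
Proof.
apply: eq_from_tnth => i; rewrite [RHS]tnth_mktuple.
case: (unliftP ord_max i) => [j|] ->.
  rewrite (@tnth_insert_lift _ n.+1) tnth_mktuple; congr (_ * _).
  by rewrite [RHS]tnth_mktuple lift_max (tnth_nth (1 - \sum_(z <- y) z)).
rewrite tnth_insert -mulr_sumr -[X in X - _]mulr1 -mulrBr; congr (_ * _).
by rewrite [RHS]tnth_mktuple nth_default ?size_tuple//= big_tuple.
Qed.

(** A shear replaces the last coordinate by the sum s, and a dilation by s normalizes the others;
    the Jacobians are 1 and s^n. *)
Lemma ge0_integral_polar n (f : n.+1.-tuple R -> \bar R) :
  measurable_fun setT f -> (forall w, 0 <= f w)%E ->
  (forall w, \sum_(i < n.+1) tnth w i <= 0 -> f w = 0%E) ->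
  (\int[lebesgue_tuple R n.+1]_w f w =
   \int[leb]_s (((0 < s)%R%:R * s ^+ n)%:E *
     \int[lebesgue_tuple R n]_y f (tuple_scale n.+1 s (@complete_simplex R n.+1 y))))%E.
Proof.
move=> mf f0 fneg.
have mS : measurable_fun setT (fun u : n.-tuple R * measurableTypeR R =>
    f (@tuple_insert R n.+1 ord_max (u.2 - \sum_(i < n) tnth u.1 i) u.1)).
  have mi : measurable_fun setT (fun u : n.-tuple R * measurableTypeR R =>
      (u.1, u.2 - \sum_(i < n) tnth u.1 i) : n.-tuple R * measurableTypeR R).
    apply/measurable_fun_pairP; split => /=; first exact: measurable_fst.
    apply: measurable_funB; first exact: measurable_snd.
    apply: measurable_sum => i.
    exact: (measurableT_comp (@measurable_tnth _ R n i) measurable_fst).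
  exact: (measurableT_comp (measurable_section_insert n ord_max f mf) mi).
rewrite (ge0_integral_lebesgue_insert n ord_max)//.
transitivity (\int[lebesgue_tuple R n]_y \int[leb]_s
    f (@tuple_insert R n.+1 ord_max (s - \sum_(i < n) tnth y i)%R y))%E.
  apply: eq_integral => y _.
  rewrite (ge0_integral_affine 1 (- \sum_(i < n) tnth y i) (fun t => f (@tuple_insert R n.+1 ord_max t y)))//.
    by rewrite mul1e; apply: eq_integral => s _; rewrite mul1r.
  exact: (measurableT_comp (measurable_section_insert n ord_max f mf) (pair1_measurable y)).
rewrite (fubini_tonelli (fun u : n.-tuple R * measurableTypeR R =>
    f (@tuple_insert R n.+1 ord_max (u.2 - \sum_(i < n) tnth u.1 i) u.1)))//.
apply: eq_integral => s _ /=.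
have [s0|s0] := ltP 0 s; last first.
  rewrite mul0r mul0e; apply: integral0_eq => y _; apply: fneg.
  rewrite (big_ord_lift n.+1 ord_max) tnth_insert.
  under [X in _ + X <= _]eq_bigr do rewrite (@tnth_insert_lift _ n.+1).
  by rewrite subrK.
rewrite mul1r (ge0_integral_scale n s)//.
- by congr (_ * _)%E; apply: eq_integral => y _; rewrite -insert_complete_simplex;
    under [in LHS]eq_bigr do rewrite tnth_mktuple.
- exact: (measurableT_comp mS (pair2_measurable s)).
Qed.

End polar.

(** * From the cone to its slice *)

Section moments_law.
Context {R : realType}.
Local Notation leb := (@lebesgue_measure R).

(** A cut-off in the total mass: it gives both sides the finite radial integral 1 / (d + 1), which
    cancels. *)
Definition open_unit (s : R) : R := ((0 < s) && (s < 1))%R%:R.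

Lemma measurable_open_unit : measurable_fun setT open_unit.
Proof.
rewrite (_ : open_unit = \1_(`]0, 1[%classic : set R)).
  by apply: measurable_indic; exact: measurable_itv.
apply/funext => w; rewrite indicE; congr ((nat_of_bool _)%:R).
by apply/idP/idP; rewrite inE /= in_itv.
Qed.

Lemma integral_open_unit_expr d :
  (\int[leb]_s (open_unit s * s ^+ d)%:E = (d.+1%:R^-1)%:E)%E.
Proof.
(* The integral formula for the derivative of r / p is reused with p = 1. *)
pose r : {poly R} := d.+1%:R^-1 *: 'X^(d.+1).
have r' t : (r^`().[t] * 1%:P.[t] - r.[t] * (1%:P : {poly R})^`().[t]) / 1%:P.[t] ^+ 2 = t ^+ d.
  rewrite derivC horner0 !hornerC mulr0 subr0 mulr1 expr1n divr1.
  by rewrite /r derivZ derivXn hornerZ hornerMn hornerXn mulrnAr -mulrnAl -[d.+1%:R^-1 *+ _]mulr_natr mulVf ?mul1r// pnatr_eq0.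
have p1 (t : R) : 0 <= t <= 1 -> 1 <= (1%:P : {poly R}).[t] by rewrite hornerC.
have H := @integral_horner_div_deriv R 1%:P 1 ltr01 p1 r.
have -> : (d.+1%:R^-1)%:E = (r.[1] / 1%:P.[1] - r.[0] / 1%:P.[0])%:E.
  by rewrite !hornerC !divr1 /r !hornerZ !hornerXn expr1n expr0n mulr0 subr0 mulr1.
rewrite -H.
transitivity (\int[leb]_(s in `]0%R, 1%R[) (s ^+ d)%:E)%E.
  rewrite [RHS]integral_mkcond; apply: eq_integral => s _; rewrite patchE /open_unit.
  have -> : (s \in `]0%R, 1%R[%classic) = (0 < s < 1).
    by apply/idP/idP; rewrite inE /= in_itv.
  by case: ifPn => _; rewrite ?mul0r// mul1r.
rewrite -(@integral_itv_bndoo _ 0 1 _ true false).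
  by apply: eq_integral => s _; rewrite r'.
by apply/measurable_EFinP/measurable_funTS; exact: measurable_funX.
Qed.

Definition simplex_weight e0 n m (y : m.-tuple R) : R :=
  \prod_(k < m) pos_power (node_double e0 n k) (tnth y k).

Definition moment_map d e0 e1 n m (u : n.-tuple R * m.-tuple R) : d.-tuple R :=
  [tuple power_sum m (cone_nodes e0 e1 u.1) u.2 j.+1 | j < d].

Definition dual_moment_space d : set (d.-tuple R) :=
  [set r : d.-tuple R | @dual_cone R d.+1 [tuple of (1 : R) :: r]].

Lemma measurable_moment_map d e0 e1 n m : measurable_fun setT (moment_map d e0 e1 n m).
Proof.
apply: measurable_mktuple => j; apply: measurable_sum => k.
apply: measurable_funM.
  exact: (measurableT_comp (@measurable_tnth _ R m k)).
apply: measurable_funX; exact: (measurableT_comp (@measurable_cone_nodes R e0 e1 n k)).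
Qed.

Lemma measurable_simplex_weight e0 n m : measurable_fun setT (simplex_weight e0 n m).
Proof.
apply: measurable_prod => k _.
exact: (measurableT_comp (measurable_pos_power _) (@measurable_tnth _ R m k)).
Qed.

Lemma simplex_weight_ge0 e0 n m y : 0 <= simplex_weight e0 n m y.
Proof. by apply: prodr_ge0 => k _; exact: pos_power_ge0. Qed.

Lemma measurable_dual_moment_space d : measurable (dual_moment_space d).
Proof.
rewrite -[X in measurable X]setTI.
have mc : measurable_fun setT (fun y : d.-tuple R => [tuple of (1 : R) :: y]).
  by apply: (@measurable_cons _ _ _ _ (fun=> 1 : R) d id).
by apply: mc => //; exact: measurable_dual_cone.
Qed.

Lemma dual_coneZ D s (c : D.-tuple R) : 0 < s ->
  dual_cone D (tuple_scale D s c) <-> dual_cone D c.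
Proof.
move=> s0.
have E q : pairing D q (tuple_scale D s c) = s * pairing D q c.
  by rewrite /pairing mulr_sumr; apply: eq_bigr => i _; rewrite tnth_mktuple mulrCA.
split=> H q sq nq; first by have := H q sq nq; rewrite E pmulr_rge0.
by rewrite E pmulr_rge0//; exact: H.
Qed.

Lemma sum_node_double (e0 e1 : bool) n m : m = (n + e0 + e1)%N ->
  (\sum_(k < m) node_double e0 n k = n)%N.
Proof.
move=> ->; rewrite -(big_mkord xpredT (fun k => nat_of_bool (node_double e0 n k))).
rewrite (_ : (n + e0 + e1)%N = (e0 + (n + e1))%N); last by lia.
rewrite (@big_cat_nat _ _ _ e0)//= ?leq_addr//.
rewrite (@big_cat_nat _ _ _ (e0 + n) e0)//= ?leq_add2l ?leq_addr//.
rewrite big_nat big1 ?add0n; last first.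
  by move=> k /andP[_ ke]; rewrite /node_double leqNgt ke.
rewrite [X in (_ + X)%N]big_nat [X in (_ + X)%N]big1 ?addn0; last first.
  by move=> k /andP[ke _]; rewrite /node_double [(k < _)%N]ltnNge ke andbF.
rewrite big_nat (eq_bigr (fun=> 1%N)); last first.
  by move=> k /andP[ke kn]; rewrite /node_double ke kn.
by rewrite -big_nat sum_nat_const_nat muln1 addKn.
Qed.

Lemma pos_power_scale a (s t : R) : 0 < s -> pos_power a (s * t) = s ^+ a * pos_power a t.
Proof.
by move=> s0; rewrite /pos_power pmulr_rgt0// exprMn; case: (0 < t); rewrite ?mul1r// !mul0r mulr0.
Qed.

Definition normalized d (c : d.+1.-tuple R) : d.-tuple R :=
  [tuple tnth c (lift ord0 j) / thead c | j < d].

Lemma measurable_normalized d : measurable_fun setT (@normalized d).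
Proof.
apply: measurable_mktuple => j; apply: measurable_funM; first exact: measurable_tnth.
apply: measurable_funV; exact: measurable_tnth.
Qed.

Section law.
Variables (e0 e1 : bool) (n m d : nat) (A : set (d.-tuple R)).
Hypotheses (mE : m.+1 = (n + e0 + e1)%N) (dE : d.+1 = (2 * n + e0 + e1)%N).
Hypothesis mA : measurable A.

(** The test function for [cone_uniformP]: apart from the cut-off in c_0 it depends only on the ray
    through c. *)
Let h (c : d.+1.-tuple R) : \bar R := (open_unit (thead c) * \1_A (normalized d c))%:E.

Let mh : measurable_fun setT h.
Proof.
apply/measurable_EFinP/measurable_funM.
  exact: (measurableT_comp measurable_open_unit (@measurable_tnth _ R d.+1 ord0)).
exact: (measurableT_comp (measurable_indic mA) (measurable_normalized d)).
Qed.

Let h0 c : (0 <= h c)%E.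
Proof. by rewrite lee_fin mulr_ge0. Qed.

Let inner (x : n.-tuple R) : \bar R := (\int[lebesgue_tuple R m]_y
  (simplex_weight e0 n m.+1 (@complete_simplex R m.+1 y) *
   \1_A (moment_map d e0 e1 n m.+1 (x, @complete_simplex R m.+1 y)))%:E)%E.

Let inner_ge0 x : (0 <= inner x)%E.
Proof.
by apply: integral_ge0 => y _; rewrite lee_fin mulr_ge0// simplex_weight_ge0.
Qed.

Let minner : measurable_fun setT inner.
Proof.
pose f (u : n.-tuple R * m.-tuple R) : \bar R :=
  (simplex_weight e0 n m.+1 (@complete_simplex R m.+1 u.2) *
   \1_A (moment_map d e0 e1 n m.+1 (u.1, @complete_simplex R m.+1 u.2)))%:E.
apply: (measurable_fun_fubini_tonelli_F f); last first.
  by move=> u; rewrite lee_fin mulr_ge0// simplex_weight_ge0.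
have mcs : measurable_fun setT (fun u : n.-tuple R * m.-tuple R => @complete_simplex R m.+1 u.2).
  exact: (measurableT_comp (@measurable_complete_simplex R m.+1) measurable_snd).
apply/measurable_EFinP/measurable_funM.
  exact: (measurableT_comp (measurable_simplex_weight e0 n m.+1) mcs).
have mp : measurable_fun setT (fun u : n.-tuple R * m.-tuple R =>
    (u.1, @complete_simplex R m.+1 u.2) : n.-tuple R * m.+1.-tuple R).
  by apply/measurable_fun_pairP; split => //=; exact: measurable_fst.
exact: (measurableT_comp (measurable_indic mA) (measurableT_comp (measurable_moment_map d e0 e1 n m.+1) mp)).
Qed.

Let cone_mapE x s y : 0 < s ->
  cone_map d.+1 e0 e1 n m.+1 (x, tuple_scale m.+1 s (@complete_simplex R m.+1 y)) =
  [tuple of s :: tuple_scale d s (moment_map d e0 e1 n m.+1 (x, @complete_simplex R m.+1 y))].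
Proof.
move=> s0; apply: eq_from_tnth => i; rewrite tnth_mktuple /power_sum.
case: (unliftP ord0 i) => [j|] ->.
  rewrite tnthS !tnth_mktuple /power_sum mulr_sumr /=; apply: eq_bigr => k _.
  by rewrite tnth_mktuple mulrA.
rewrite -[RHS]mulr1 -(sum_complete_simplex m y) mulr_sumr; apply: eq_bigr => k _ /=.
by rewrite tnth_mktuple expr0 mulr1.
Qed.

Let normalized_cons s (r : d.-tuple R) : 0 < s ->
  normalized d [tuple of s :: tuple_scale d s r] = r.
Proof.
move=> s0; apply: eq_from_tnth => j; rewrite tnth_mktuple tnthS tnth_mktuple theadE.
by rewrite mulrAC mulfV ?gt_eqF// mul1r.
Qed.

Let weight_side :
  (\int[lebesgue_tuple R n \x lebesgue_tuple R m.+1]_u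
     ((cone_weight e0 e1 n m.+1 u)%:E * h (cone_map d.+1 e0 e1 n m.+1 u)) =
   (d.+1%:R^-1)%:E * \int[lebesgue_tuple R n]_x
     ((\1_(@unit_cube R n) x * node_weight e0 e1 n x)%:E * inner x))%E.
Proof.
have mhF : measurable_fun setT (fun u => h (cone_map d.+1 e0 e1 n m.+1 u)).
  exact: (measurableT_comp mh (measurable_cone_map _ _ _ _ _)).
have mnw : measurable_fun setT (fun x => \1_(@unit_cube R n) x * node_weight e0 e1 n x).
  apply: measurable_funM; first exact: measurable_indic (@measurable_unit_cube R n).
  exact: (cube_bounded_node_weight e0 e1 n).1.
have nw0 x : 0 <= \1_(@unit_cube R n) x * node_weight e0 e1 n x.
  by rewrite mulr_ge0// node_weight_ge0.
rewrite fubini_tonelli1/=; last 2 first.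
- apply: emeasurable_funM => //.
  by apply/measurable_EFinP; exact: measurable_cone_weight.
- by move=> u; rewrite mule_ge0// lee_fin cone_weight_ge0.
rewrite -ge0_integralZl_EFin; last 4 first.
- exact: measurableT.
- by move=> x _; rewrite mule_ge0// lee_fin.
- by apply: emeasurable_funM => //; exact/measurable_EFinP.
- by rewrite invr_ge0.
apply: eq_integral => x _; rewrite /fubini_F muleCA.
have mfx : measurable_fun setT (fun w : m.+1.-tuple R =>
    (simplex_weight e0 n m.+1 w)%:E * h (cone_map d.+1 e0 e1 n m.+1 (x, w)))%E.
  apply: emeasurable_funM; first by apply/measurable_EFinP; exact: measurable_simplex_weight.
  exact: (measurableT_comp mhF (pair1_measurable x)).
have fx0 w : (0 <= (simplex_weight e0 n m.+1 w)%:E * h (cone_map d.+1 e0 e1 n m.+1 (x, w)))%E.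
  by rewrite mule_ge0// lee_fin simplex_weight_ge0.
transitivity ((\1_(@unit_cube R n) x * node_weight e0 e1 n x)%:E *
  \int[lebesgue_tuple R m.+1]_w ((simplex_weight e0 n m.+1 w)%:E *
     h (cone_map d.+1 e0 e1 n m.+1 (x, w))))%E.
  rewrite -ge0_integralZl_EFin//.
  by apply: eq_integral => w _; rewrite muleA -EFinM.
congr (_ * _)%E; rewrite ge0_integral_polar//; last first.
  move=> w w0; rewrite /h (_ : open_unit _ = 0) ?mul0r ?mule0//.
  rewrite /open_unit (_ : thead _ = \sum_(i < m.+1) tnth w i); first by rewrite ltNge w0.
  rewrite /thead tnth_mktuple; apply: eq_bigr => k _.
  by rewrite expr0 mulr1.
transitivity (\int[leb]_s ((open_unit s * s ^+ d)%:E * inner x))%E.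
  apply: eq_integral => s _.
  have [s0|s0] := ltP 0 s; last by rewrite /open_unit ltNge s0 /= !mul0r !mul0e.
  rewrite mul1r.
  (* Power count: s^m is the Jacobian and s^n comes from the n double weights; m + n = d is also the
     exponent from dilating the slice of the cone. *)
  rewrite (_ : (open_unit s * s ^+ d)%:E = ((s ^+ m)%:E * (s ^+ n * open_unit s)%:E)%E); last first.
    rewrite -EFinM mulrA -exprD mulrC; congr (_ ^+ _ * _)%:E.
    by apply: succn_inj; rewrite dE; lia.
  rewrite -muleA; congr (_ * _)%E.
  rewrite /inner -ge0_integralZl_EFin; last 4 first.
  - exact: measurableT.
  - by move=> y _; rewrite lee_fin mulr_ge0// simplex_weight_ge0.
  - have mcs := @measurable_complete_simplex R m.+1.
    apply/measurable_EFinP/measurable_funM.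
      exact: (measurableT_comp (measurable_simplex_weight e0 n m.+1) mcs).
    exact: (measurableT_comp (measurable_indic mA) (measurableT_comp (measurable_moment_map d e0 e1 n m.+1)
      (measurableT_comp (pair1_measurable x) mcs))).
  - by rewrite mulr_ge0// exprn_ge0// ltW.
  apply: eq_integral => y _; rewrite cone_mapE// /h normalized_cons// theadE.
  rewrite -!EFinM; congr EFin.
  have -> : simplex_weight e0 n m.+1 (tuple_scale m.+1 s (@complete_simplex R m.+1 y)) =
      s ^+ n * simplex_weight e0 n m.+1 (@complete_simplex R m.+1 y).
    rewrite /simplex_weight -{2}(sum_node_double e0 e1 n m.+1 mE) -prodrXr -big_split/=.
    by apply: eq_bigr => k _; rewrite tnth_mktuple pos_power_scale.
  by ring.
rewrite ge0_integralZr//; last 2 first.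
- apply/measurable_EFinP/measurable_funM; first exact: measurable_open_unit.
  exact: measurable_funX.
- move=> s _; rewrite lee_fin /open_unit; case: ltP => [s0|]; rewrite ?mul0r//=.
  by rewrite mulr_ge0// exprn_ge0// ltW.
by rewrite integral_open_unit_expr.
Qed.

Let cone_side :
  (\int[lebesgue_tuple R d.+1]_c ((n`!%:R * \1_(@dual_cone R d.+1) c)%:E * h c) =
   (d.+1%:R^-1)%:E * ((n`!%:R)%:E * lebesgue_tuple R d (dual_moment_space d `&` A)))%E.
Proof.
have mk : measurable_fun setT (fun c => (n`!%:R * \1_(@dual_cone R d.+1) c)%:E * h c)%E.
  apply: emeasurable_funM => //; apply/measurable_EFinP/measurable_funM => //.
  exact: measurable_indic (@measurable_dual_cone R d.+1).
have k0 c : (0 <= (n`!%:R * \1_(@dual_cone R d.+1) c)%:E * h c)%E.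
  by rewrite mule_ge0// lee_fin mulr_ge0.
rewrite ge0_integral_lebesgue_cons//.
transitivity (\int[leb]_s ((open_unit s * s ^+ d)%:E *
    ((n`!%:R)%:E * lebesgue_tuple R d (dual_moment_space d `&` A))))%E.
  apply: eq_integral => s _.
  have [s0|s0] := ltP 0 s; last first.
    rewrite /open_unit ltNge s0 /= mul0r mul0e; apply: integral0_eq => r _.
    by rewrite /h /open_unit theadE ltNge s0 mul0r mule0.
  rewrite (ge0_integral_scale d s)//; last first.
    apply: (measurableT_comp mk).
    by apply: (@measurable_cons _ _ _ _ (fun=> s) d id).
  rewrite [open_unit s * _]mulrC EFinM -muleA; congr (_ * _)%E.
  have mI := measurableI _ _ (measurable_dual_moment_space d) mA.
  rewrite -(setIT (_ `&` A)) -integral_indic//.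
  rewrite muleA -EFinM -ge0_integralZl_EFin; last 4 first.
  - exact: measurableT.
  - by move=> r _; rewrite lee_fin.
  - by apply/measurable_EFinP; exact: measurable_indic.
  - by rewrite mulr_ge0.
  apply: eq_integral => r _; rewrite /h normalized_cons// theadE -!EFinM; congr EFin.
  have E : [tuple of s :: tuple_scale d s r] = tuple_scale d.+1 s [tuple of (1 : R) :: r].
    by rewrite tuple_scale_cons mulr1.
  have -> : \1_(@dual_cone R d.+1) [tuple of s :: tuple_scale d s r] = \1_(dual_moment_space d) r :> R.
    rewrite !indicE; congr ((nat_of_bool _)%:R).
    apply/idP/idP; rewrite !inE E /dual_moment_space/=.
      by move=> /(dual_coneZ _ _ _ s0).
    by move=> H; apply/(dual_coneZ _ _ _ s0).
  by rewrite indicI /=; ring.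
rewrite ge0_integralZr//; last 3 first.
- apply/measurable_EFinP/measurable_funM; first exact: measurable_open_unit.
  exact: measurable_funX.
- move=> s _; rewrite lee_fin /open_unit; case: ltP => [s0|]; rewrite ?mul0r//=.
  by rewrite mulr_ge0// exprn_ge0// ltW.
- by rewrite mule_ge0 ?lee_fin.
by rewrite integral_open_unit_expr.
Qed.

(** [cone_uniformP] for the test function [h], with the common radial factor removed. The left side
    is the unnormalized probability of A under the Jacobi and Dirichlet laws. *)
Lemma moments_lawE :
  (\int[lebesgue_tuple R n]_x ((\1_(@unit_cube R n) x * node_weight e0 e1 n x)%:E *
     \int[lebesgue_tuple R m]_y
       (simplex_weight e0 n m.+1 (@complete_simplex R m.+1 y) *
        \1_A (moment_map d e0 e1 n m.+1 (x, @complete_simplex R m.+1 y)))%:E) =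
   (n`!%:R)%:E * lebesgue_tuple R d (dual_moment_space d `&` A))%E.
Proof.
have := @cone_uniformP R d.+1 isT e0 e1 n m.+1 (esym dE) mE h mh h0.
rewrite weight_side cone_side => /(congr1 (fun z => (d.+1%:R : R)%:E * z)%E).
by rewrite !muleA -!EFinM mulfV ?pnatr_eq0// mul1e EFinM mul1e.
Qed.

End law.
End moments_law.

(** * Moments of measures carried by nodes *)

Section node_moments.
Context {R : realType}.
Variables (d : nat) (e0 e1 : bool) (n m : nat).

(** Weights may vanish here, unlike in the open simplex, so that the parameters form a compact
    set. *)
Definition node_moments : set (d.-tuple R) :=
  [set c | exists (x : n.-tuple R) (w : m.-tuple R), [/\ @unit_cube R n x,
     forall k, 0 <= tnth w k, \sum_(k < m) tnth w k = 1 &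
     c = moment_map d e0 e1 n m (x, w)]].

(* Closedness by compactness of the parameters: at a limit point c the
   continuous function |sum w - 1| + sum |moments - c| attains its minimum 0. *)
Lemma measurable_node_moments : measurable node_moments.
Proof.
apply: measurable_closed_tuple => c Hc.
pose tx (v : 'rV[R]_(n + m)) : n.-tuple R := [tuple v ord0 (lshift m i) | i < n].
pose tw (v : 'rV[R]_(n + m)) : m.-tuple R := [tuple v ord0 (rshift n i) | i < m].
pose K : set 'rV[R]_(n + m) := [set v | forall i, `[0, 1]%classic (v ord0 i)].
pose f (v : 'rV[R]_(n + m)) : R := `|\sum_(k < m) tnth (tw v) k - 1| +
  \sum_(j < d) `|tnth (moment_map d e0 e1 n m (tx v, tw v)) j - tnth c j|.
have cK : compact K.
  have := @rV_compact R (n + m) (fun=> `[0%R, 1%R]%classic); apply => i.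
  exact: segment_compact.
have cf : continuous f.
  have cc i : continuous (fun v : 'rV[R]_(n + m) => v ord0 i) by move=> v; exact: coord_continuous.
  have ceq (g h : 'rV[R]_(n + m) -> R) : g =1 h -> continuous h -> continuous g.
    by move=> /funext ->.
  have cn k : continuous (fun v => (cone_nodes e0 e1 (tx v))`_k).
    apply: (ceq _ _ (fun v => nth_cone_nodes e0 e1 n (tx v) k)).
    case: ltnP => [|ek]; first by move=> _; exact: cst_continuous.
    case: ltnP => [kn|_]; last by case: ifP => _; exact: cst_continuous.
    have kn' : (k - e0 < n)%N by rewrite ltn_subLR.
    apply: (ceq _ _ _ (cc (lshift m (Ordinal kn')))) => v.
    by rewrite -(tnth_nth 0 (tx v) (Ordinal kn')) tnth_mktuple.
  have cs I (r : seq I) (g : I -> 'rV[R]_(n + m) -> R) :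
      (forall i, continuous (g i)) -> continuous (fun v => \sum_(i <- r) g i v).
    move=> cg; elim: r => [|i r IH].
      by apply: (ceq _ (fun=> 0)) => [v|]; [rewrite big_nil|exact: cst_continuous].
    apply: (ceq _ (fun v => g i v + \sum_(j <- r) g j v)) => v; first by rewrite big_cons.
    exact: (cvgD (cg i v) (IH v)).
  have cabs (g : 'rV[R]_(n + m) -> R) a : continuous g -> continuous (fun v => `|g v - a|).
    by move=> cg v; exact: (cvg_norm (cvgB (cg v) (cvg_cst a))).
  have cw k : continuous (fun v => tnth (tw v) k).
    by apply: (ceq _ _ _ (cc (rshift n k))) => u; rewrite tnth_mktuple.
  have c1 : continuous (fun v => `|\sum_(k < m) tnth (tw v) k - 1|).
    by apply: (cabs); exact: (cs _ _ (fun k v => tnth (tw v) k)).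
  have cm k j : continuous (fun v => tnth (tw v) k * (cone_nodes e0 e1 (tx v))`_k ^+ j).
    have cX : continuous (fun v => (cone_nodes e0 e1 (tx v))`_k ^+ j).
      elim: j => [|j IH].
        by apply: (ceq _ (fun=> 1)) => [v|]; [rewrite expr0|exact: cst_continuous].
      apply: (ceq _ _ (fun v => exprS _ _)) => v; exact: (cvgM (cn k v) (IH v)).
    by move=> v; exact: (cvgM (cw k v) (cX v)).
  have c2 : continuous (fun v =>
      \sum_(j < d) `|tnth (moment_map d e0 e1 n m (tx v, tw v)) j - tnth c j|).
    apply: (cs _ _ (fun j v => `|tnth (moment_map d e0 e1 n m (tx v, tw v)) j - tnth c j|)) => j.
    apply: cabs; apply: (ceq _ _ _ (cs _ _ (fun k => _) (cm ^~ j.+1))) => u.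
    by rewrite tnth_mktuple.
  by move=> v; exact: (cvgD (c1 v) (c2 v)).
(* The factor [d.+1] in place of d keeps the bound strict also when d = 0. *)
have approx e : 0 < e -> exists2 v, K v & f v < d.+1%:R * e.
  move=> e0'; have [s [x [w [cx w0 w1 ->]]] sc] := Hc e e0'.
  pose v : 'rV[R]_(n + m) := \row_(i < n + m) match fintype.split i with inl a => tnth x a | inr b => tnth w b end.
  have xE : tx v = x.
    by apply: eq_from_tnth => i; rewrite tnth_mktuple mxE (unsplitK (inl i)).
  have wE : tw v = w.
    by apply: eq_from_tnth => i; rewrite tnth_mktuple mxE (unsplitK (inr i)).
  exists v.
    move=> i; rewrite /= in_itv/= mxE; case: fintype.split => k; first exact: cx.
    by rewrite w0/= -w1 (bigD1 k)//= lerDl sumr_ge0.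
  rewrite /f wE xE w1 subrr normr0 add0r.
  apply: (@le_lt_trans _ _ (\sum_(j < d) e)).
    by apply: ler_sum => j _; exact/ltW/sc.
  rewrite sumr_const card_ord -[e *+ d]mulr_natl ltr_pM2r//.
  by rewrite ltr_nat.
have [v1 Kv1 _] := approx 1 ltr01.
have [v] := compact_EVT_min (ex_intro _ v1 Kv1) cK (continuous_subspaceT cf).
rewrite inE => Kv vmin.
have f0 : f v <= 0.
  apply/ler_addgt0Pl => e e_gt0; rewrite addr0.
  have [|u Ku fu] := approx (e / d.+1%:R); first by rewrite divr_gt0.
  move: fu; rewrite mulrCA mulfV ?pnatr_eq0// mulr1 => /ltW; apply: le_trans.
  by apply: vmin; rewrite inE.
have sum0 : 0 <= \sum_(j < d) `|tnth (moment_map d e0 e1 n m (tx v, tw v)) j - tnth c j|.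
  by apply: sumr_ge0.
exists (tx v), (tw v); split.
- by move=> k; rewrite tnth_mktuple; have := Kv (lshift m k); rewrite /= in_itv.
- by move=> k; rewrite tnth_mktuple; have := Kv (rshift n k); rewrite /= in_itv/= => /andP[].
- apply/eqP; rewrite -subr_eq0 -normr_le0; apply: le_trans f0.
  by rewrite /f lerDl.
- apply: eq_from_tnth => j; apply/eqP; rewrite eq_sym -subr_eq0 -normr_le0.
  apply: le_trans f0; rewrite /f (bigD1 j)//= addrCA lerDl.
  by rewrite addr_ge0// sumr_ge0.
Qed.

End node_moments.

(** * The moment space between [node_moments] and the slice of the cone *)

Section moment_space_sandwich.
Context {R : realType}.
Local Notation Rm := (measurableTypeR R).

Lemma integrable_itv_expr (mu : probability Rm R) i :
  mu.-integrable `[0, 1]%classic (EFin \o (fun t : Rm => t ^+ i)).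
Proof.
apply: measurable_bounded_integrable.
- exact: measurable_itv.
- by rewrite (le_lt_trans (probability_le1 mu _)) ?ltry//; exact: measurable_itv.
- exact: measurable_funX.
- exists 1; split; first exact: num_real.
  move=> K K1 t; rewrite /= in_itv/= => /andP[t0 t1].
  by rewrite (le_trans _ (ltW K1))// ger0_norm ?exprn_ge0// exprn_ile1.
Qed.

(** The pairing of q with (1, m_1, ..., m_d) is the integral of q over [0, 1]. *)
Lemma moment_space_dual d : moment_space d `<=` @dual_moment_space R d.
Proof.
move=> c [mu mu1 <-] q sq nq.
pose g D (t : Rm) := \sum_(i < D) q`_i * t ^+ i.
have H D : mu.-integrable `[0, 1]%classic (EFin \o g D) /\
    \int[mu]_(t in `[0, 1]) g D t = \sum_(i < D) q`_i * moment mu i.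
  have gS k : g k.+1 = (fun t => g k t + q`_k * t ^+ k).
    by apply/funext => t; rewrite /g big_ord_recr.
  have m01 : measurable (`[0, 1]%classic : set Rm) by exact: measurable_itv.
  elim: D => [|D [iD IH]].
    have -> : g 0 = cst 0 by apply/funext => t; rewrite /g big_ord0.
    split; first exact: integrable0.
    by rewrite big_ord0 /Rintegral; rewrite integral0_eq.
  have iq : mu.-integrable `[0, 1]%classic (EFin \o (fun t : Rm => q`_D * t ^+ D)).
    have := integrableZl m01 q`_D (integrable_itv_expr mu D).
    by apply: eq_integrable.
  rewrite gS; split.
    by have := integrableD m01 iD iq; apply: eq_integrable.
  rewrite RintegralD// IH big_ord_recr/= RintegralZl//.
  exact: integrable_itv_expr.
have m0 : moment mu 0 = 1.
  rewrite /moment /Rintegral (eq_integral (fun=> 1%E)) => [|t _]; last by rewrite expr0.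
  by rewrite integral_cst ?mul1e; [exact: (congr1 fine mu1)|exact: measurable_itv].
have -> : pairing d.+1 q [tuple of 1 :: moments d mu] = \sum_(i < d.+1) q`_i * moment mu i.
  apply: eq_bigr => i _; congr (_ * _); case: (unliftP ord0 i) => [j|] ->.
    by rewrite tnthS tnth_mktuple.
  by rewrite m0.
rewrite -(H d.+1).2; apply: Rintegral_ge0 => t; rewrite /= in_itv/= => t01.
by rewrite /g -horner_coef_wide// nq.
Qed.

Section probability_of_measure.
Variables (mu : {measure set Rm -> \bar R}) (mu1 : mu setT = 1%E).

Definition probability_of (_ : mu setT = 1%E) : set Rm -> \bar R := mu.

HB.instance Definition _ := Measure.copy (probability_of mu1) mu.
HB.instance Definition _ := Measure_isProbability.Build _ _ _ (probability_of mu1) mu1.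

End probability_of_measure.

Lemma node_moments_space d (e0 e1 : bool) n m : m = (n + e0 + e1)%N ->
  @node_moments R d e0 e1 n m `<=` moment_space d.
Proof.
move=> mE c [x [w [cx w0 w1 ->]]].
have w0' k : 0 <= w`_k.
  have [km|km] := ltnP k m; last by rewrite nth_default ?size_tuple.
  by have := w0 (Ordinal km); rewrite (tnth_nth 0).
have sz : size (cone_nodes e0 e1 x) = m.
  by rewrite /cone_nodes !size_cat !size_nseq size_tuple mE; lia.
pose mu := discrete_measure (cone_nodes e0 e1 x) w.
have muE A : (forall t, 0 <= t <= 1 -> A t) -> mu A = 1%E.
  move=> A01; rewrite discrete_measureE// sz.
  rewrite (eq_bigr (fun k : 'I_m => (tnth w k)%:E)); last first.
    move=> k _; rewrite diracE mem_set ?mule1 ?(tnth_nth 0)//.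
    by apply: A01; exact: cone_nodes_itv.
  by rewrite sumEFin w1.
have muT : mu setT = 1%E by exact: muE.
exists (probability_of mu muT).
  by rewrite /= -[LHS]/(mu _) muE// => t; rewrite /= in_itv.
apply: eq_from_tnth => j; rewrite !tnth_mktuple.
rewrite -[LHS]/(moment mu j.+1) moment_discrete_measure//.
  by rewrite sz; apply: eq_bigr => k _; rewrite (tnth_nth 0).
by move=> k; exact: cone_nodes_itv.
Qed.

End moment_space_sandwich.

(** * The Jacobi and Dirichlet laws in terms of the weights above *)

Section jacobi_dirichlet.
Context {R : realType}.

Lemma sqdisc_vandermonde n (x : n.-tuple R) : sqdisc n x = vandermonde x ^+ 4.
Proof.
pose D (i j : 'I_n) := (tnth x i - tnth x j) ^+ 2.
have -> : sqdisc n x = (\prod_(i < n) \prod_(j < n | (i < j)%N) D i j) *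
    (\prod_(i < n) \prod_(j < n | (j < i)%N) D i j).
  rewrite -big_split/=; apply: eq_bigr => i _.
  rewrite (bigID (fun j : 'I_n => (i < j)%N))/=; congr (_ * _); apply: eq_bigl => j.
    by rewrite -(inj_eq val_inj)/=; case: (ltngtP i j).
  by rewrite -(inj_eq val_inj)/=; case: (ltngtP i j).
have -> : \prod_(i < n) \prod_(j < n | (j < i)%N) D i j =
    \prod_(i < n) \prod_(j < n | (i < j)%N) D i j.
  rewrite (exchange_big_dep xpredT)//=; apply: eq_bigr => i _; apply: eq_bigr => j _.
  by rewrite /D -sqrrN opprB.
rewrite /vandermonde -expr2 (exprM _ 2 2); congr (_ ^+ 2).
by rewrite -prodrXl; apply: eq_bigr => i _; rewrite -prodrXl.
Qed.

Lemma powR_1D (a k : R) n : 0 <= k -> a = 1 + n%:R -> k `^ (a - 1) = k ^+ n.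
Proof. by move=> k0 ->; rewrite addrC addKr powR_mulrn. Qed.

Section laws.
Variables (e0 e1 : bool) (n m : nat) (a b : R) (alpha : m.+1.-tuple R).
Hypotheses (aE : a = 1 + (2 * e1)%:R) (bE : b = 1 + (2 * e0)%:R).
Hypothesis alphaE : forall k : 'I_m.+1, tnth alpha k = 1 + (node_double e0 n k)%:R.

Lemma jacobi_weightE (x : n.-tuple R) : @unit_cube R n x ->
  jacobi_weight 4 a b x = node_weight e0 e1 n x.
Proof.
move=> cx; rewrite /jacobi_weight /node_weight sqdisc_vandermonde.
congr (_ * _).
  by rewrite (powR_mulrn 4)// -normrX ger0_norm// (exprM _ 2 2) sqr_ge0.
apply: eq_bigr => k _; have /andP[x0 x1] := cx k.
by rewrite (powR_1D _ _ _ _ bE)// (powR_1D _ _ _ _ aE)// subr_ge0.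
Qed.

Definition jacobi_const : R :=
  (\int[lebesgue_tuple R n]_(x in @unit_cube R n) jacobi_weight 4 a b x)^-1.

Lemma jacobi_const_ge0 : 0 <= jacobi_const.
Proof. by rewrite invr_ge0 Rintegral_ge0// => x _; exact: jacobi_weight_ge0. Qed.

Lemma integral_jacobi (f : n.-tuple R -> \bar R) :
  measurable_fun setT f -> (forall x, 0 <= f x)%E ->
  (\int[jacobi 4 a b n]_x f x = jacobi_const%:E * \int[lebesgue_tuple R n]_x
     ((\1_(@unit_cube R n) x * node_weight e0 e1 n x)%:E * f x))%E.
Proof.
move=> mf f0; pose g x := jacobi_const * (\1_(@unit_cube R n) x * node_weight e0 e1 n x).
have mw : measurable_fun setT (fun x => \1_(@unit_cube R n) x * node_weight e0 e1 n x).
  apply: measurable_funM; first exact: measurable_indic (@measurable_unit_cube R n).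
  exact: (cube_bounded_node_weight e0 e1 n).1.
have w0 x : 0 <= \1_(@unit_cube R n) x * node_weight e0 e1 n x.
  by rewrite mulr_ge0// node_weight_ge0.
have mg : measurable_fun setT g by exact: measurable_funM.
have g0 x : 0 <= g x by rewrite mulr_ge0// jacobi_const_ge0.
rewrite (eq_measure_integral (mdensity (lebesgue_tuple R n) mg g0)); last first.
  move=> A mA _; rewrite /= /jacobi /mdensity -/jacobi_const.
  rewrite setIC integral_mkcondr -ge0_integralZl_EFin; last 4 first.
  - exact: mA.
  - by move=> x _; rewrite patchE; case: ifP => // _; rewrite lee_fin jacobi_weight_ge0.
  - apply: measurable_funTS; apply/(measurable_restrictT _ (@measurable_unit_cube R n)).
    apply: measurable_funTS; apply/measurable_EFinP; exact: measurable_jacobi_weight.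
  - exact: jacobi_const_ge0.
  apply: eq_integral => x _; rewrite patchE /g indicE; case: ifPn => cx.
    by rewrite jacobi_weightE ?mul1r -?EFinM//; rewrite inE in cx.
  by rewrite mul0r mulr0 mule0.
rewrite ge0_integral_density// -ge0_integralZl_EFin; last 4 first.
- exact: measurableT.
- by move=> x _; rewrite mule_ge0// lee_fin.
- by apply: emeasurable_funM => //; exact/measurable_EFinP.
- exact: jacobi_const_ge0.
by apply: eq_integral => x _; rewrite /g EFinM muleA.
Qed.

Definition dirichlet_const : R :=
  Gamma (\sum_(i < m.+1) tnth alpha i) / (\prod_(i < m.+1) Gamma (tnth alpha i)).

Lemma dirichlet_const_ge0 : 0 <= dirichlet_const.
Proof.
by rewrite divr_ge0 ?Gamma_ge0//; apply: prodr_ge0 => i _; exact: Gamma_ge0.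
Qed.

Lemma dirichletE (S : set (m.+1.-tuple R)) : measurable S ->
  dirichlet alpha S = (dirichlet_const%:E * \int[lebesgue_tuple R m]_y
    (simplex_weight e0 n m.+1 (@complete_simplex R m.+1 y) *
     \1_S (@complete_simplex R m.+1 y))%:E)%E.
Proof.
move=> mS; rewrite /dirichlet integral_mkcond -ge0_integralZl_EFin; last 4 first.
- exact: measurableT.
- by move=> y _; rewrite lee_fin mulr_ge0// simplex_weight_ge0.
- have mcs := @measurable_complete_simplex R m.+1.
  apply/measurable_EFinP/measurable_funM.
    exact: (measurableT_comp (measurable_simplex_weight e0 n m.+1) mcs).
  exact: (measurableT_comp (measurable_indic mS) mcs).
- exact: dirichlet_const_ge0.
apply: eq_integral => y _; rewrite patchE; set c := @complete_simplex R m.+1 y.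
(* A completed point always has sum 1, so the open simplex is a positivity condition, which
   [pos_power] encodes by a zero weight. *)
have [c0|/existsNP[k /negP]] := pselect (forall i, 0 < tnth c i); last first.
  rewrite -leNgt => ck.
  have -> : simplex_weight e0 n m.+1 c = 0.
    by rewrite /simplex_weight (bigD1 k)//= /pos_power ltNge ck !mul0r.
  rewrite mul0r mule0 ifF//; apply/negbTE/negP; rewrite inE => -[[c0 _] _].
  by have := c0 k; rewrite ltNge ck.
have -> : (y \in @complete_simplex R m.+1 @^-1` (@open_simplex R m.+1 `&` S)) = (c \in S).
  apply/idP/idP; rewrite !inE; first by case.
  by move=> Sc; split => //; split => //; exact: sum_complete_simplex.
rewrite indicE; case: ifP => _; last by rewrite mulr0 mule0.
rewrite mulr1 -EFinM; congr (_ * _)%:E; apply: eq_bigr => k _.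
by rewrite (powR_1D _ _ _ _ (alphaE k)) 1?ltW// /pos_power c0 mul1r.
Qed.

Lemma jacobi_dirichletE (B : set (n.-tuple R * m.+1.-tuple R)) : measurable B ->
  ((jacobi 4 a b n \x dirichlet alpha) B =
   (jacobi_const * dirichlet_const)%:E * \int[lebesgue_tuple R n]_x
     ((\1_(@unit_cube R n) x * node_weight e0 e1 n x)%:E *
      \int[lebesgue_tuple R m]_y
       (simplex_weight e0 n m.+1 (@complete_simplex R m.+1 y) *
        \1_B (x, @complete_simplex R m.+1 y))%:E))%E.
Proof.
move=> mB.
pose inner (x : n.-tuple R) : \bar R := (\int[lebesgue_tuple R m]_y
  (simplex_weight e0 n m.+1 (@complete_simplex R m.+1 y) *
   \1_B (x, @complete_simplex R m.+1 y))%:E)%E.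
have inner_ge0 x : (0 <= inner x)%E.
  by apply: integral_ge0 => y _; rewrite lee_fin mulr_ge0// simplex_weight_ge0.
have minner : measurable_fun setT inner.
  pose f (u : n.-tuple R * m.-tuple R) : \bar R :=
    (simplex_weight e0 n m.+1 (@complete_simplex R m.+1 u.2) *
     \1_B (u.1, @complete_simplex R m.+1 u.2))%:E.
  apply: (measurable_fun_fubini_tonelli_F f); last first.
    by move=> u; rewrite lee_fin mulr_ge0// simplex_weight_ge0.
  have mcs : measurable_fun setT (fun u : n.-tuple R * m.-tuple R => @complete_simplex R m.+1 u.2).
    exact: (measurableT_comp (@measurable_complete_simplex R m.+1) measurable_snd).
  apply/measurable_EFinP/measurable_funM.
    exact: (measurableT_comp (measurable_simplex_weight e0 n m.+1) mcs).
  have mp : measurable_fun setT (fun u : n.-tuple R * m.-tuple R =>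
      (u.1, @complete_simplex R m.+1 u.2) : n.-tuple R * m.+1.-tuple R).
    by apply/measurable_fun_pairP; split => //=; exact: measurable_fst.
  exact: (measurableT_comp (measurable_indic mB) mp).
transitivity (\int[jacobi 4 a b n]_x (dirichlet_const%:E * inner x))%E.
  rewrite /product_measure1; apply: eq_integral => x _ /=.
  rewrite dirichletE; last exact: measurable_xsection.
  congr (_ * _)%E; apply: eq_integral => y _; congr (_ * _)%:E.
  by rewrite !indicE mem_xsection.
rewrite integral_jacobi; last 2 first.
- by apply: emeasurable_funM => //; exact: measurable_cst.
- by move=> x; rewrite mule_ge0// lee_fin dirichlet_const_ge0.
rewrite [in RHS]EFinM -[RHS]muleA; congr (_ * _)%E.
rewrite -ge0_integralZl_EFin; last 4 first.
- exact: measurableT.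
- move=> x _; apply: mule_ge0; last exact: inner_ge0.
  by rewrite lee_fin mulr_ge0// node_weight_ge0.
- apply: emeasurable_funM; last exact: minner.
  apply/measurable_EFinP/measurable_funM; last exact: (cube_bounded_node_weight e0 e1 n).1.
  exact: measurable_indic (@measurable_unit_cube R n).
- exact: dirichlet_const_ge0.
by apply: eq_integral => x _; rewrite muleCA.
Qed.

End laws.
End jacobi_dirichlet.

(** * The law of the random moments *)

Section node_law.
Context {R : realType}.
Local Notation Rm := (measurableTypeR R).

(** Valid for arbitrary nodes and weights, so that the moments are seen to be measurable on the
    whole space and not just on the support of the law. *)
Lemma momentE (z w : seq R) j : moment (discrete_measure z w) j =
  \sum_(k < size z) `|w`_k| * (\1_(`[0, 1]%classic : set R) z`_k * z`_k ^+ j).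
Proof.
rewrite /moment /Rintegral /discrete_measure.
have mX : @measurable_fun _ _ Rm (\bar R) `[0, 1]%classic (fun t => (t ^+ j)%:E).
  by apply/measurable_EFinP; exact: measurable_funX.
have X0 (t : Rm) : `[0, 1]%classic t -> (0 <= (t ^+ j)%:E :> \bar R)%E.
  by rewrite /= in_itv/= => /andP[t0 _]; rewrite lee_fin exprn_ge0.
rewrite ge0_integral_measure_sum//=.
rewrite (eq_bigr (fun k : 'I_(size z) =>
  (`|w`_k| * (\1_(`[0, 1]%classic : set R) z`_k * z`_k ^+ j))%:E)) => [|k _].
  by rewrite sumEFin.
by rewrite ge0_integral_mscale// integral_dirac// diracE indicE.
Qed.

Section law.
Variables (e0 e1 : bool) (n m d : nat).

Definition node_measure_moments (u : n.-tuple R * m.-tuple R) : d.-tuple R :=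
  moments d (discrete_measure (cone_nodes e0 e1 u.1) u.2).

Lemma measurable_node_measure_moments :
  measurable_fun setT node_measure_moments.
Proof.
apply: measurable_mktuple => j; under eq_fun do rewrite momentE.
have sz (x : n.-tuple R) : size (cone_nodes e0 e1 x) = (n + e0 + e1)%N.
  by rewrite /cone_nodes !size_cat !size_nseq size_tuple; lia.
rewrite (_ : (fun _ => _) = fun u : n.-tuple R * m.-tuple R => \sum_(k < n + e0 + e1)
  `|u.2`_k| * (\1_(`[0, 1]%classic : set R) (cone_nodes e0 e1 u.1)`_k *
     (cone_nodes e0 e1 u.1)`_k ^+ j.+1)); last by apply/funext => u; rewrite sz.
apply: measurable_sum => k.
have mz := measurableT_comp (@measurable_cone_nodes R e0 e1 n k)
  (@measurable_fst _ _ (n.-tuple R) (m.-tuple R)).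
apply: measurable_funM; last first.
  apply: measurable_funM; last exact: (measurable_funX _ mz).
  by apply: (measurableT_comp _ mz); apply: measurable_indic; exact: measurable_itv.
have [km|km] := ltnP k m; last first.
  rewrite (_ : (fun _ => _) = fun=> 0) //.
  by apply/funext => u; rewrite nth_default ?size_tuple// normr0.
rewrite (_ : (fun _ => _) = (fun u : n.-tuple R * m.-tuple R => `|tnth u.2 (Ordinal km)|)).
  apply: measurableT_comp => //.
  exact: (measurableT_comp (@measurable_tnth _ R m (Ordinal km)) measurable_snd).
by apply/funext => u; rewrite (tnth_nth 0).
Qed.

Lemma node_measure_momentsE (u : n.-tuple R * m.-tuple R) : m = (n + e0 + e1)%N ->
  @unit_cube R n u.1 -> (forall k, 0 <= tnth u.2 k) ->
  node_measure_moments u = moment_map d e0 e1 n m u.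
Proof.
move=> mE cu w0; apply: eq_from_tnth => j; rewrite !tnth_mktuple.
have w0' k : 0 <= u.2`_k.
  have [km|km] := ltnP k m; last by rewrite nth_default ?size_tuple.
  by have := w0 (Ordinal km); rewrite (tnth_nth 0).
rewrite moment_discrete_measure//; last by move=> k; exact: cone_nodes_itv.
rewrite (_ : size _ = m); last by rewrite /cone_nodes !size_cat !size_nseq size_tuple mE; lia.
by apply: eq_bigr => k _; rewrite (tnth_nth 0).
Qed.

End law.

Lemma simplex_weight_neq0 (e0 : bool) n m (y : m.-tuple R) :
  simplex_weight e0 n m y != 0 -> forall k, 0 < tnth y k.
Proof.
move=> /prodf_neq0 H k; have := H k isT.
by rewrite /pos_power; case: ltP => //; rewrite mul0r eqxx.
Qed.

Section law.
Variables (e0 e1 : bool) (n m d : nat).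
Hypotheses (mE : m.+1 = (n + e0 + e1)%N) (dE : d.+1 = (2 * n + e0 + e1)%N).

(** With the complement of [node_moments] as A in [moments_lawE], the side of the nodes is zero by
    construction, while n! is not. *)
Lemma null_dual_node_moments :
  lebesgue_tuple R d (@dual_moment_space R d `\` @node_moments R d e0 e1 n m.+1) = 0%E.
Proof.
have mN := @measurable_node_moments R d e0 e1 n m.+1.
have := @moments_lawE R e0 e1 n m d _ mE dE (measurableC mN).
rewrite -setDE integral0_eq => [/esym/eqP|x _].
  by rewrite mule_eq0 eqe pnatr_eq0 -leqn0 leqNgt fact_gt0/= => /eqP.
rewrite indicE; have [/set_mem cx|] := boolP (x \in _); last by rewrite mul0r mul0e.
rewrite integral0_eq ?mule0// => y _; set c := @complete_simplex R m.+1 y.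
have [->|/simplex_weight_neq0 c0] := eqVneq (simplex_weight e0 n m.+1 c) 0.
  by rewrite mul0r.
rewrite indicE memNset ?mulr0//; apply; exists x, c; split => //.
- by move=> k; exact/ltW.
- exact: sum_complete_simplex.
Qed.

(** The moment space is squeezed between two measurable sets that differ by a null set; to the
    moment space itself only monotonicity is applied. *)
Lemma lebesgue_moment_space (A : set (d.-tuple R)) : measurable A ->
  lebesgue_tuple R d (moment_space d `&` A) =
  lebesgue_tuple R d (@dual_moment_space R d `&` A).
Proof.
move=> mA; have mN := @measurable_node_moments R d e0 e1 n m.+1.
have mD := @measurable_dual_moment_space R d.
apply/eqP; rewrite eq_le; apply/andP; split.
  by apply: le_lebesgue_tuple; apply: setSI; exact: moment_space_dual.
apply: (@le_trans _ _ (lebesgue_tuple R d (@node_moments R d e0 e1 n m.+1 `&` A))); last first.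
  by apply: le_lebesgue_tuple; apply: setSI; exact: node_moments_space mE.
rewrite -(measureU0 (measurableI _ _ mN mA) (measurableD mD mN) null_dual_node_moments).
apply: le_lebesgue_tuple => c [Dc Ac].
by have [Nc|Nc] := pselect (@node_moments R d e0 e1 n m.+1 c); [left|right].
Qed.

Section random_nodes.
Context d' (Omega : measurableType d') (P : probability Omega R).
Variables (a b : R) (alpha : m.+1.-tuple R).
Hypotheses (aE : a = 1 + (2 * e1)%:R) (bE : b = 1 + (2 * e0)%:R).
Hypothesis alphaE : forall k : 'I_m.+1, tnth alpha k = 1 + (node_double e0 n k)%:R.
Variables (x : Omega -> n.-tuple R) (w : Omega -> m.+1.-tuple R).
Hypothesis xw_law : has_law P (fun o => (x o, w o)) (jacobi 4 a b n \x dirichlet alpha)%E.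

Lemma law_node_measure_moments :
  has_law P (fun o => moments d (discrete_measure (cone_nodes e0 e1 (x o)) (w o)))
    (uniform_on (moment_space d)).
Proof.
have [mxw lxw] := xw_law.
have mG := @measurable_node_measure_moments e0 e1 n m.+1 d.
split; first exact: (measurableT_comp mG mxw).
pose C := jacobi_const n a b * dirichlet_const m alpha * n`!%:R.
have law A : measurable A ->
    pushforward P (fun o => moments d (discrete_measure (cone_nodes e0 e1 (x o)) (w o))) A =
    (C%:E * lebesgue_tuple R d (@dual_moment_space R d `&` A))%E.
  move=> mA.
  have mGA : measurable (@node_measure_moments e0 e1 n m.+1 d @^-1` A).
    by rewrite -[X in measurable X]setTI; exact: mG.
  have -> : pushforward P (fun o => moments d (discrete_measure (cone_nodes e0 e1 (x o)) (w o))) A =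
      pushforward P (fun o => (x o, w o)) (@node_measure_moments e0 e1 n m.+1 d @^-1` A) by [].
  rewrite lxw// (jacobi_dirichletE e0 e1 n m a b alpha aE bE alphaE)//.
  rewrite /C [in RHS]EFinM -[RHS]muleA -(moments_lawE e0 e1 n m d A mE dE mA).
  apply: (congr1 (mule _)); apply: eq_integral => t _.
  rewrite indicE; have [/set_mem ct|_] := boolP (t \in _); last by rewrite mul0r !mul0e.
  congr (_ * _)%E; apply: eq_integral => y _; set c := @complete_simplex R m.+1 y.
  have [->|/simplex_weight_neq0 c0] := eqVneq (simplex_weight e0 n m.+1 c) 0.
    by rewrite !mul0r.
  rewrite -node_measure_momentsE// => k; exact/ltW.
(* Total mass 1 identifies [C] as the inverse of the volume. *)
have lawT : (C%:E * lebesgue_tuple R d (@dual_moment_space R d) = 1)%E.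
  by rewrite -[X in lebesgue_tuple R d X]setIT -law// -(@probability_setT _ _ _ P).
move=> A mA; rewrite law// /uniform_on lebesgue_moment_space//.
rewrite -[X in fine (lebesgue_tuple R d X)]setIT lebesgue_moment_space// setIT.
congr (_%:E * _)%E; move: lawT.
(* An infinite volume would make the product 0 or infinite, never 1. *)
case: (lebesgue_tuple R d (@dual_moment_space R d)) => [l| |] /=.
- rewrite -EFinM => -[Cl].
  have l0 : l != 0 by apply: contra_eq_neq Cl => ->; rewrite mulr0 eq_sym oner_eq0.
  by rewrite -[C]mulr1 -(mulfV l0) mulrA Cl mul1r.
- rewrite mulry; case: sgrP => _; rewrite ?mul0e ?mul1e ?mulN1e => /eqP//.
  by rewrite eqe eq_sym oner_eq0.
- rewrite mulrNy; case: sgrP => _; rewrite ?mul0e ?mul1e ?mulN1e => /eqP//.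
  by rewrite eqe eq_sym oner_eq0.
Qed.

End random_nodes.
End law.
End node_law.

Theorem theorem4p8 (R : realType) (d : measure_display)
    (Omega : measurableType d) (P : probability Omega R)
    (N : nat) (N_ge1 : (1 <= N)%N) :
  [/\ forall (x : Omega -> N.-tuple R) (w : Omega -> N.-tuple R),
        has_law P (fun o => (x o, w o))
          (jacobi 4 1 1 N \x dirichlet [tuple of nseq N 2%R])%E ->
        has_law P
          (fun o => moments (2 * N - 1) (discrete_measure (x o) (w o)))
          (uniform_on (moment_space (2 * N - 1))),
      forall (x : Omega -> N.-tuple R) (w : Omega -> N.+1.-tuple R),
        has_law P (fun o => (x o, w o))
          (jacobi 4 1 3 N \x dirichlet [tuple of 1%R :: nseq N 2%R])%E ->
        has_law P
          (fun o => moments (2 * N) (discrete_measure (0 :: x o) (w o)))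
          (uniform_on (moment_space (2 * N))),
      forall (x : Omega -> N.-1.-tuple R) (w : Omega -> N.-1.+2.-tuple R),
        has_law P (fun o => (x o, w o))
          (jacobi 4 3 3 N.-1 \x
             dirichlet [tuple of 1%R :: rcons (nseq N.-1 2%R) 1%R])%E ->
        has_law P
          (fun o => moments (2 * N - 1)
                      (discrete_measure (0 :: rcons (x o) 1) (w o)))
          (uniform_on (moment_space (2 * N - 1)))
    & forall (x : Omega -> N.-tuple R) (w : Omega -> N.+1.-tuple R),
        has_law P (fun o => (x o, w o))
          (jacobi 4 3 1 N \x dirichlet [tuple of rcons (nseq N 2%R) 1%R])%E ->
        has_law P
          (fun o => moments (2 * N) (discrete_measure (rcons (x o) 1) (w o)))
          (uniform_on (moment_space (2 * N)))].
Proof.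
(* The four items are the four choices of ends, with N = k + 1; the arithmetic side conditions are
   the node count m + 1 = n + e0 + e1 and the dimension count d + 1 = 2 n + e0 + e1. *)
case: N N_ge1 => // k _; split=> x w xw_law.
- rewrite (_ : (fun o => _) = fun o => moments (2 * k.+1 - 1)
      (discrete_measure (cone_nodes false false (x o)) (w o))); last first.
    by apply/funext => o; rewrite /cone_nodes cats0.
  apply: (law_node_measure_moments false false k.+1 k (2 * k.+1 - 1) _ _ d Omega P
    1 1 [tuple of nseq k.+1 2] _ _ _ x w) => //; try lia.
  + by rewrite mulr0n addr0.
  + by rewrite mulr0n addr0.
  + by move=> i; rewrite (tnth_nth 0) [LHS]nth_nseq ltn_ord /node_double add0n ltn_ord.
- rewrite (_ : (fun o => _) = fun o => moments (2 * k.+1)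
      (discrete_measure (cone_nodes true false (x o)) (w o))); last first.
    by apply/funext => o; rewrite /cone_nodes cats0.
  apply: (law_node_measure_moments true false k.+1 k.+1 (2 * k.+1) _ _ d Omega P
    1 3 [tuple of 1 :: nseq k.+1 2] _ _ _ x w) => //; try lia.
  + by rewrite mulr0n addr0.
  + move=> i; case: (unliftP ord0 i) => [j|] ->; last first.
      by rewrite (tnth_nth 0)/= /node_double mulr0n addr0.
    by rewrite tnthS (tnth_nth 0) [LHS]nth_nseq ltn_ord /node_double lift0 add1n ltnS ltn_ord.
- rewrite (_ : (fun o => _) = fun o => moments (2 * k.+1 - 1)
      (discrete_measure (cone_nodes true true (x o)) (w o))); last first.
    by apply/funext => o; rewrite /cone_nodes /= cats1.
  apply: (law_node_measure_moments true true k k.+1 (2 * k.+1 - 1) _ _ d Omega P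
    3 3 [tuple of 1 :: rcons (nseq k 2) 1] _ _ _ x w) => //; try lia.
  + move=> i; case: (unliftP ord0 i) => [j|] ->; last first.
      by rewrite (tnth_nth 0)/= /node_double mulr0n addr0.
    rewrite tnthS (tnth_nth 0) [LHS]nth_rcons nth_nseq size_nseq /node_double lift0 add1n ltnS.
    have := ltn_ord j; rewrite ltnS leq_eqVlt; case: ltngtP => //= _ _.
    by rewrite mulr0n addr0.
- rewrite (_ : (fun o => _) = fun o => moments (2 * k.+1)
      (discrete_measure (cone_nodes false true (x o)) (w o))); last first.
    by apply/funext => o; rewrite /cone_nodes /= cats1.
  apply: (law_node_measure_moments false true k.+1 k.+1 (2 * k.+1) _ _ d Omega P
    3 1 [tuple of rcons (nseq k.+1 2) 1] _ _ _ x w) => //; try lia.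
  + by rewrite mulr0n addr0.
  + move=> i; rewrite (tnth_nth 0) [nth _ _ _]nth_rcons nth_nseq size_nseq /node_double add0n.
    have := ltn_ord i; rewrite ltnS leq_eqVlt; case: ltngtP => //= _ _.
    by rewrite mulr0n addr0.
Qed.
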